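(* Let $a,b,c\in\mathbb{C}$ with $c\neq 0,-1,-2,\dots$ and let $\varphi=1+Q$ for some $Q\in\mathcal{Q}$, with associated exceptional boundary points $\zeta_1,\dots,\zeta_n\in\partial\mathbb{D}$ (as in the definition of the class $\mathcal{Q}$). Put $p=a+b+1-c$, $A(z)=Q(z)(Q(z)+c-1)$ and $B(z)=(Q(z)+a)(Q(z)+b)$. Then the function $f(z)=z\,{}_2F_1(a,b;c;z)$ belongs to $\mathcal{S}^*(\varphi)$ if $$0<-2\operatorname{Re}\big[(pQ(\zeta)+ab)\,\overline{\zeta Q'(\zeta)}\big]$$ and $$|B(\zeta)|^2-|A(\zeta)|^2\le -2\operatorname{Re}\big[(pQ(\zeta)+ab)\,\overline{\zeta Q'(\zeta)}\big]$$ for all $\zeta\in\partial\mathbb{D}\setminus\{\zeta_1,\dots,\zeta_n\}$.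
   Context: $\mathbb{D}=\{z\in\mathbb{C}:|z|<1\}$ and $\widehat{\mathbb{C}}=\mathbb{C}\cup\{\infty\}$. For $c\neq0,-1,-2,\dots$, the hypergeometric function is ${}_2F_1(a,b;c;z)=\sum_{n=0}^\infty\frac{(a)_n(b)_n}{(c)_n\,n!}z^n$ for $|z|<1$, where $(a)_0=1$ and $(a)_n=a(a+1)\cdots(a+n-1)$ for $n\geq 1$. $\mathcal{A}_0$ is the set of analytic functions $\varphi$ on $\mathbb{D}$ with $\varphi(0)=1$, and $\mathcal{A}_1$ is the set of analytic functions $f$ on $\mathbb{D}$ with $f(0)=f'(0)-1=0$. For $\varphi\in\mathcal{A}_0$, $\mathcal{S}^*(\varphi)=\{f\in\mathcal{A}_1: zf'(z)/f(z)\prec\varphi(z)\}$ (where $zf'(z)/f(z)$ takes the value $1$ at $z=0$). Here $g\prec h$ (subordination) means that $g=h\circ\omega$ for some analytic function $\omega$ on $\mathbb{D}$ with $|\omega(z)|\le|z|$ for $z\in\mathbb{D}$. The class $\mathcal{Q}$ is the set of all analytic functions $Q$ for which there exist finitely many points $\zeta_1,\dots,\zeta_n\in\partial\mathbb{D}$ such that the following conditions hold: (i) $Q$ is analytic and univalent (injective) on a neighbourhood of $\overline{\mathbb{D}}\setminus\{\zeta_1,\dots,\zeta_n\}$; (ii) $Q(0)=0$; (iii) $Q(z)$ has a limit $w_j$ in $\widehat{\mathbb{C}}$ as $z\to\zeta_j$ in $\mathbb{D}$, for each $j=1,\dots,n$; (iv) when $w_j\in\mathbb{C}$, $(Q(z)-w_j)^{\beta_j}$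 extends to a univalent function on a neighbourhood of $z=\zeta_j$ for some number $\beta_j>1$; (v) when $w_j=\infty$, $Q(z)^{-\beta_j}$ extends to a univalent function on a neighbourhood of $z=\zeta_j$ for some number $\beta_j\ge1$; (vi) when $w_j=\infty$ and $\beta_j=1$, the derivative of $P=1/Q$ satisfies $\zeta_jP'(\zeta_j)\in\mathbb{C}\setminus[0,1]$. *)

(* Defs.v *)
(* Stdlib reals with Coquelicot's complex numbers *)
From Stdlib Require Export Reals List Factorial.
From Coquelicot Require Export Coquelicot.
Open Scope R_scope.
Open Scope C_scope.

Definition unit_disk (z : C) : Prop := Cmod z < 1.

(* Functions are total on C; only their values on the set [U] matter.
   The power series has complex coefficients and a complex variable. *)
Definition analytic_on (U : C -> Prop) (f : C -> C) : Prop :=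
  forall z0 : C, U z0 ->
  exists (r : R) (a : nat -> C), 0 < r /\
    forall z : C, Cmod (z - z0) < r ->
      @is_pseries C_AbsRing C_NormedModule a (z - z0) (f z).

Definition univalent_on (U : C -> Prop) (f : C -> C) : Prop :=
  analytic_on U f /\ forall x y : C, U x -> U y -> f x = f y -> x = y.

Definition subordinate (g h : C -> C) : Prop :=
  exists omega : C -> C,
    analytic_on unit_disk omega /\
    (forall z : C, unit_disk z -> Cmod (omega z) <= Cmod z) /\
    (forall z : C, unit_disk z -> g z = h (omega z)).

Definition class_A1 (f : C -> C) : Prop :=
  analytic_on unit_disk f /\ f 0 = 0 /\ C_derive f 0 = 1.

Definition zdlog (f : C -> C) (z : C) : C :=
  if Ceq_dec z 0 then 1 else z * C_derive f z / f z.

(* Division by zero is a total operation in [zdlog], hence the explicit clause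
   that the quotient z f'(z) / f(z) is defined on the punctured disk. *)
Definition Sstar (phi f : C -> C) : Prop :=
  class_A1 f /\
  (forall z : C, unit_disk z -> z <> 0 -> f z <> 0) /\
  subordinate (zdlog f) phi.

Definition Cexp (z : C) : C := (exp (Re z) * cos (Im z), exp (Re z) * sin (Im z))%R.

(* [k] is a branch on [U] of the real power [h ^ beta]: it is
   [exp (beta * log h)] for some analytic branch of [log h] on [U]. *)
Definition power_branch (U : C -> Prop) (h : C -> C) (beta : R) (k : C -> C) : Prop :=
  exists L : C -> C, analytic_on U L /\
    forall z : C, U z -> Cexp (L z) = h z /\ k z = Cexp (beta * L z).

(* [g] is a univalent function near [zeta] which extends (a branch of) the power
   [h ^ beta] from the part of the unit disk near [zeta]. *)
Definition univalent_power_extension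
    (h : C -> C) (beta : R) (zeta : C) (g : C -> C) : Prop :=
  exists U : C -> Prop, open (T := C_UniformSpace) U /\ U zeta /\
    univalent_on U g /\
    power_branch (fun z => U z /\ unit_disk z) h beta g.

(* The Riemann sphere is [option C], with [None] the point at infinity. *)
Definition sphere_nbhs (w : option C) : (C -> Prop) -> Prop :=
  match w with
  | Some w0 => locally (T := C_UniformSpace) w0
  | None => fun P => exists M : R, forall z : C, M < Cmod z -> P z
  end.

Definition disk_limit (Q : C -> C) (zeta : C) (w : option C) : Prop :=
  filterlim Q (within unit_disk (locally (T := C_UniformSpace) zeta))
    (sphere_nbhs w).

(* In the infinite case with [beta = 1], the extension [g] is [1 / Q] continued
   to a neighbourhood of [zeta]. *)
Definition exceptional_point (Q : C -> C) (zeta : C) : Prop :=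
  exists w : option C, disk_limit Q zeta w /\
    match w with
    | Some w0 =>
        exists (beta : R) (g : C -> C), 1 < beta /\
          univalent_power_extension (fun z => Q z - w0) beta zeta g
    | None =>
        exists (beta : R) (g : C -> C), 1 <= beta /\
          univalent_power_extension Q (- beta)%R zeta g /\
          (beta = 1%R ->
           ~ exists t : R, 0 <= t <= 1 /\ zeta * C_derive g zeta = RtoC t)
    end.

(* The class Q together with a choice [zetas] of its exceptional boundary points. *)
Definition class_Q (Q : C -> C) (zetas : list C) : Prop :=
  (forall zeta : C, In zeta zetas -> Cmod zeta = 1%R) /\
  (exists V : C -> Prop, open (T := C_UniformSpace) V /\
     (forall z : C, Cmod z <= 1 -> ~ In z zetas -> V z) /\
     univalent_on V Q) /\
  Q 0 = 0 /\
  (forall zeta : C, In zeta zetas -> exceptional_point Q zeta).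

Fixpoint pochhammer (a : C) (n : nat) : C :=
  match n with
  | O => 1
  | S m => pochhammer a m * (a + INR m)
  end.

Definition hyp2F1_term (a b c z : C) (n : nat) : C :=
  pochhammer a n * pochhammer b n / (pochhammer c n * INR (fact n)) * z ^ n.

(* [Series] is real-valued, so the complex sum is taken componentwise. *)
Definition hyp2F1 (a b c z : C) : C :=
  (Series (fun n => Re (hyp2F1_term a b c z n)),
   Series (fun n => Im (hyp2F1_term a b c z n))).

(* Main.v *)
(* Write [g = z F' / F] with [F = 2F1(a,b;c;.)], so that [z f' / f = 1 + g].  Lift [g] through [Q] to
   [om = Q^-1 o g] on the largest disk [|z| < r0] where this is possible, and suppose [r0 < 1].  By
   Schwarz's lemma [|om z| <= |z| / r0].  Let [z0] be an obstructing point of modulus [r0] and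
   [ze0] a cluster point of [om] along the radius to [z0]; necessarily [|ze0| = 1].

   If [ze0] is not exceptional, the boundary Schwarz lemma (Jack, Julia-Wolff, Miller-Mocanu) gives
   [z0 g'(z0) = m ze0 Q'(ze0)] with [m >= 1].  Writing [W = ze0 Q'(ze0)], the hypergeometric equation
   becomes [m W + A = z0 (m W + B)], while the two hypotheses say [|m W + B| <= |m W + A|] and
   [A <> B]; this contradicts [|z0| < 1].

   At an exceptional point with [beta > 1] the local power of [Q] is of size [(1 - t)^beta] at
   [om (t z0)], whereas [1 - |om (t z0)| >= 1 - t].  When [w = oo] and [beta = 1], the same boundary
   lemma applied to [1 / g] and [1 / Q] gives [ze0 (1/Q)'(ze0) = 1 / (n m)], where [n] is the order
   of the zero of [F] at [z0], contrary to (vi).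

   Analyticity of [om] comes from Cauchy's formula on circles, proved by letting the contour
   shrink: the derivative of [la |-> int f (z + la (zeta - z)) zeta / (zeta - z)] vanishes. *)

Require Import Defs.
From Stdlib Require Import Lra Lia Classical ClassicalEpsilon Ranalysis5.

(** The lift [om] lives only on the open disk [|z| < r0] and nothing is known of it at [z0]; this
    obstacle shapes the argument. Injectivity of [Q] lets [om] be picked pointwise as a preimage, so
    no continuation is involved. Its behaviour at [z0] is read off from a relation between
    [K (om z)] and [h z], where [K] is strictly differentiable at [ze0] with nonzero derivative and
    [h] is differentiable at [z0]: [K = Q], [h = g] at a regular point, [K = 1 / Q], [h = 1 / g] at
    a simple pole, and a comparison of moduli at a corner.

    Nonvanishing of [F] is carried along with the lift, because a zero of [F] is a pole of [g]; such
    a zero can be reached only where [Q] tends to infinity.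

    Holomorphy is handled as strict differentiability, which passes to compositions and local
    inverses by elementary estimates. Cauchy's formula is needed only to return to power series and
    for Schwarz's lemma. *)

Lemma Cmod_minus_sym (x y : C) : Cmod (x - y) = Cmod (y - x).
Proof. rewrite <- (Cmod_opp (x - y)); f_equal; ring. Qed.

Lemma Cmod_rtriangle (x y : C) : (Cmod x - Cmod y <= Cmod (x - y))%R.
Proof.
  pose proof (Cmod_triangle (x - y) y) as H.
  replace (x - y + y) with x in H by ring; lra.
Qed.

Lemma Cmod_triangle_minus (x y z : C) : (Cmod (x - z) <= Cmod (x - y) + Cmod (y - z))%R.
Proof.
  pose proof (Cmod_triangle (x - y) (y - z)) as H.
  replace (x - y + (y - z)) with (x - z) in H by ring; lra.
Qed.

Lemma Cmod_self_minus (x : C) : Cmod (x - x) = 0%R.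
Proof. replace (x - x) with (RtoC 0) by ring; apply Cmod_0. Qed.

Lemma Cmod_INR (n : nat) : Cmod (INR n) = INR n.
Proof. rewrite Cmod_R; apply Rabs_pos_eq, pos_INR. Qed.

Lemma Ceq_of_small (x y : C) : (forall eps : R, 0 < eps -> Cmod (x - y) <= eps) -> x = y.
Proof.
  intros H; apply Ceq_minus, Cmod_eq_0.
  destruct (Req_dec (Cmod (x - y)) 0) as [|Hn]; [assumption|exfalso].
  pose proof (Cmod_ge_0 (x - y)).
  specialize (H (Cmod (x - y) / 2)%R); lra.
Qed.

(** * Strict complex differentiability *)

(* Requiring the estimate for two moving points makes [d] a continuous function of [z]
   and gives a locally Lipschitz inverse when [d <> 0]. *)
Definition sdiff (f : C -> C) (z d : C) : Prop :=
  forall eps : R, 0 < eps -> exists delta : R, 0 < delta /\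
    forall x y : C, Cmod (x - z) < delta -> Cmod (y - z) < delta ->
      (Cmod (f x - f y - d * (x - y)) <= eps * Cmod (x - y))%R.

Lemma sdiff_ext_loc (f g : C -> C) (z d : C) (r : R) :
  0 < r -> (forall x, Cmod (x - z) < r -> f x = g x) -> sdiff f z d -> sdiff g z d.
Proof.
  intros Hr Hfg Hf eps Heps; destruct (Hf eps Heps) as [de [Hd H]].
  exists (Rmin de r); split; [now apply Rmin_pos|].
  intros x y Hx Hy; pose proof (Rmin_l de r); pose proof (Rmin_r de r).
  rewrite <- !Hfg by lra; apply H; lra.
Qed.

Lemma sdiff_lip (f : C -> C) (z d : C) : sdiff f z d ->
  exists delta : R, 0 < delta /\ forall x y : C,
    Cmod (x - z) < delta -> Cmod (y - z) < delta ->
    (Cmod (f x - f y) <= (Cmod d + 1) * Cmod (x - y))%R.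
Proof.
  intros Hf; destruct (Hf 1%R Rlt_0_1) as [de [Hd H]].
  exists de; split; [assumption|]; intros x y Hx Hy.
  pose proof (Cmod_triangle (f x - f y - d * (x - y)) (d * (x - y))) as T.
  replace (f x - f y - d * (x - y) + d * (x - y)) with (f x - f y) in T by ring.
  rewrite Cmod_mult in T; specialize (H x y Hx Hy); lra.
Qed.

Lemma sdiff_cont (f : C -> C) (z d : C) : sdiff f z d ->
  forall eps : R, 0 < eps -> exists delta : R, 0 < delta /\
    forall x : C, Cmod (x - z) < delta -> Cmod (f x - f z) < eps.
Proof.
  intros Hf eps Heps; destruct (sdiff_lip f z d Hf) as [de [Hd H]].
  pose proof (Cmod_ge_0 d).
  exists (Rmin de (eps / (Cmod d + 1))); split.
  { apply Rmin_pos; [assumption|apply Rdiv_lt_0_compat; lra]. }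
  intros x Hx; pose proof (Rmin_l de (eps / (Cmod d + 1))).
  pose proof (Rmin_r de (eps / (Cmod d + 1))).
  eapply Rle_lt_trans; [apply H; [lra|rewrite Cmod_self_minus; lra]|].
  apply Rlt_le_trans with ((Cmod d + 1) * (eps / (Cmod d + 1)))%R.
  - apply Rmult_lt_compat_l; lra.
  - right; field; lra.
Qed.

Lemma sdiff_const (c z : C) : sdiff (fun _ => c) z 0.
Proof.
  intros eps Heps; exists 1%R; split; [lra|]; intros x y _ _.
  replace (c - c - 0 * (x - y)) with (RtoC 0) by ring; rewrite Cmod_0.
  apply Rmult_le_pos; [lra|apply Cmod_ge_0].
Qed.

Lemma sdiff_id (z : C) : sdiff (fun x => x) z 1.
Proof.
  intros eps Heps; exists 1%R; split; [lra|]; intros x y _ _.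
  replace (x - y - 1 * (x - y)) with (RtoC 0) by ring; rewrite Cmod_0.
  apply Rmult_le_pos; [lra|apply Cmod_ge_0].
Qed.

Lemma sdiff_plus (f g : C -> C) (z d e : C) :
  sdiff f z d -> sdiff g z e -> sdiff (fun x => f x + g x) z (d + e).
Proof.
  intros Hf Hg eps Heps.
  destruct (Hf (eps / 2)%R) as [d1 [Hd1 H1]]; [lra|].
  destruct (Hg (eps / 2)%R) as [d2 [Hd2 H2]]; [lra|].
  exists (Rmin d1 d2); split; [now apply Rmin_pos|]; intros x y Hx Hy.
  pose proof (Rmin_l d1 d2); pose proof (Rmin_r d1 d2).
  specialize (H1 x y); specialize (H2 x y).
  replace (f x + g x - (f y + g y) - (d + e) * (x - y))
    with ((f x - f y - d * (x - y)) + (g x - g y - e * (x - y))) by ring.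
  eapply Rle_trans; [apply Cmod_triangle|]; lra.
Qed.

Lemma sdiff_comp (f g : C -> C) (z d e : C) :
  sdiff g z e -> sdiff f (g z) d -> sdiff (fun x => f (g x)) z (d * e).
Proof.
  intros Hg Hf eps Heps.
  (* The error is the outer error plus [d] times the inner one. As [k] dominates both [Cmod e + 1]
     and [Cmod d], each part is at most [eps / 2] times [Cmod (x - y)]. *)
  set (k := (Cmod d + Cmod e + 1)%R).
  pose proof (Cmod_ge_0 d); pose proof (Cmod_ge_0 e).
  assert (Hk : 0 < k) by (unfold k; lra).
  assert (He : (0 < eps / (2 * k))%R) by (apply Rdiv_lt_0_compat; lra).
  destruct (Hf _ He) as [d1 [Hd1 H1]].
  destruct (Hg _ He) as [d2 [Hd2 H2]].
  destruct (sdiff_lip g z e Hg) as [d3 [Hd3 H3]].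
  destruct (sdiff_cont g z e Hg d1 Hd1) as [d4 [Hd4 H4]].
  exists (Rmin (Rmin d2 d3) d4); split; [repeat apply Rmin_pos; assumption|].
  intros x y Hx Hy.
  pose proof (Rmin_l (Rmin d2 d3) d4); pose proof (Rmin_r (Rmin d2 d3) d4).
  pose proof (Rmin_l d2 d3); pose proof (Rmin_r d2 d3).
  assert (B1 : (Cmod (f (g x) - f (g y) - d * (g x - g y)) <=
    eps / (2 * k) * Cmod (g x - g y))%R) by (apply H1; apply H4; lra).
  assert (B2 : (Cmod (g x - g y - e * (x - y)) <= eps / (2 * k) * Cmod (x - y))%R)
    by (apply H2; lra).
  assert (B3 : (Cmod (g x - g y) <= (Cmod e + 1) * Cmod (x - y))%R) by (apply H3; lra).
  replace (f (g x) - f (g y) - d * e * (x - y)) with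
    ((f (g x) - f (g y) - d * (g x - g y)) + d * (g x - g y - e * (x - y))) by ring.
  eapply Rle_trans; [apply Cmod_triangle|]; rewrite Cmod_mult.
  pose proof (Cmod_ge_0 (x - y)).
  assert (B4 : (eps / (2 * k) * Cmod (g x - g y) <=
     eps / (2 * k) * (k * Cmod (x - y)))%R).
  { apply Rmult_le_compat_l; [lra|]; eapply Rle_trans; [apply B3|].
    apply Rmult_le_compat_r; unfold k; lra. }
  assert (B5 : (Cmod d * Cmod (g x - g y - e * (x - y)) <=
     k * (eps / (2 * k) * Cmod (x - y)))%R).
  { apply Rmult_le_compat; try apply Cmod_ge_0; [unfold k; lra|lra]. }
  replace (eps * Cmod (x - y))%R with
    (eps / (2 * k) * (k * Cmod (x - y)) + k * (eps / (2 * k) * Cmod (x - y)))%R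
    by (field; lra).
  lra.
Qed.

Lemma sdiff_sqr (z : C) : sdiff (fun x => x * x) z (2 * z).
Proof.
  intros eps Heps; exists (eps / 2)%R; split; [lra|]; intros x y Hx Hy.
  replace (x * x - y * y - 2 * z * (x - y)) with (((x - z) + (y - z)) * (x - y)) by ring.
  rewrite Cmod_mult; apply Rmult_le_compat_r; [apply Cmod_ge_0|].
  eapply Rle_trans; [apply Cmod_triangle|]; lra.
Qed.

Lemma sdiff_scal (k : C) (f : C -> C) (z d : C) :
  sdiff f z d -> sdiff (fun x => k * f x) z (k * d).
Proof.
  intros Hf eps Heps; pose proof (Cmod_ge_0 k).
  destruct (Hf (eps / (Cmod k + 1))%R) as [de [Hd H1]].
  { apply Rdiv_lt_0_compat; lra. }
  exists de; split; [assumption|]; intros x y Hx Hy; specialize (H1 x y Hx Hy).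
  replace (k * f x - k * f y - k * d * (x - y)) with (k * (f x - f y - d * (x - y))) by ring.
  rewrite Cmod_mult.
  apply Rle_trans with ((Cmod k + 1) * (eps / (Cmod k + 1) * Cmod (x - y)))%R.
  - apply Rmult_le_compat; try apply Cmod_ge_0; lra.
  - right; field; lra.
Qed.

(* Polarization: [4 f g = (f + g)^2 - (f - g)^2]. *)
Lemma sdiff_mult (f g : C -> C) (z d e : C) :
  sdiff f z d -> sdiff g z e -> sdiff (fun x => f x * g x) z (d * g z + f z * e).
Proof.
  intros Hf Hg.
  assert (H1 := sdiff_comp _ _ _ _ _ (sdiff_plus _ _ _ _ _ Hf Hg) (sdiff_sqr _)).
  assert (H2 := sdiff_comp _ _ _ _ _
    (sdiff_plus _ _ _ _ _ Hf (sdiff_scal (-(1)) _ _ _ Hg)) (sdiff_sqr _)).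
  assert (H3 := sdiff_scal (/ 4) _ _ _
    (sdiff_plus _ _ _ _ _ H1 (sdiff_scal (-(1)) _ _ _ H2))); cbv beta in H3.
  assert (H4 : RtoC 4 <> 0) by (intros E; apply RtoC_inj in E; lra).
  replace (d * g z + f z * e) with
    (/ 4 * (2 * (f z + g z) * (d + e) + - (1) * (2 * (f z + - (1) * g z) * (d + - (1) * e))))
    by (field; assumption).
  refine (sdiff_ext_loc _ _ _ _ 1 Rlt_0_1 _ H3).
  intros x _; field; assumption.
Qed.

Lemma sdiff_inv_at (z : C) : z <> 0 -> sdiff (fun x => / x) z (- / (z * z)).
Proof.
  intros Hz eps Heps; apply Cmod_gt_0 in Hz as Hm.
  set (m := Cmod z) in *.
  (* Radius [m / 2] keeps the moduli of [x] and [y] between [m / 2] and [3 / 2 * m]. The numerator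
     is then at most [5 / 2 * m * de] and the denominator at least [m ^ 4 / 4], whence the factor
     10. *)
  exists (Rmin (m / 2) (eps * (m * m * m) / 10)); split.
  { apply Rmin_pos; [lra|]. apply Rdiv_lt_0_compat; [|lra].
    repeat apply Rmult_lt_0_compat; lra. }
  intros x y Hx Hy.
  pose proof (Rmin_l (m / 2) (eps * (m * m * m) / 10)).
  pose proof (Rmin_r (m / 2) (eps * (m * m * m) / 10)).
  set (de := Rmin (m / 2) (eps * (m * m * m) / 10)) in *.
  assert (Lx : (m / 2 < Cmod x)%R).
  { pose proof (Cmod_rtriangle z x); rewrite Cmod_minus_sym in H1; fold m in H1; lra. }
  assert (Ly : (m / 2 < Cmod y)%R).
  { pose proof (Cmod_rtriangle z y); rewrite Cmod_minus_sym in H1; fold m in H1; lra. }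
  assert (Hx0 : x <> 0) by (intros E; rewrite E, Cmod_0 in Lx; lra).
  assert (Hy0 : y <> 0) by (intros E; rewrite E, Cmod_0 in Ly; lra).
  replace (/ x - / y - - / (z * z) * (x - y)) with
    ((x * (y - z) + z * (x - z)) / (x * y * z * z) * (x - y))
    by (field; auto).
  rewrite Cmod_mult; apply Rmult_le_compat_r; [apply Cmod_ge_0|].
  rewrite Cmod_div by (repeat apply Cmult_neq_0; auto).
  rewrite !Cmod_mult; fold m.
  assert (Ux : (Cmod x <= 3 / 2 * m)%R).
  { pose proof (Cmod_rtriangle x z); fold m in H1; lra. }
  assert (N : (Cmod (x * (y - z) + z * (x - z)) <= 5 / 2 * m * de)%R).
  { eapply Rle_trans; [apply Cmod_triangle|]; rewrite !Cmod_mult; fold m.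
    pose proof (Cmod_ge_0 (x - z)); pose proof (Cmod_ge_0 (y - z)).
    assert (Cmod x * Cmod (y - z) <= 3 / 2 * m * de)%R by (apply Rmult_le_compat; lra).
    assert (m * Cmod (x - z) <= m * de)%R by (apply Rmult_le_compat_l; lra).
    lra. }
  assert (Dn : (m * m * m * m / 4 <= Cmod x * Cmod y * m * m)%R).
  { assert (m / 2 * (m / 2) <= Cmod x * Cmod y)%R by (apply Rmult_le_compat; lra).
    replace (m * m * m * m / 4)%R with (m / 2 * (m / 2) * m * m)%R by field.
    repeat apply Rmult_le_compat_r; lra. }
  assert (P : (0 < m * m * m * m / 4)%R).
  { apply Rdiv_lt_0_compat; [repeat apply Rmult_lt_0_compat|]; lra. }
  apply Rmult_le_reg_r with (Cmod x * Cmod y * m * m)%R; [lra|].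
  unfold Rdiv at 1; rewrite Rmult_assoc, Rinv_l, Rmult_1_r by lra.
  eapply Rle_trans; [apply N|].
  apply Rle_trans with (eps * (m * m * m * m / 4))%R.
  - replace (eps * (m * m * m * m / 4))%R with (5 / 2 * m * (eps * (m * m * m) / 10))%R by field.
    apply Rmult_le_compat_l; lra.
  - apply Rmult_le_compat_l; lra.
Qed.

Lemma sdiff_div (f g : C -> C) (z d e : C) : g z <> 0 ->
  sdiff f z d -> sdiff g z e -> sdiff (fun x => f x / g x) z ((d * g z - f z * e) / (g z * g z)).
Proof.
  intros Hz Hf Hg.
  pose proof (sdiff_mult _ _ _ _ _ Hf (sdiff_comp _ _ _ _ _ Hg (sdiff_inv_at _ Hz))) as H.
  cbv beta in H.
  replace ((d * g z - f z * e) / (g z * g z)) with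
   (d * / g z + f z * (- / (g z * g z) * e)) by (field; assumption).
  exact H.
Qed.

Lemma sdiff_pow (f : C -> C) (z d : C) (n : nat) : sdiff f z d ->
  sdiff (fun x => f x ^ n) z (INR n * f z ^ (pred n) * d).
Proof.
  intros Hf; induction n as [|n IH].
  - simpl; replace (0 * 1 * d) with (RtoC 0) by ring; apply sdiff_const.
  - pose proof (sdiff_mult _ _ _ _ _ Hf IH) as H; cbv beta in H.
    replace (INR (S n) * f z ^ pred (S n) * d) with
      (d * f z ^ n + f z * (INR n * f z ^ pred n * d)); [exact H|].
    rewrite S_INR, RtoC_plus; destruct n as [|n]; simpl pred; [simpl; ring|].
    rewrite (Cpow_S (f z) n); ring.
Qed.

(** Both [d] and [e] approximate the same difference quotient, taken from [x] along a short real
    step [t] that stays in both neighbourhoods. This gives continuity of the derivative and its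
    uniqueness. *)
Lemma sdiff_deriv_close (f : C -> C) (z d : C) : sdiff f z d ->
  forall eps : R, 0 < eps -> exists delta : R, 0 < delta /\
    forall x e : C, Cmod (x - z) < delta -> sdiff f x e -> Cmod (e - d) <= eps.
Proof.
  intros Hf eps Heps; destruct (Hf (eps / 2)%R) as [d1 [Hd1 H1]]; [lra|].
  exists d1; split; [assumption|]; intros x e Hx He.
  destruct (He (eps / 2)%R) as [d2 [Hd2 H2]]; [lra|].
  set (t := Rmin (d2 / 2) ((d1 - Cmod (x - z)) / 2)).
  assert (Ht : 0 < t) by (apply Rmin_pos; lra).
  assert (t <= d2 / 2)%R by apply Rmin_l.
  assert (t <= (d1 - Cmod (x - z)) / 2)%R by apply Rmin_r.
  assert (E : Cmod (RtoC t) = t) by (rewrite Cmod_R; apply Rabs_pos_eq; lra).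
  assert (A1 : (Cmod (f (x + t)%C - f x - d * (x + t - x)) <= eps / 2 * Cmod (x + t - x))%R).
  { apply H1; [|assumption].
    replace (x + t - z) with (x - z + t) by ring.
    eapply Rle_lt_trans; [apply Cmod_triangle|]; lra. }
  assert (A2 : (Cmod (f (x + t)%C - f x - e * (x + t - x)) <= eps / 2 * Cmod (x + t - x))%R).
  { apply H2; [|rewrite Cmod_self_minus; assumption].
    replace (x + t - x) with (RtoC t) by ring; lra. }
  replace (x + t - x) with (RtoC t) in A1, A2 by ring; rewrite E in A1, A2.
  apply Rmult_le_reg_r with t; [assumption|].
  replace (Cmod (e - d) * t)%R with (Cmod ((e - d) * t)) by (rewrite Cmod_mult, E; reflexivity).
  replace ((e - d) * t) with ((f (x + t) - f x - d * t) - (f (x + t) - f x - e * t)) by ring.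
  eapply Rle_trans; [apply Cmod_triangle|]; rewrite Cmod_opp; lra.
Qed.

Lemma sdiff_unique (f : C -> C) (z d e : C) : sdiff f z d -> sdiff f z e -> d = e.
Proof.
  intros Hd He; symmetry; apply Ceq_of_small; intros eps Heps.
  destruct (sdiff_deriv_close f z d Hd eps Heps) as [de [Hde H]].
  apply (H z e); [rewrite Cmod_self_minus; assumption|assumption].
Qed.

(** * Comparison with the filters and the derivative of Coquelicot *)

Lemma locally_Cmod (P : C -> Prop) (z : C) :
  locally (T := C_UniformSpace) z P <->
  exists r : R, 0 < r /\ forall x : C, Cmod (x - z) < r -> P x.
Proof.
  split.
  - intros [r H]; exists r; split; [apply cond_pos|]; intros x Hx; apply H.
    now apply C_NormedModule_mixin_compat1.
  - intros [r [Hr H]].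
    (* The uniform structure of [C] is that of a product, so its balls are squares; [sqrt 2]
       compares them with disks. *)
    assert (Hs : 0 < sqrt 2) by (apply sqrt_lt_R0; lra).
    assert (Hp : (0 < r / sqrt 2)%R) by now apply Rdiv_lt_0_compat.
    exists (mkposreal _ Hp); intros x Hx; apply H.
    apply (C_NormedModule_mixin_compat2 z x (mkposreal _ Hp)) in Hx.
    simpl in Hx; replace (sqrt 2 * (r / sqrt 2))%R with r in Hx by (field; lra).
    exact Hx.
Qed.

Lemma sdiff_C_derive (f : C -> C) (z d : C) : sdiff f z d -> C_derive f z = d.
Proof.
  intros Hf; apply is_C_derive_unique; split; [apply is_linear_scal_l|].
  intros x Hx eps.
  assert (x = z).
  { symmetry; exact (is_filter_lim_locally_unique (V := AbsRing_NormedModule C_AbsRing) z x Hx). }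
  subst x; apply locally_C, locally_Cmod.
  destruct (Hf eps (cond_pos eps)) as [de [Hd H]].
  exists de; split; [assumption|]; intros y Hy.
  specialize (H y z Hy); rewrite Cmod_self_minus in H; specialize (H Hd).
  change (Cmod (f y - f z - (y - z) * d) <= eps * Cmod (y - z))%R.
  now rewrite (Cmult_comm (y - z) d).
Qed.

(** * Complex series *)

(** Half-open sums, with one term fewer than [sum_n a n]: the empty sum and the removal of the head
    need no special case. *)
Fixpoint csum (a : nat -> C) (n : nat) : C :=
  match n with O => 0 | S m => csum a m + a m end.

Fixpoint rsum (a : nat -> R) (n : nat) : R :=
  match n with O => 0%R | S m => (rsum a m + a m)%R end.

Definition csums (a : nat -> C) (l : C) : Prop :=
  forall eps : R, 0 < eps -> exists N : nat, forall n : nat, (N <= n)%nat ->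
    Cmod (csum a n - l) <= eps.

Lemma csum_ext (a b : nat -> C) (n : nat) :
  (forall k, a k = b k) -> csum a n = csum b n.
Proof. intros H; induction n as [|n IH]; simpl; [reflexivity|]. now rewrite IH, H. Qed.

Lemma csum_plus (a b : nat -> C) (n : nat) :
  csum (fun k => a k + b k) n = csum a n + csum b n.
Proof. induction n as [|n IH]; simpl; [ring|]. rewrite IH; ring. Qed.

Lemma csum_scal (k : C) (a : nat -> C) (n : nat) :
  csum (fun i => k * a i) n = k * csum a n.
Proof. induction n as [|n IH]; simpl; [ring|]. rewrite IH; ring. Qed.

Lemma csum_head (a : nat -> C) (n : nat) :
  csum a (S n) = a 0%nat + csum (fun k => a (S k)) n.
Proof. induction n as [|n IH]; [simpl; ring|]. simpl in *. rewrite IH; ring. Qed.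

Lemma csum_Cmod (a : nat -> C) (b : nat -> R) (n : nat) :
  (forall k, Cmod (a k) <= b k) -> Cmod (csum a n) <= rsum b n.
Proof.
  intros H; induction n as [|n IH]; simpl; [rewrite Cmod_0; lra|].
  eapply Rle_trans; [apply Cmod_triangle|]; specialize (H n); lra.
Qed.

Lemma csums_ext (a b : nat -> C) (l : C) :
  (forall k, a k = b k) -> csums a l -> csums b l.
Proof.
  intros H Ha eps Heps; destruct (Ha eps Heps) as [N HN]; exists N; intros n Hn.
  rewrite <- (csum_ext a b n H); auto.
Qed.

Lemma csums_unique (a : nat -> C) (l m : C) : csums a l -> csums a m -> l = m.
Proof.
  intros Hl Hm; apply Ceq_of_small; intros eps Heps.
  destruct (Hl (eps / 2)%R) as [N HN]; [lra|].
  destruct (Hm (eps / 2)%R) as [M HM]; [lra|].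
  specialize (HN (N + M)%nat ltac:(lia)); specialize (HM (N + M)%nat ltac:(lia)).
  pose proof (Cmod_triangle_minus l (csum a (N + M)) m).
  rewrite (Cmod_minus_sym l (csum a (N + M))) in H; lra.
Qed.

Lemma csums_plus (a b : nat -> C) (l m : C) :
  csums a l -> csums b m -> csums (fun k => a k + b k) (l + m).
Proof.
  intros Hl Hm eps Heps.
  destruct (Hl (eps / 2)%R) as [N HN]; [lra|].
  destruct (Hm (eps / 2)%R) as [M HM]; [lra|].
  exists (N + M)%nat; intros n Hn.
  specialize (HN n ltac:(lia)); specialize (HM n ltac:(lia)).
  rewrite csum_plus.
  replace (csum a n + csum b n - (l + m)) with ((csum a n - l) + (csum b n - m)) by ring.
  eapply Rle_trans; [apply Cmod_triangle|]; lra.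
Qed.

Lemma csums_scal (k : C) (a : nat -> C) (l : C) :
  csums a l -> csums (fun n => k * a n) (k * l).
Proof.
  intros Hl eps Heps; pose proof (Cmod_ge_0 k).
  destruct (Hl (eps / (Cmod k + 1))%R) as [N HN]; [apply Rdiv_lt_0_compat; lra|].
  exists N; intros n Hn; specialize (HN n Hn).
  rewrite csum_scal; replace (k * csum a n - k * l) with (k * (csum a n - l)) by ring.
  rewrite Cmod_mult.
  apply Rle_trans with ((Cmod k + 1) * (eps / (Cmod k + 1)))%R.
  - apply Rmult_le_compat; try apply Cmod_ge_0; lra.
  - right; field; lra.
Qed.

Lemma csums_shift (a : nat -> C) (l : C) :
  a 0%nat = 0 -> csums a l -> csums (fun n => a (S n)) l.
Proof.
  intros H0 Ha eps Heps; destruct (Ha eps Heps) as [N HN]; exists N; intros n Hn.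
  specialize (HN (S n) ltac:(lia)); rewrite csum_head, H0 in HN.
  now rewrite Cplus_0_l in HN.
Qed.

Lemma csums_Cmod_le (a : nat -> C) (l : C) (B : R) :
  csums a l -> (forall n, Cmod (csum a n) <= B) -> Cmod l <= B.
Proof.
  intros Ha HB; apply Rnot_lt_le; intros Hlt.
  destruct (Ha ((Cmod l - B) / 2)%R) as [N HN]; [lra|].
  specialize (HN N (le_n _)); specialize (HB N).
  pose proof (Cmod_rtriangle l (csum a N)); rewrite Cmod_minus_sym in H; lra.
Qed.

Lemma csum_sum_n (a : nat -> C) (n : nat) :
  sum_n (G := C_AbelianMonoid) a n = csum a (S n).
Proof.
  induction n as [|n IH]; [rewrite sum_O; simpl; ring|].
  rewrite sum_Sn, IH; reflexivity.
Qed.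

Lemma is_series_csums (a : nat -> C) (l : C) :
  is_series (K := C_AbsRing) (V := C_NormedModule) a l <-> csums a l.
Proof.
  unfold is_series, csums; split.
  - intros H eps Heps.
    assert (L : locally (T := C_UniformSpace) l (fun x => Cmod (x - l) < eps)).
    { apply locally_Cmod; exists eps; auto. }
    destruct (H _ L) as [N HN]; exists (S N); intros n Hn.
    destruct n as [|n]; [lia|]; rewrite <- csum_sum_n.
    left; apply HN; lia.
  - intros H P HP; apply locally_Cmod in HP; destruct HP as [r [Hr HP]].
    destruct (H (r / 2)%R) as [N HN]; [lra|].
    exists N; intros n Hn; apply HP.
    change (sum_n (fun n0 => a n0) n) with (sum_n (G := C_AbelianMonoid) a n).
    rewrite csum_sum_n; specialize (HN (S n) ltac:(lia)); lra.
Qed.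

Lemma pow_n_Cpow (z : C) (n : nat) : pow_n (K := C_Ring) z n = z ^ n.
Proof. induction n as [|n IH]; [reflexivity|]. simpl; now rewrite IH. Qed.

Lemma is_pseries_csums (a : nat -> C) (z l : C) :
  @is_pseries C_AbsRing C_NormedModule a z l <-> csums (fun n => a n * z ^ n) l.
Proof.
  unfold is_pseries; rewrite is_series_csums.
  assert (E : forall k, scal (pow_n (K := C_AbsRing) z k) (a k) = (a k * z ^ k : C_NormedModule)).
  { intros k; transitivity (pow_n (K := C_Ring) z k * a k); [reflexivity|].
    rewrite pow_n_Cpow; apply Cmult_comm. }
  split; apply csums_ext; intros k; [|symmetry]; apply E.
Qed.

Lemma rsum_mono (b : nat -> R) (n m : nat) :
  (forall k, 0 <= b k) -> (n <= m)%nat -> (rsum b n <= rsum b m)%R.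
Proof.
  intros Hb; induction 1 as [|m Hm IH]; simpl; [lra|]. specialize (Hb m); lra.
Qed.

Lemma csum_diff_le (a : nat -> C) (b : nat -> R) (n m : nat) :
  (forall k, Cmod (a k) <= b k) -> (n <= m)%nat ->
  (Cmod (csum a m - csum a n) <= rsum b m - rsum b n)%R.
Proof.
  intros H; induction 1 as [|m Hm IH]; simpl; [rewrite Cmod_self_minus; lra|].
  replace (csum a m + a m - csum a n) with (csum a m - csum a n + a m) by ring.
  eapply Rle_trans; [apply Cmod_triangle|]; specialize (H m); lra.
Qed.

(** Absolute convergence by domination. The partial sums of [b] increase and are bounded, hence
    converge; they control the differences of the partial sums of [a], whose real and imaginary
    parts are therefore Cauchy. *)
Lemma csums_ex (a : nat -> C) (b : nat -> R) (B : R) :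
  (forall k, Cmod (a k) <= b k) -> (forall n, rsum b n <= B) ->
  exists l, csums a l /\ Cmod l <= B.
Proof.
  intros Hab HB.
  assert (Hb : forall k, 0 <= b k).
  { intros k; eapply Rle_trans; [apply Cmod_ge_0|apply Hab]. }
  assert (Hgr : Un_growing (rsum b)).
  { intros n; apply rsum_mono; auto. }
  destruct (growing_cv (rsum b) Hgr) as [L HL].
  { exists B; intros x [n ->]; apply HB. }
  assert (HLn : forall n, (rsum b n <= L)%R) by (intros n; now apply growing_ineq).
  assert (Hcauchy : forall eps : R, 0 < eps -> exists N, forall n m, (N <= n)%nat ->
    (N <= m)%nat -> Cmod (csum a n - csum a m) < eps).
  { intros eps Heps; destruct (HL eps Heps) as [N HN]; exists N.
    assert (W : forall n m, (N <= n)%nat -> (n <= m)%nat -> Cmod (csum a m - csum a n) < eps).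
    { intros n m Hn Hm; eapply Rle_lt_trans; [apply csum_diff_le; eauto|].
      specialize (HN n Hn); unfold R_dist in HN; apply Rabs_def2 in HN.
      specialize (HLn m); lra. }
    intros n m Hn Hm; destruct (Nat.le_ge_cases n m) as [H|H].
    - rewrite Cmod_minus_sym; auto.
    - auto. }
  assert (Cre : forall p : C -> R, (forall z, Rabs (p z) <= Cmod z) ->
      (forall x y : C, p (x - y)%C = (p x - p y)%R) -> exists l, Un_cv (fun n => p (csum a n)) l).
  { intros p Hp Hpm; destruct (Rcomplete.R_complete (fun n => p (csum a n))) as [l Hl]; 
    [|exists l; exact Hl].
    intros eps Heps; destruct (Hcauchy eps Heps) as [N HN]; exists N; intros n m Hn Hm.
    unfold R_dist; rewrite <- Hpm; eapply Rle_lt_trans; [apply Hp|]; auto. }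
  destruct (Cre Re re_le_Cmod) as [x Hx]; [reflexivity|].
  destruct (Cre Im) as [y Hy]; [|reflexivity|].
  { intros z; eapply Rle_trans; [|apply Rmax_Cmod]; apply Rmax_r. }
  assert (Ha : csums a (x, y)).
  { intros eps Heps.
    destruct (Hx (eps / 2)%R) as [N HN]; [lra|].
    destruct (Hy (eps / 2)%R) as [M HM]; [lra|].
    exists (N + M)%nat; intros n Hn.
    specialize (HN n ltac:(lia)); specialize (HM n ltac:(lia)).
    unfold R_dist in *.
    eapply Rle_trans; [apply Cmod_2Rmax|].
    assert (Hs : (sqrt 2 <= 2)%R).
    { rewrite <- (sqrt_Rsqr 2) at 2 by lra; apply sqrt_le_1_alt; unfold Rsqr; lra. }
    apply Rle_trans with (2 * (eps / 2))%R; [|lra].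
    apply Rmult_le_compat; [apply sqrt_pos| |assumption|].
    - eapply Rle_trans; [apply Rabs_pos|apply Rmax_l].
    - apply Rmax_lub; left; assumption. }
  exists (x, y); split; [assumption|].
  apply (csums_Cmod_le a); [assumption|]; intros n.
  eapply Rle_trans; [apply csum_Cmod; eauto|apply HB].
Qed.

(** * Power series *)

(** Abel's description of a radius of convergence at least [r], by bounded terms at smaller radii.
    It avoids a limit superior and passes easily to [INR n * a n]. *)
Definition radius_ge (a : nat -> C) (r : R) : Prop :=
  forall s : R, (0 < s < r)%R -> exists M : R, forall n, (Cmod (a n) * s ^ n <= M)%R.

Lemma rsum_geom (q : R) (n : nat) : (0 <= q < 1)%R -> (rsum (fun k => q ^ k) n <= / (1 - q))%R.
Proof.
  intros Hq; assert (E : (rsum (fun k => q ^ k) n * (1 - q) = 1 - q ^ n)%R).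
  { induction n as [|n IH]; simpl; [ring|]. rewrite Rmult_plus_distr_r, IH; ring. }
  assert (0 <= q ^ n)%R by (apply pow_le; lra).
  apply Rmult_le_reg_r with (1 - q)%R; [lra|]; rewrite E, Rinv_l; lra.
Qed.

Lemma rsum_scal (k : R) (a : nat -> R) (n : nat) :
  rsum (fun i => (k * a i)%R) n = (k * rsum a n)%R.
Proof. induction n as [|n IH]; simpl; [ring|]. rewrite IH; ring. Qed.

Lemma rsum_le (a b : nat -> R) (n : nat) :
  (forall k, a k <= b k) -> (rsum a n <= rsum b n)%R.
Proof. intros H; induction n as [|n IH]; simpl; [lra|]. specialize (H n); lra. Qed.

(** Each of the [n] terms [q ^ m] with [m < n] is at least [q ^ n], so the geometric sum
    dominates. *)
Lemma INR_pow_bound (q : R) (n : nat) : (0 <= q < 1)%R -> (INR n * q ^ n <= / (1 - q))%R.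
Proof.
  intros Hq; eapply Rle_trans; [|apply (rsum_geom q n Hq)].
  assert (G : forall m, (m <= n)%nat -> (INR m * q ^ n <= rsum (fun k => q ^ k) m)%R).
  { induction m as [|m IH]; intros Hm; [simpl; lra|].
    rewrite S_INR; simpl rsum; specialize (IH ltac:(lia)).
    enough (q ^ n <= q ^ m)%R by lra.
    replace n with (m + (n - m))%nat by lia; rewrite pow_add.
    rewrite <- (Rmult_1_r (q ^ m)) at 2; apply Rmult_le_compat_l; [apply pow_le; lra|].
    rewrite <- (pow1 (n - m)); apply pow_incr; lra. }
  now apply G.
Qed.

Lemma radius_ge_INR (a : nat -> C) (r : R) :
  radius_ge a r -> radius_ge (fun n => INR n * a n) r.
Proof.
  (* At the intermediate radius [t] the terms are bounded; the factor [(s / t) ^ n] that remains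
     absorbs [INR n]. *)
  intros Ha s Hs; set (t := ((s + r) / 2)%R).
  assert (Ht : (s < t < r)%R) by (unfold t; lra).
  destruct (Ha t) as [M HM]; [lra|].
  assert (Hq : (0 <= s / t < 1)%R).
  { split; [apply Rdiv_le_0_compat; lra|]. apply Rmult_lt_reg_r with t; [lra|].
    unfold Rdiv; rewrite Rmult_assoc, Rinv_l; lra. }
  exists (M * / (1 - s / t))%R; intros n.
  rewrite Cmod_mult, Cmod_INR.
  replace (s ^ n)%R with (t ^ n * (s / t) ^ n)%R.
  2:{ rewrite <- Rpow_mult_distr; f_equal; field; lra. }
  replace (INR n * Cmod (a n) * (t ^ n * (s / t) ^ n))%R with
    ((Cmod (a n) * t ^ n) * (INR n * (s / t) ^ n))%R by ring.
  apply Rmult_le_compat.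
  - apply Rmult_le_pos; [apply Cmod_ge_0|apply pow_le; lra].
  - apply Rmult_le_pos; [apply pos_INR|apply pow_le; lra].
  - apply HM.
  - apply INR_pow_bound; lra.
Qed.

Lemma radius_ge_rsum (a : nat -> C) (r s : R) : (0 < s < r)%R -> radius_ge a r ->
  exists K : R, forall n, (rsum (fun k => Cmod (a k) * s ^ k) n <= K)%R.
Proof.
  intros Hs Ha; set (t := ((s + r) / 2)%R).
  assert (Ht : (s < t < r)%R) by (unfold t; lra).
  destruct (Ha t) as [M HM]; [lra|].
  assert (Hq : (0 <= s / t < 1)%R).
  { split; [apply Rdiv_le_0_compat; lra|]. apply Rmult_lt_reg_r with t; [lra|].
    unfold Rdiv; rewrite Rmult_assoc, Rinv_l; lra. }
  assert (HM0 : (0 <= M)%R).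
  { eapply Rle_trans; [|apply (HM 0%nat)]; apply Rmult_le_pos; [apply Cmod_ge_0|simpl; lra]. }
  exists (M * / (1 - s / t))%R; intros n.
  apply Rle_trans with (rsum (fun k => M * (s / t) ^ k)%R n).
  - apply rsum_le; intros k.
    replace (s ^ k)%R with (t ^ k * (s / t) ^ k)%R.
    2:{ rewrite <- Rpow_mult_distr; f_equal; field; lra. }
    rewrite <- Rmult_assoc; apply Rmult_le_compat_r; [apply pow_le; lra|apply HM].
  - rewrite rsum_scal; apply Rmult_le_compat_l; [assumption|]. now apply rsum_geom.
Qed.

Lemma radius_ge_csums (a : nat -> C) (r : R) (z : C) : Cmod z < r -> radius_ge a r ->
  exists l, csums (fun n => a n * z ^ n) l.
Proof.
  intros Hz Ha; set (s := ((Cmod z + r) / 2)%R); pose proof (Cmod_ge_0 z).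
  destruct (radius_ge_rsum a r s) as [K HK]; [unfold s; lra|assumption|].
  destruct (csums_ex (fun n => a n * z ^ n) (fun k => Cmod (a k) * s ^ k)%R K) as [l [Hl _]];
    [|assumption|eauto].
  intros k; rewrite Cmod_mult, Cmod_pow; apply Rmult_le_compat_l; [apply Cmod_ge_0|].
  apply pow_incr; unfold s; lra.
Qed.

(** A term is the difference of two consecutive partial sums, so from some index on its modulus is
    at most 2; the finitely many earlier terms are bounded separately. *)
Lemma csums_radius_ge (a : nat -> C) (r : R) :
  (forall z, Cmod z < r -> exists l, csums (fun n => a n * z ^ n) l) -> radius_ge a r.
Proof.
  intros H s Hs.
  assert (Es : Cmod (RtoC s) = s) by (rewrite Cmod_R; apply Rabs_pos_eq; lra).
  destruct (H (RtoC s)) as [l Hl]; [rewrite Es; lra|].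
  destruct (Hl 1%R Rlt_0_1) as [N HN].
  assert (B : forall n, (N <= n)%nat -> (Cmod (a n) * s ^ n <= 2)%R).
  { intros n Hn; rewrite <- Es, <- Cmod_pow, <- Cmod_mult.
    assert (A1 := HN n Hn); assert (A2 := HN (S n) ltac:(lia)); simpl in A2.
    replace (a n * s ^ n) with ((csum (fun n => a n * s ^ n) n + a n * s ^ n - l) -
      (csum (fun n => a n * s ^ n) n - l)) by ring.
    eapply Rle_trans; [apply Cmod_triangle|]; rewrite Cmod_opp; lra. }
  assert (Fin : forall n, exists M, forall k, (k < n)%nat -> (Cmod (a k) * s ^ k <= M)%R).
  { induction n as [|n [M HM]]; [exists 0%R; intros; lia|].
    exists (Rmax M (Cmod (a n) * s ^ n)); intros k Hk.
    destruct (Nat.eq_dec k n) as [->|]; [apply Rmax_r|].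
    eapply Rle_trans; [apply HM; lia|apply Rmax_l]. }
  destruct (Fin N) as [M HM]; exists (Rmax M 2); intros n.
  destruct (Nat.lt_ge_cases n N) as [L|L].
  - eapply Rle_trans; [apply HM; assumption|apply Rmax_l].
  - eapply Rle_trans; [apply B; assumption|apply Rmax_r].
Qed.

(** The factor [s] on the left stands for the exponent [n - 1] on the right, which would misbehave
    at [n = 0]. *)
Lemma Cpow_diff_bound (s de : R) (x z : C) (n : nat) : (0 < s)%R ->
  Cmod x <= s -> Cmod z <= s -> Cmod (x - z) <= de ->
  (Cmod (x ^ n - z ^ n) * s <= INR n * s ^ n * de)%R.
Proof.
  intros Hs Hx Hz Hd; induction n as [|n IH].
  - simpl; rewrite Cmod_self_minus; lra.
  - rewrite !Cpow_S, S_INR.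
    replace (x * x ^ n - z * z ^ n) with (x * (x ^ n - z ^ n) + (x - z) * z ^ n) by ring.
    assert (T := Cmod_triangle (x * (x ^ n - z ^ n)) ((x - z) * z ^ n)).
    rewrite !Cmod_mult, Cmod_pow in T.
    assert (P : (Cmod z ^ n <= s ^ n)%R) by (apply pow_incr; split; [apply Cmod_ge_0|assumption]).
    assert (0 <= Cmod z ^ n)%R by (apply pow_le, Cmod_ge_0).
    pose proof (Cmod_ge_0 x); pose proof (Cmod_ge_0 (x - z)).
    pose proof (Cmod_ge_0 (x ^ n - z ^ n)).
    assert (A1 : (Cmod x * Cmod (x ^ n - z ^ n) * s <= s * (INR n * s ^ n * de))%R).
    { rewrite Rmult_assoc; apply Rmult_le_compat; [assumption| |assumption|assumption].
      apply Rmult_le_pos; lra. }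
    assert (A2 : (Cmod (x - z) * Cmod z ^ n * s <= de * s ^ n * s)%R).
    { apply Rmult_le_compat_r; [lra|]; now apply Rmult_le_compat. }
    simpl pow; nra.
Qed.

(** Second-order companion of [Cpow_diff_bound], with [s * s] standing for the exponent [n - 2]. The
    factor [Cmod (x - y)] is what two moving points require, and [n ^ 2 + 2 * n <= (n + 1) ^ 2]
    closes the induction. *)
Lemma Cpow_strict_bound (s de : R) (x y z : C) (n : nat) : (0 < s)%R ->
  Cmod x <= s -> Cmod y <= s -> Cmod z <= s -> Cmod (x - z) <= de -> Cmod (y - z) <= de ->
  (Cmod (x ^ n - y ^ n - INR n * z ^ pred n * (x - y)) * (s * s) <=
   INR n * INR n * s ^ n * (de * Cmod (x - y)))%R.
Proof.
  intros Hs Hx Hy Hz Hdx Hdy; induction n as [|n IH].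
  - simpl; replace (1 - 1 - 0 * 1 * (x - y)) with (RtoC 0) by ring; rewrite Cmod_0; lra.
  - assert (E : x ^ S n - y ^ S n - INR (S n) * z ^ pred (S n) * (x - y) =
      y * (x ^ n - y ^ n - INR n * z ^ pred n * (x - y)) +
      (x - y) * ((x ^ n - z ^ n) + INR n * (z ^ pred n * (y - z)))).
    { rewrite S_INR, RtoC_plus; destruct n as [|n]; [simpl; ring|].
      simpl pred; rewrite !(Cpow_S _ (S n)), (Cpow_S z n); ring. }
    rewrite E; clear E.
    set (D := x ^ n - y ^ n - INR n * z ^ pred n * (x - y)) in *.
    set (G := (x ^ n - z ^ n) + INR n * (z ^ pred n * (y - z))).
    assert (Hde : (0 <= de)%R) by (eapply Rle_trans; [apply Cmod_ge_0|eassumption]).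
    assert (BG : (Cmod G * s <= 2 * (INR n * s ^ n * de))%R).
    { pose proof (Cpow_diff_bound s de x z n Hs Hx Hz Hdx) as B1.
      assert (B2 : (Cmod (INR n * (z ^ pred n * (y - z))) * s <= INR n * s ^ n * de)%R).
      { rewrite !Cmod_mult, Cmod_INR, Cmod_pow.
        destruct n as [|n]; [simpl; lra|]; simpl pred.
        assert (P : (Cmod z ^ n <= s ^ n)%R)
          by (apply pow_incr; split; [apply Cmod_ge_0|assumption]).
        replace (INR (S n) * (Cmod z ^ n * Cmod (y - z)) * s)%R with
          (INR (S n) * (s * (Cmod z ^ n * Cmod (y - z))))%R by ring.
        rewrite Rmult_assoc; apply Rmult_le_compat_l; [apply pos_INR|].
        change (s ^ S n)%R with (s * s ^ n)%R; rewrite Rmult_assoc.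
        apply Rmult_le_compat_l; [lra|].
        apply Rmult_le_compat; [apply pow_le, Cmod_ge_0|apply Cmod_ge_0|assumption|assumption]. }
      assert (T := Cmod_triangle (x ^ n - z ^ n) (INR n * (z ^ pred n * (y - z)))).
      fold G in T; nra. }
    assert (T := Cmod_triangle (y * D) ((x - y) * G)); rewrite !Cmod_mult in T.
    pose proof (Cmod_ge_0 D); pose proof (Cmod_ge_0 G); pose proof (Cmod_ge_0 y).
    pose proof (Cmod_ge_0 (x - y)); pose proof (pos_INR n).
    assert (0 < s ^ n)%R by (apply pow_lt; lra).
    set (u := Cmod (x - y)) in *; set (c := Cmod (y * D + (x - y) * G)) in *.
    assert (A1 : (Cmod y * Cmod D * (s * s) <= s * (INR n * INR n * s ^ n * (de * u)))%R).
    { rewrite Rmult_assoc; apply Rmult_le_compat; [assumption| |assumption|assumption].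
      apply Rmult_le_pos; nra. }
    assert (A2 : (u * Cmod G * (s * s) <= u * (2 * (INR n * s ^ n * de)) * s)%R).
    { replace (u * Cmod G * (s * s))%R with (u * (Cmod G * s) * s)%R by ring.
      apply Rmult_le_compat_r; [lra|]; now apply Rmult_le_compat_l. }
    assert (A3 : (0 <= s * (s ^ n * (de * u)))%R).
    { repeat apply Rmult_le_pos; lra. }
    rewrite S_INR; simpl pow.
    apply Rle_trans with ((Cmod y * Cmod D + u * Cmod G) * (s * s))%R.
    { apply Rmult_le_compat_r; [nra|assumption]. }
    lra.
Qed.

Lemma power_series_sdiff (a : nat -> C) (r : R) (f : C -> C) (z : C) :
  (forall x, Cmod x < r -> csums (fun n => a n * x ^ n) (f x)) -> Cmod z < r ->
  exists d, sdiff f z d /\ csums (fun n => INR n * a n * z ^ pred n) d.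
Proof.
  intros Hf Hz.
  assert (Ha : radius_ge a r) by (apply csums_radius_ge; eauto).
  pose proof (Cmod_ge_0 z) as Hz0.
  set (s := ((Cmod z + r) / 2)%R).
  assert (Hs : (0 < s < r)%R) by (unfold s; lra).
  assert (Hzs : (Cmod z < s)%R) by (unfold s; lra).
  destruct (radius_ge_rsum _ r s Hs (radius_ge_INR _ _ Ha)) as [K1 HK1].
  destruct (radius_ge_rsum _ r s Hs (radius_ge_INR _ _ (radius_ge_INR _ _ Ha))) as [K2 HK2].
  assert (HK0 : (0 <= K2)%R) by (apply (HK2 0%nat)).
  destruct (csums_ex (fun n => INR n * a n * z ^ pred n)
    (fun k => / s * (Cmod (INR k * a k) * s ^ k))%R (/ s * K1)%R) as [d [Hd _]].
  { intros [|k].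
    - simpl; rewrite !Cmult_0_l, Cmod_0; lra.
    - simpl pred; change (s ^ S k)%R with (s * s ^ k)%R.
      replace (/ s * (Cmod (INR (S k) * a (S k)) * (s * s ^ k)))%R with
        (Cmod (INR (S k) * a (S k)) * s ^ k)%R by (field; lra).
      rewrite Cmod_mult, Cmod_pow; apply Rmult_le_compat_l; [apply Cmod_ge_0|].
      apply pow_incr; lra. }
  { intros n; rewrite rsum_scal; apply Rmult_le_compat_l; [|apply HK1].
    left; apply Rinv_0_lt_compat; lra. }
  exists d; split; [|assumption].
  intros eps Heps.
  (* [K2] bounds the sums of [n ^ 2 * |a n| * s ^ n], so adding up [Cpow_strict_bound] over all
     terms gives a total error of at most [L * de * Cmod (x - y)]. *)
  set (L := (K2 / (s * s))%R).
  assert (HL : (0 <= L)%R) by (apply Rdiv_le_0_compat; [assumption|nra]).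
  exists (Rmin (s - Cmod z) (eps / (L + 1))); split.
  { apply Rmin_pos; [lra|]; apply Rdiv_lt_0_compat; lra. }
  intros x y Hx Hy.
  pose proof (Rmin_l (s - Cmod z) (eps / (L + 1))).
  pose proof (Rmin_r (s - Cmod z) (eps / (L + 1))).
  set (de := Rmin (s - Cmod z) (eps / (L + 1))) in *.
  pose proof (Cmod_rtriangle x z); pose proof (Cmod_rtriangle y z).
  assert (Hxs : Cmod x <= s) by lra; assert (Hys : Cmod y <= s) by lra.
  assert (S1 := csums_plus _ _ _ _ (Hf x ltac:(lra)) (csums_plus _ _ _ _
    (csums_scal (-(1)) _ _ (Hf y ltac:(lra))) (csums_scal (- (x - y)) _ _ Hd))).
  replace (f x - f y - d * (x - y)) with (f x + (- (1) * f y + - (x - y) * d)) by ring.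
  set (u := Cmod (x - y)).
  assert (Hu : (0 <= u)%R) by apply Cmod_ge_0.
  assert (Hde : (0 <= de)%R) by (pose proof (Cmod_ge_0 (x - z)); lra).
  apply Rle_trans with (L * (de * u))%R.
  - apply (csums_Cmod_le _ _ _ S1); intros n; eapply Rle_trans.
    + apply (csum_Cmod _ (fun k => / (s * s) * (de * u) *
        (Cmod (INR k * (INR k * a k)) * s ^ k))%R); intros k.
      replace (a k * x ^ k + (- (1) * (a k * y ^ k) + - (x - y) * (INR k * a k * z ^ pred k)))
        with (a k * (x ^ k - y ^ k - INR k * z ^ pred k * (x - y))) by ring.
      rewrite !Cmod_mult, !Cmod_INR.
      assert (B := Cpow_strict_bound s de x y z k ltac:(lra) Hxs Hys ltac:(lra)
        ltac:(lra) ltac:(lra)); fold u in B.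
      apply Rmult_le_reg_r with (s * s)%R; [nra|].
      replace (/ (s * s) * (de * u) * (INR k * (INR k * Cmod (a k)) * s ^ k) * (s * s))%R
        with (Cmod (a k) * (INR k * INR k * s ^ k * (de * u)))%R by (field; lra).
      rewrite Rmult_assoc; apply Rmult_le_compat_l; [apply Cmod_ge_0|exact B].
    + rewrite rsum_scal; unfold L, Rdiv.
      replace (K2 * / (s * s) * (de * u))%R with (/ (s * s) * (de * u) * K2)%R by ring.
      apply Rmult_le_compat_l; [|apply HK2].
      apply Rmult_le_pos; [left; apply Rinv_0_lt_compat; nra|nra].
  - rewrite <- Rmult_assoc; apply Rmult_le_compat_r; [assumption|].
    apply Rle_trans with ((L + 1) * (eps / (L + 1)))%R.
    + apply Rmult_le_compat; lra.
    + right; field; lra.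
Qed.

Lemma analytic_on_sdiff (U : C -> Prop) (f : C -> C) (z : C) :
  analytic_on U f -> U z -> exists d, sdiff f z d.
Proof.
  intros Hf Hz; destruct (Hf z Hz) as [r [a [Hr Ha]]].
  destruct (power_series_sdiff a r (fun h => f (z + h)) 0) as [d [Hd _]].
  - intros x Hx; apply is_pseries_csums.
    specialize (Ha (z + x)); replace (z + x - z) with x in Ha by ring; auto.
  - rewrite Cmod_0; assumption.
  - exists (d * 1).
    assert (Hs : sdiff (fun x => x + (- z)) z 1).
    { pose proof (sdiff_plus _ _ _ _ _ (sdiff_id z) (sdiff_const (- z) z)) as H.
      now replace (1 + 0) with (RtoC 1) in H by ring. }
    refine (sdiff_ext_loc _ f _ _ 1 Rlt_0_1 _
      (sdiff_comp (fun h => f (z + h)) (fun x => x + - z) z d 1 Hs _)).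
    + intros x _; cbv beta; f_equal; ring.
    + now replace (z + - z) with (RtoC 0) by ring.
Qed.

(** * Cauchy's formula on circles *)

(** Stated with [Cmod] so that it composes with [sdiff]; [curve_derive_is_derive] translates it for
    the fundamental theorem of calculus. *)
Definition curve_derive (g : R -> C) (t : R) (l : C) : Prop :=
  forall eps : R, 0 < eps -> exists delta : R, 0 < delta /\
    forall s : R, Rabs (s - t) < delta ->
      (Cmod (g s - g t - (s - t)%R * l) <= eps * Rabs (s - t))%R.

Definition curve_cont (g : R -> C) (t : R) : Prop :=
  forall eps : R, 0 < eps -> exists delta : R, 0 < delta /\
    forall s : R, Rabs (s - t) < delta -> Cmod (g s - g t) < eps.

Lemma curve_derive_is_derive (g : R -> C) (t : R) (l : C) :
  curve_derive g t l -> is_derive (K := R_AbsRing) (V := C_R_NormedModule) g t l.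
Proof.
  intros H; split; [apply is_linear_scal_l|].
  intros x Hx eps.
  assert (x = t).
  { symmetry; exact (is_filter_lim_locally_unique (V := R_NormedModule) t x Hx). }
  subst x; destruct (H eps (cond_pos eps)) as [de [Hd Hs]].
  exists (mkposreal de Hd); intros s Hst.
  specialize (Hs s Hst).
  rewrite Cmod_norm, <- (scal_R_Cmult (s - t) l) in Hs; exact Hs.
Qed.

Lemma is_derive_real_eps (f : R -> R) (t l : R) : is_derive f t l ->
  forall eps : R, 0 < eps -> exists delta : R, 0 < delta /\
    forall s : R, Rabs (s - t) < delta ->
      (Rabs (f s - f t - (s - t) * l) <= eps * Rabs (s - t))%R.
Proof.
  intros [_ H] eps Heps.
  destruct (H t (fun P HP => HP) (mkposreal eps Heps)) as [de Hd].
  exists de; split; [apply cond_pos|]; intros s Hs; exact (Hd s Hs).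
Qed.

Lemma curve_derive_pair (f g : R -> R) (t a b : R) : is_derive f t a -> is_derive g t b ->
  curve_derive (fun s => (f s, g s)) t (a, b).
Proof.
  intros Hf Hg eps Heps.
  destruct (is_derive_real_eps f t a Hf (eps / 2)) as [d1 [Hd1 H1]]; [lra|].
  destruct (is_derive_real_eps g t b Hg (eps / 2)) as [d2 [Hd2 H2]]; [lra|].
  exists (Rmin d1 d2); split; [now apply Rmin_pos|]; intros s Hs.
  pose proof (Rmin_l d1 d2); pose proof (Rmin_r d1 d2).
  specialize (H1 s ltac:(lra)); specialize (H2 s ltac:(lra)).
  eapply Rle_trans; [apply Cmod_2Rmax|].
  assert (Hs2 : (sqrt 2 <= 2)%R).
  { rewrite <- (sqrt_Rsqr 2) at 2 by lra; apply sqrt_le_1_alt; unfold Rsqr; lra. }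
  replace (eps * Rabs (s - t))%R with (2 * (eps / 2 * Rabs (s - t)))%R by field.
  apply Rmult_le_compat; [apply sqrt_pos| |assumption|].
  - eapply Rle_trans; [apply Rabs_pos|apply Rmax_l].
  - apply Rmax_lub; simpl; [eapply Rle_trans; [|apply H1]|eapply Rle_trans; [|apply H2]];
      right; f_equal; ring.
Qed.

Lemma curve_derive_lip (g : R -> C) (t : R) (l : C) : curve_derive g t l ->
  exists delta : R, 0 < delta /\ forall s : R, Rabs (s - t) < delta ->
    (Cmod (g s - g t) <= (Cmod l + 1) * Rabs (s - t))%R.
Proof.
  intros H; destruct (H 1%R Rlt_0_1) as [de [Hd Hs]].
  exists de; split; [assumption|]; intros s Hst; specialize (Hs s Hst).
  pose proof (Cmod_triangle (g s - g t - (s - t)%R * l) ((s - t)%R * l)) as T.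
  replace (g s - g t - (s - t)%R * l + (s - t)%R * l) with (g s - g t) in T by ring.
  rewrite Cmod_mult, Cmod_R in T; lra.
Qed.

Lemma curve_derive_cont (g : R -> C) (t : R) (l : C) : curve_derive g t l -> curve_cont g t.
Proof.
  intros H eps Heps; destruct (curve_derive_lip g t l H) as [de [Hd Hs]].
  pose proof (Cmod_ge_0 l).
  exists (Rmin de (eps / (Cmod l + 1))); split.
  { apply Rmin_pos; [assumption|apply Rdiv_lt_0_compat; lra]. }
  intros s Hst; pose proof (Rmin_l de (eps / (Cmod l + 1))).
  pose proof (Rmin_r de (eps / (Cmod l + 1))).
  eapply Rle_lt_trans; [apply Hs; lra|].
  apply Rlt_le_trans with ((Cmod l + 1) * (eps / (Cmod l + 1)))%R.
  - apply Rmult_lt_compat_l; lra.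
  - right; field; lra.
Qed.

Lemma curve_cont_comp (f : C -> C) (g : R -> C) (t : R) :
  (forall eps : R, 0 < eps -> exists delta : R, 0 < delta /\
    forall x : C, Cmod (x - g t) < delta -> Cmod (f x - f (g t)) < eps) ->
  curve_cont g t -> curve_cont (fun s => f (g s)) t.
Proof.
  intros Hf Hg eps Heps; destruct (Hf eps Heps) as [d1 [Hd1 H1]].
  destruct (Hg d1 Hd1) as [d2 [Hd2 H2]]; exists d2; split; auto.
Qed.

Lemma sdiff_curve (f : C -> C) (g : R -> C) (t : R) (d l : C) :
  sdiff f (g t) d -> curve_derive g t l -> curve_derive (fun s => f (g s)) t (d * l).
Proof.
  intros Hf Hg eps Heps.
  set (k := (Cmod d + Cmod l + 1)%R).
  pose proof (Cmod_ge_0 d); pose proof (Cmod_ge_0 l).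
  assert (Hk : 0 < k) by (unfold k; lra).
  assert (He : (0 < eps / (2 * k))%R) by (apply Rdiv_lt_0_compat; lra).
  destruct (Hf _ He) as [d1 [Hd1 H1]].
  destruct (Hg _ He) as [d2 [Hd2 H2]].
  destruct (curve_derive_lip g t l Hg) as [d3 [Hd3 H3]].
  destruct (curve_derive_cont g t l Hg d1 Hd1) as [d4 [Hd4 H4]].
  exists (Rmin (Rmin d2 d3) d4); split; [repeat apply Rmin_pos; assumption|].
  intros s Hs.
  pose proof (Rmin_l (Rmin d2 d3) d4); pose proof (Rmin_r (Rmin d2 d3) d4).
  pose proof (Rmin_l d2 d3); pose proof (Rmin_r d2 d3).
  assert (B1 : (Cmod (f (g s) - f (g t) - d * (g s - g t)) <=
    eps / (2 * k) * Cmod (g s - g t))%R).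
  { apply H1; [apply H4; lra|rewrite Cmod_self_minus; assumption]. }
  assert (B2 : (Cmod (g s - g t - (s - t)%R * l) <= eps / (2 * k) * Rabs (s - t))%R)
    by (apply H2; lra).
  assert (B3 : (Cmod (g s - g t) <= (Cmod l + 1) * Rabs (s - t))%R) by (apply H3; lra).
  replace (f (g s) - f (g t) - (s - t)%R * (d * l)) with
    ((f (g s) - f (g t) - d * (g s - g t)) + d * (g s - g t - (s - t)%R * l)) by ring.
  eapply Rle_trans; [apply Cmod_triangle|]; rewrite Cmod_mult.
  pose proof (Rabs_pos (s - t)).
  assert (B4 : (eps / (2 * k) * Cmod (g s - g t) <=
     eps / (2 * k) * (k * Rabs (s - t)))%R).
  { apply Rmult_le_compat_l; [lra|]; eapply Rle_trans; [apply B3|].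
    apply Rmult_le_compat_r; unfold k; lra. }
  assert (B5 : (Cmod d * Cmod (g s - g t - (s - t)%R * l) <=
     k * (eps / (2 * k) * Rabs (s - t)))%R).
  { apply Rmult_le_compat; try apply Cmod_ge_0; [unfold k; lra|lra]. }
  replace (eps * Rabs (s - t))%R with
    (eps / (2 * k) * (k * Rabs (s - t)) + k * (eps / (2 * k) * Rabs (s - t)))%R
    by (field; lra).
  lra.
Qed.

Lemma curve_cont_mult (f g : R -> C) (t : R) :
  curve_cont f t -> curve_cont g t -> curve_cont (fun s => f s * g s) t.
Proof.
  intros Hf Hg eps Heps.
  set (k := (Cmod (f t) + Cmod (g t) + 1)%R).
  pose proof (Cmod_ge_0 (f t)); pose proof (Cmod_ge_0 (g t)).
  assert (Hk : 0 < k) by (unfold k; lra).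
  assert (He : (0 < eps / (4 * k))%R) by (apply Rdiv_lt_0_compat; lra).
  destruct (Hf (Rmin 1 (eps / (4 * k)))) as [d1 [Hd1 H1]]; [apply Rmin_pos; lra|].
  destruct (Hg (eps / (4 * k))%R He) as [d2 [Hd2 H2]].
  exists (Rmin d1 d2); split; [now apply Rmin_pos|]; intros s Hs.
  pose proof (Rmin_l d1 d2); pose proof (Rmin_r d1 d2).
  pose proof (Rmin_l 1 (eps / (4 * k))); pose proof (Rmin_r 1 (eps / (4 * k))).
  specialize (H1 s ltac:(lra)); specialize (H2 s ltac:(lra)).
  replace (f s * g s - f t * g t) with (f s * (g s - g t) + (f s - f t) * g t) by ring.
  eapply Rle_lt_trans; [apply Cmod_triangle|]; rewrite !Cmod_mult.
  pose proof (Cmod_rtriangle (f s) (f t)).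
  assert (A1 : (Cmod (f s) * Cmod (g s - g t) <= k * (eps / (4 * k)))%R).
  { apply Rmult_le_compat; try apply Cmod_ge_0; unfold k in *; lra. }
  assert (A2 : (Cmod (f s - f t) * Cmod (g t) <= eps / (4 * k) * k)%R).
  { apply Rmult_le_compat; try apply Cmod_ge_0; unfold k in *; lra. }
  assert (k * (eps / (4 * k)) = eps / 4)%R by (field; lra).
  lra.
Qed.

Lemma curve_cont_continuous (g : R -> C) (t : R) :
  curve_cont g t -> continuous (U := C_R_NormedModule) g t.
Proof.
  intros H P HP.
  assert (HP' : locally (T := C_UniformSpace) (g t) P) by exact HP.
  apply locally_Cmod in HP'; destruct HP' as [r [Hr HP']].
  destruct (H r Hr) as [de [Hd Hs]].
  exists (mkposreal de Hd); intros s Hst; apply HP', Hs, Hst.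
Qed.

Definition circle_int (g : R -> C) (l : C) : Prop :=
  is_RInt (V := C_R_NormedModule) g 0 (2 * PI) l.

Lemma two_PI_pos : (0 < 2 * PI)%R.
Proof. pose proof PI_RGT_0; lra. Qed.

Lemma Rmin_max_circle (x : R) : (Rmin 0 (2 * PI) <= x <= Rmax 0 (2 * PI))%R ->
  (0 <= x <= 2 * PI)%R.
Proof. pose proof two_PI_pos; rewrite Rmin_left, Rmax_right; lra. Qed.

Lemma circle_int_unique (g : R -> C) (l m : C) : circle_int g l -> circle_int g m -> l = m.
Proof.
  intros Hl Hm; rewrite <- (is_RInt_unique (V := C_R_CompleteNormedModule) g 0 (2 * PI) l Hl).
  exact (is_RInt_unique (V := C_R_CompleteNormedModule) g 0 (2 * PI) m Hm).
Qed.

Lemma circle_int_ex (g : R -> C) : (forall t, (0 <= t <= 2 * PI)%R -> curve_cont g t) ->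
  exists l, circle_int g l.
Proof.
  intros H; apply (ex_RInt_continuous (V := C_R_CompleteNormedModule)).
  intros t Ht; apply Rmin_max_circle in Ht; now apply curve_cont_continuous, H.
Qed.

Lemma circle_int_plus (f g : R -> C) (l m : C) :
  circle_int f l -> circle_int g m -> circle_int (fun t => f t + g t) (l + m).
Proof. apply (is_RInt_plus (V := C_R_NormedModule)). Qed.

Lemma circle_int_ext (f g : R -> C) (l : C) :
  (forall t, f t = g t) -> circle_int f l -> circle_int g l.
Proof. intros H; apply (is_RInt_ext (V := C_R_NormedModule)); intros; apply H. Qed.

(** The integral is linear over the reals, so a complex factor is treated on the two coordinates. *)
Lemma circle_int_scal (k : C) (f : R -> C) (l : C) :
  circle_int f l -> circle_int (fun t => k * f t) (k * l).
Proof.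
  intros Hf.
  assert (H1 := is_RInt_fct_extend_fst (U := R_NormedModule) (V := R_NormedModule) _ _ _ _ Hf).
  assert (H2 := is_RInt_fct_extend_snd (U := R_NormedModule) (V := R_NormedModule) _ _ _ _ Hf).
  apply (is_RInt_fct_extend_pair (U := R_NormedModule) (V := R_NormedModule)).
  - apply (is_RInt_minus (V := R_NormedModule)); now apply (is_RInt_scal (V := R_NormedModule)).
  - apply (is_RInt_plus (V := R_NormedModule)); now apply (is_RInt_scal (V := R_NormedModule)).
Qed.

Lemma circle_int_bound (f : R -> C) (l : C) (M : R) :
  (forall t, (0 <= t <= 2 * PI)%R -> Cmod (f t) <= M) -> circle_int f l ->
  (Cmod l <= 2 * PI * M)%R.
Proof.
  intros H Hf; rewrite Cmod_norm.
  replace (2 * PI * M)%R with ((2 * PI - 0) * M)%R by ring.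
  apply (norm_RInt_le_const (V := C_R_NormedModule) f 0 (2 * PI) l M).
  - left; apply two_PI_pos.
  - intros t Ht; rewrite <- Cmod_norm; now apply H.
  - exact Hf.
Qed.

Lemma circle_int_const (k : C) : circle_int (fun _ => k) (RtoC (2 * PI) * k).
Proof.
  rewrite <- scal_R_Cmult.
  replace (2 * PI)%R with (2 * PI - 0)%R at 1 by ring.
  apply (is_RInt_const (V := C_R_NormedModule)).
Qed.

Lemma circle_int_derive (f df : R -> C) :
  (forall t, (0 <= t <= 2 * PI)%R -> curve_derive f t (df t)) ->
  (forall t, (0 <= t <= 2 * PI)%R -> curve_cont df t) ->
  circle_int df (f (2 * PI)%R - f 0%R).
Proof.
  intros H1 H2; apply (is_RInt_derive (V := C_R_CompleteNormedModule)); intros t Ht;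
    apply Rmin_max_circle in Ht.
  - now apply curve_derive_is_derive, H1.
  - now apply curve_cont_continuous, H2.
Qed.

(** * Circles and the contraction of a circle to a point *)

Definition cis (t : R) : C := (cos t, sin t).

Lemma cis_derive (t : R) : curve_derive cis t (Ci * cis t).
Proof.
  replace (Ci * cis t) with ((- sin t)%R, cos t).
  - apply curve_derive_pair; auto_derive; auto; ring.
  - unfold cis, Ci, Cmult; simpl; f_equal; ring.
Qed.

Lemma cis_Cmod (t : R) : Cmod (cis t) = 1%R.
Proof.
  unfold Cmod, cis; simpl fst; simpl snd.
  replace (cos t ^ 2 + sin t ^ 2)%R with 1%R; [apply sqrt_1|].
  pose proof (sin2_cos2 t) as H; unfold Rsqr in H; lra.
Qed.

Lemma cis_period : cis (2 * PI) = cis 0.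
Proof. unfold cis; now rewrite cos_2PI, sin_2PI, cos_0, sin_0. Qed.

Lemma Ci_neq_0 : Ci <> 0.
Proof. intros E; apply (f_equal snd) in E; simpl in E; lra. Qed.

Lemma eq_of_curve_derive_0 (g : R -> C) :
  (forall t, (0 <= t <= 1)%R -> curve_derive g t 0) -> g 1%R = g 0%R.
Proof.
  intros H.
  assert (I1 : is_RInt (V := C_R_NormedModule) (fun _ => RtoC 0) 0 1 (g 1%R - g 0%R)).
  { apply (is_RInt_derive (V := C_R_CompleteNormedModule)).
    - intros t Ht; rewrite Rmin_left, Rmax_right in Ht by lra.
      now apply curve_derive_is_derive, H.
    - intros t _; apply continuous_const. }
  assert (I2 := is_RInt_const (V := C_R_NormedModule) 0 1 (RtoC 0)).
  assert (E := is_RInt_unique (V := C_R_CompleteNormedModule) _ _ _ _ I1).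
  rewrite (is_RInt_unique (V := C_R_CompleteNormedModule) _ _ _ _ I2) in E.
  rewrite scal_R_Cmult in E; apply Ceq_minus; rewrite <- E; ring.
Qed.

(** With [w] running over a circle this is the contour homotopy: [la = 1] is the circle and [la = 0]
    the point [z]. *)
Definition ray (z w : C) (la : R) : C := z + la * (w - z).

Lemma ray_Cmod (z w : C) (la r : R) : (0 <= la <= 1)%R ->
  Cmod z < r -> Cmod w < r -> Cmod (ray z w la) < r.
Proof.
  intros Hla Hz Hw; unfold ray.
  replace (z + la * (w - z)) with ((1 - la)%R * z + la * w)
    by (rewrite RtoC_minus; ring).
  eapply Rle_lt_trans; [apply Cmod_triangle|].
  rewrite !Cmod_mult, !Cmod_R, !Rabs_pos_eq by lra.
  destruct (Req_dec la 0) as [->|]; [lra|].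
  assert (la * Cmod w < la * r)%R by (apply Rmult_lt_compat_l; lra).
  assert ((1 - la) * Cmod z <= (1 - la) * r)%R by (apply Rmult_le_compat_l; lra).
  lra.
Qed.

Lemma ray_diff (z w : C) (la mu : R) : ray z w la - ray z w mu = (la - mu)%R * (w - z).
Proof. unfold ray; rewrite RtoC_minus; ring. Qed.

Definition circ (rho t : R) : C := rho * cis t.

Lemma circ_Cmod (rho t : R) : 0 < rho -> Cmod (circ rho t) = rho.
Proof. intros H; unfold circ; rewrite Cmod_mult, cis_Cmod, Cmod_R, Rabs_pos_eq; lra. Qed.

Lemma circ_derive (rho t : R) : curve_derive (circ rho) t (Ci * circ rho t).
Proof.
  pose proof (sdiff_curve (fun x => rho * x) cis t _ _
    (sdiff_scal rho _ _ _ (sdiff_id _)) (cis_derive t)) as H.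
  replace (Ci * circ rho t) with (rho * 1 * (Ci * cis t)); [exact H|unfold circ; ring].
Qed.

Lemma ray_circ_derive (z : C) (rho la t : R) :
  curve_derive (fun s => ray z (circ rho s) la) t (la * (Ci * circ rho t)).
Proof.
  assert (Hs : sdiff (fun w => ray z w la) (circ rho t) la).
  { pose proof (sdiff_plus _ _ _ _ _ (sdiff_const (z - la * z) (circ rho t))
      (sdiff_scal la _ _ _ (sdiff_id (circ rho t)))) as H.
    replace (0 + la * 1) with (RtoC la) in H by ring.
    refine (sdiff_ext_loc _ _ _ _ 1 Rlt_0_1 _ H).
    intros x _; unfold ray; ring. }
  exact (sdiff_curve _ _ _ _ _ Hs (circ_derive rho t)).
Qed.

(** Differentiation under the integral needs the first-order estimate uniformly in [t]. Strict
    differentiability gives it near each [t], and compactness of the parameter interval gives a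
    common [de]. *)
Lemma homotopy_uniform (f f' : C -> C) (r rho : R) (z : C) (la0 eps : R) :
  (0 < rho < r)%R -> Cmod z < rho -> (forall x, Cmod x < r -> sdiff f x (f' x)) ->
  (0 <= la0 <= 1)%R -> 0 < eps ->
  exists de : R, 0 < de /\ forall la t : R, (0 <= la <= 1)%R -> Rabs (la - la0) < de ->
    (0 <= t <= 2 * PI)%R ->
    (Cmod (f (ray z (circ rho t) la) - f (ray z (circ rho t) la0) -
      (la - la0)%R * (f' (ray z (circ rho t) la0) * (circ rho t - z))) <=
     eps * (Rabs (la - la0) * Cmod (circ rho t - z)))%R.
Proof.
  intros Hrho Hz Hf Hla0 Heps.
  assert (Hin : forall la t, (0 <= la <= 1)%R -> Cmod (ray z (circ rho t) la) < r).
  { intros la t Hla; apply ray_Cmod; [assumption|lra|rewrite circ_Cmod; lra]. }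
  assert (Hloc : forall t : R, exists de : posreal, forall s la : R,
    Rabs (s - t) < de -> (0 <= la <= 1)%R -> Rabs (la - la0) < de ->
    (Cmod (f (ray z (circ rho s) la) - f (ray z (circ rho s) la0) -
      (la - la0)%R * (f' (ray z (circ rho s) la0) * (circ rho s - z))) <=
     eps * (Rabs (la - la0) * Cmod (circ rho s - z)))%R).
  { intros t; pose proof (Hf _ (Hin la0 t Hla0)) as Hs.
    destruct (Hs (eps / 2)%R) as [d1 [Hd1 H1]]; [lra|].
    destruct (sdiff_deriv_close _ _ _ Hs (eps / 2)%R) as [d2 [Hd2 H2]]; [lra|].
    assert (Hd : (0 < Rmin d1 d2 / 2)%R) by (assert (0 < Rmin d1 d2) by (now apply Rmin_pos); lra).
    destruct (curve_derive_cont _ _ _ (ray_circ_derive z rho la0 t) _ Hd) as [d3 [Hd3 H3]].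
    (* Since [Cmod (circ rho s - z) <= 2 * rho], the change of [la] moves the point by less than
       [Rmin d1 d2 / 2]; the change of [t] uses the other half. *)
    assert (Hd4 : (0 < Rmin d3 (Rmin d1 d2 / (4 * rho)))%R).
    { apply Rmin_pos; [assumption|apply Rdiv_lt_0_compat; lra]. }
    exists (mkposreal _ Hd4); simpl; intros s la Hst Hla Hlala.
    pose proof (Rmin_l d3 (Rmin d1 d2 / (4 * rho))).
    pose proof (Rmin_r d3 (Rmin d1 d2 / (4 * rho))).
    pose proof (Rmin_l d1 d2); pose proof (Rmin_r d1 d2).
    specialize (H3 s ltac:(lra)); cbv beta in H3.
    assert (Hw : (Cmod (circ rho s - z) <= 2 * rho)%R).
    { eapply Rle_trans; [apply Cmod_triangle|]; rewrite Cmod_opp, circ_Cmod; lra. }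
    assert (Hla2 : Cmod (ray z (circ rho s) la - ray z (circ rho s) la0) < Rmin d1 d2 / 2).
    { rewrite ray_diff, Cmod_mult, Cmod_R.
      apply Rle_lt_trans with (Rabs (la - la0) * (2 * rho))%R.
      - apply Rmult_le_compat_l; [apply Rabs_pos|assumption].
      - apply Rlt_le_trans with (Rmin d1 d2 / (4 * rho) * (2 * rho))%R.
        + apply Rmult_lt_compat_r; lra.
        + right; field; lra. }
    assert (Hla3 : Cmod (ray z (circ rho s) la - ray z (circ rho t) la0) < Rmin d1 d2).
    { pose proof (Cmod_triangle_minus (ray z (circ rho s) la) (ray z (circ rho s) la0)
        (ray z (circ rho t) la0)); lra. }
    assert (A := H1 (ray z (circ rho s) la) (ray z (circ rho s) la0) ltac:(lra) ltac:(lra)).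
    assert (B := H2 (ray z (circ rho s) la0) _ ltac:(lra) (Hf _ (Hin la0 s Hla0))).
    set (x := ray z (circ rho s) la) in *; set (y := ray z (circ rho s) la0) in *.
    set (d := f' (ray z (circ rho t) la0)) in *.
    assert (E : x - y = (la - la0)%R * (circ rho s - z)) by apply ray_diff.
    replace (f x - f y - (la - la0)%R * (f' y * (circ rho s - z))) with
      ((f x - f y - d * (x - y)) - (f' y - d) * (x - y)) by (rewrite E; ring).
    eapply Rle_trans; [apply Cmod_triangle|]; rewrite Cmod_opp, Cmod_mult.
    replace (Rabs (la - la0) * Cmod (circ rho s - z))%R with (Cmod (x - y))
      by (rewrite E, Cmod_mult, Cmod_R; reflexivity).
    assert (Cmod (f' y - d) * Cmod (x - y) <= eps / 2 * Cmod (x - y))%R.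
    { apply Rmult_le_compat_r; [apply Cmod_ge_0|assumption]. }
    lra. }
  pose (delta := fun t => proj1_sig (constructive_indefinite_description _ (Hloc t))).
  destruct (compactness_value_1d 0 (2 * PI) delta) as [d Hd].
  exists d; split; [apply cond_pos|]; intros la t Hla Hlala Ht.
  (* [compactness_value_1d] concludes under a double negation, so the inequality is proved by
     contradiction. *)
  apply Rnot_lt_le; intros Hlt.
  apply (Hd t Ht); intros [s [Hs [Hts Hds]]].
  apply (Rlt_not_le _ _ Hlt).
  apply (proj2_sig (constructive_indefinite_description _ (Hloc s))); [exact Hts|assumption|].
  fold (delta s); lra.
Qed.

(** This is the derivative in [la] of the homotopy integral, the factor [circ rho t - z] having
    cancelled against the kernel. For [la <> 0] the integrand is the derivative in [t] of
    [f (ray z (circ rho t) la) / (la * Ci)], a closed curve; at [la = 0] the factor [f' z] is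
    constant and [circ rho] itself is integrated. *)
Lemma homotopy_derivative_integral (f f' : C -> C) (r rho : R) (z : C) (la : R) :
  (0 < rho < r)%R -> Cmod z < rho -> (forall x, Cmod x < r -> sdiff f x (f' x)) ->
  (0 <= la <= 1)%R ->
  circle_int (fun t => f' (ray z (circ rho t) la) * circ rho t) 0.
Proof.
  intros Hrho Hz Hf Hla.
  assert (Hin : forall t, Cmod (ray z (circ rho t) la) < r).
  { intros t; apply ray_Cmod; [assumption|lra|rewrite circ_Cmod; lra]. }
  assert (Hcirc : circ rho (2 * PI) = circ rho 0) by (unfold circ; now rewrite cis_period).
  assert (Hcont : forall t, curve_cont (fun t => f' (ray z (circ rho t) la) * circ rho t) t).
  { intros t; apply curve_cont_mult.
    - apply (curve_cont_comp f' (fun t => ray z (circ rho t) la)).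
      + intros eps Heps.
        destruct (sdiff_deriv_close _ _ _ (Hf _ (Hin t)) (eps / 2)%R) as [d1 [Hd1 H1]]; [lra|].
        set (y := ray z (circ rho t) la) in *.
        exists (Rmin d1 (r - Cmod y)); split.
        { apply Rmin_pos; [assumption|]; specialize (Hin t); fold y in Hin; lra. }
        intros x Hx; pose proof (Rmin_l d1 (r - Cmod y)); pose proof (Rmin_r d1 (r - Cmod y)).
        pose proof (Cmod_rtriangle x y).
        specialize (H1 x (f' x) ltac:(lra) (Hf x ltac:(lra))); lra.
      + eapply curve_derive_cont, ray_circ_derive.
    - eapply curve_derive_cont, circ_derive. }
  pose proof Ci_neq_0 as HCi.
  destruct (Req_dec la 0) as [->|Hla0].
  - assert (I := circle_int_derive (fun t => f' z / Ci * circ rho t)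
      (fun t => f' (ray z (circ rho t) 0) * circ rho t)).
    cbv beta in I; rewrite Hcirc in I.
    replace (f' z / Ci * circ rho 0 - f' z / Ci * circ rho 0) with (RtoC 0) in I by (field; assumption).
    apply I; [|auto]; intros t _.
    replace (ray z (circ rho t) 0) with z by (unfold ray; ring).
    pose proof (sdiff_curve (fun x => f' z / Ci * x) (circ rho) t _ _
      (sdiff_scal _ _ _ _ (sdiff_id _)) (circ_derive rho t)) as H.
    replace (f' z * circ rho t) with (f' z / Ci * 1 * (Ci * circ rho t)) by (field; assumption).
    exact H.
  - assert (Hc : RtoC la <> 0) by (intros E; apply RtoC_inj in E; auto).
    assert (I := circle_int_derive (fun t => / (la * Ci) * f (ray z (circ rho t) la))
      (fun t => f' (ray z (circ rho t) la) * circ rho t)).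
    cbv beta in I; rewrite Hcirc in I.
    match type of I with _ -> _ -> circle_int _ (?u - _) =>
      replace (u - u) with (RtoC 0) in I by ring end.
    apply I; [|auto]; intros t _.
    pose proof (sdiff_curve _ (fun t => ray z (circ rho t) la) t _ _
      (sdiff_scal (/ (la * Ci)) _ _ _ (Hf _ (Hin t))) (ray_circ_derive z rho la t)) as H.
    cbv beta in H.
    match goal with |- curve_derive _ _ ?l => match type of H with curve_derive _ _ ?m =>
      replace l with m by (field; split; assumption) end end.
    exact H.
Qed.

(** * The Cauchy kernel and its expansion *)

Lemma Cminus_circ_neq_0 (rho t : R) (z : C) : 0 < rho -> Cmod z < rho -> circ rho t - z <> 0.
Proof.
  intros Hrho Hz E; apply Ceq_minus in E; rewrite <- E, circ_Cmod in Hz; lra.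
Qed.

(** On the circle [dw = Ci * w dt], so the numerator is what turns the contour integral of
    [1 / (w - z)] into an integral in [t], up to the factor [Ci]. *)
Definition cauchy_kernel (rho : R) (z : C) (t : R) : C := circ rho t / (circ rho t - z).

Lemma cauchy_kernel_cont (rho : R) (z : C) (t : R) : 0 < rho -> Cmod z < rho ->
  curve_cont (cauchy_kernel rho z) t.
Proof.
  intros Hrho Hz; eapply curve_derive_cont.
  refine (sdiff_curve (fun w => w / (w - z)) (circ rho) t _ _ _ (circ_derive rho t)).
  apply sdiff_div; [now apply Cminus_circ_neq_0|apply sdiff_id|].
  apply sdiff_plus; [apply sdiff_id|apply sdiff_const].
Qed.

(** Only the argument of [f] moves to [z]; the kernel stays on the fixed circle, so the integrand
    remains regular at the end of the homotopy. *)
Lemma cauchy_homotopy (f f' : C -> C) (r rho : R) (z : C) :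
  (0 < rho < r)%R -> Cmod z < rho -> (forall x, Cmod x < r -> sdiff f x (f' x)) ->
  exists l, circle_int (fun t => f (circ rho t) * cauchy_kernel rho z t) l /\
    circle_int (fun t => f z * cauchy_kernel rho z t) l.
Proof.
  intros Hrho Hz Hf.
  (* [eq_of_curve_derive_0] asks for two-sided derivatives at 0 and 1 as well. Clamping extends the
     homotopy constantly, and it does not increase distances to points of [[0, 1]]. *)
  pose (clamp := fun la : R => Rmax 0 (Rmin la 1)).
  assert (Hclamp : forall la, (0 <= clamp la <= 1)%R).
  { intros la; unfold clamp; split; [apply Rmax_l|]; apply Rmax_lub; [lra|apply Rmin_r]. }
  assert (Hclamp1 : forall la, (0 <= la <= 1)%R -> clamp la = la).
  { intros la H; unfold clamp; rewrite Rmin_left, Rmax_right; lra. }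
  assert (Hclip : forall la mu, (0 <= mu <= 1)%R -> (Rabs (clamp la - mu) <= Rabs (la - mu))%R).
  { intros la mu H; unfold clamp, Rmax, Rmin; destruct (Rle_dec la 1).
    - destruct (Rle_dec 0 la); [lra|]; rewrite !(Rabs_left1) by lra; lra.
    - destruct (Rle_dec 0 1); [|lra]; rewrite !Rabs_pos_eq by lra; lra. }
  assert (Hin : forall la t, (0 <= la <= 1)%R -> Cmod (ray z (circ rho t) la) < r).
  { intros la t Hla; apply ray_Cmod; [assumption|lra|rewrite circ_Cmod; lra]. }
  assert (Hex : forall la, exists l, circle_int
    (fun t => f (ray z (circ rho t) (clamp la)) * cauchy_kernel rho z t) l).
  { intros la; apply circle_int_ex; intros t _; apply curve_cont_mult.
    - eapply curve_derive_cont.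
      exact (sdiff_curve f _ t _ _ (Hf _ (Hin (clamp la) t (Hclamp la))) (ray_circ_derive _ _ _ _)).
    - apply cauchy_kernel_cont; [lra|assumption]. }
  pose (Phi := fun la => proj1_sig (constructive_indefinite_description _ (Hex la))).
  assert (HPhi : forall la, circle_int
    (fun t => f (ray z (circ rho t) (clamp la)) * cauchy_kernel rho z t) (Phi la)).
  { intros la; exact (proj2_sig (constructive_indefinite_description _ (Hex la))). }
  assert (E : Phi 1%R = Phi 0%R).
  { apply eq_of_curve_derive_0; intros la0 Hla0 eps Heps.
    pose proof two_PI_pos as HPI.
    (* The interval has length [2 * PI], and the numerator of the kernel contributes the factor
       [rho]. *)
    assert (He : (0 < eps / (2 * PI * rho))%R) by (apply Rdiv_lt_0_compat; nra).
    destruct (homotopy_uniform f f' r rho z la0 _ Hrho Hz Hf Hla0 He) as [de [Hd H]].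
    exists de; split; [assumption|]; intros la Hla.
    pose proof (Hclip la la0 Hla0) as Hcl.
    replace (Phi la - Phi la0 - (la - la0)%R * 0) with
      (Phi la + (- (1) * Phi la0 + - (clamp la - la0)%R * 0)) by ring.
    assert (I := circle_int_plus _ _ _ _ (HPhi la) (circle_int_plus _ _ _ _
      (circle_int_scal (- (1)) _ _ (HPhi la0)) (circle_int_scal (- (clamp la - la0)%R) _ _
        (homotopy_derivative_integral f f' r rho z la0 Hrho Hz Hf Hla0)))).
    cbv beta in I; rewrite (Hclamp1 la0 Hla0) in I.
    apply Rle_trans with (2 * PI * (eps / (2 * PI * rho) * Rabs (clamp la - la0) * rho))%R.
    - apply (fun M H => circle_int_bound _ _ M H I); intros t Ht; cbv beta.
      specialize (H (clamp la) t (Hclamp la) ltac:(lra) Ht).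
      unfold cauchy_kernel.
      assert (HW : circ rho t - z <> 0) by (apply Cminus_circ_neq_0; [lra|assumption]).
      set (W := circ rho t - z) in *.
      set (x := f (ray z (circ rho t) (clamp la))) in *.
      set (y := f (ray z (circ rho t) la0)) in *.
      set (d := f' (ray z (circ rho t) la0)) in *.
      replace (x * (circ rho t / W) + (- (1) * (y * (circ rho t / W)) +
          - (clamp la - la0)%R * (d * circ rho t))) with
        ((x - y - (clamp la - la0)%R * (d * W)) * (circ rho t / W)) by (field; assumption).
      assert (0 < Cmod W) by (now apply Cmod_gt_0).
      rewrite Cmod_mult, Cmod_div, circ_Cmod by (assumption || lra).
      apply Rle_trans with (eps / (2 * PI * rho) * (Rabs (clamp la - la0) * Cmod W) *
        (rho / Cmod W))%R.
      + apply Rmult_le_compat_r; [apply Rdiv_le_0_compat; lra|assumption].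
      + right; field; repeat split; try lra; apply PI_neq0.
    - replace (2 * PI * (eps / (2 * PI * rho) * Rabs (clamp la - la0) * rho))%R with
        (eps * Rabs (clamp la - la0))%R by (field; split; [lra|apply PI_neq0]).
      apply Rmult_le_compat_l; lra. }
  exists (Phi 1%R); split.
  - refine (circle_int_ext _ _ _ _ (HPhi 1%R)); intros t; cbv beta.
    rewrite Hclamp1 by lra; do 2 f_equal; unfold ray; ring.
  - rewrite E; refine (circle_int_ext _ _ _ _ (HPhi 0%R)); intros t; cbv beta.
    rewrite Hclamp1 by lra; do 2 f_equal; unfold ray; ring.
Qed.

Lemma circ_pow_cont (rho t : R) (n : nat) : 0 < rho -> curve_cont (fun t => (/ circ rho t) ^ n) t.
Proof.
  intros Hrho; eapply curve_derive_cont.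
  refine (sdiff_curve (fun w => (/ w) ^ n) (circ rho) t _ _ _ (circ_derive rho t)).
  apply sdiff_pow, sdiff_inv_at.
  intros E; pose proof (circ_Cmod rho t Hrho) as H; rewrite E, Cmod_0 in H; lra.
Qed.

Lemma circ_neq_0 (rho t : R) : 0 < rho -> circ rho t <> 0.
Proof. intros H; apply Cmod_gt_0; now rewrite circ_Cmod. Qed.

Lemma circ_pow_integral (rho : R) (n : nat) : 0 < rho ->
  circle_int (fun t => (/ circ rho t) ^ (S n)) 0.
Proof.
  intros Hrho.
  assert (Hn : RtoC (INR (S n)) <> 0).
  { intros E; apply RtoC_inj in E; now apply (not_0_INR (S n)) in E. }
  pose proof Ci_neq_0 as HCi.
  assert (I := circle_int_derive (fun t => - / (INR (S n) * Ci) * (/ circ rho t) ^ (S n))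
    (fun t => (/ circ rho t) ^ (S n))).
  cbv beta in I.
  replace (circ rho (2 * PI)) with (circ rho 0) in I by (unfold circ; now rewrite cis_period).
  match type of I with _ -> _ -> circle_int _ (?u - _) =>
    replace (u - u) with (RtoC 0) in I by ring end.
  apply I.
  - intros t _; pose proof (circ_neq_0 rho t Hrho) as Hc.
    pose proof (sdiff_curve _ (circ rho) t _ _
      (sdiff_scal (- / (INR (S n) * Ci)) _ _ _ (sdiff_pow _ _ _ (S n) (sdiff_inv_at _ Hc)))
      (circ_derive rho t)) as H.
    cbv beta in H.
    match goal with |- curve_derive _ _ ?l => match type of H with curve_derive _ _ ?m =>
      replace l with m end end; [exact H|].
    simpl pred; rewrite Cpow_S; field; auto.
  - intros t _; now apply circ_pow_cont.
Qed.

(** A finite geometric sum with exact remainder, so that no series is ever interchanged with an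
    integral. *)
Lemma cauchy_kernel_expand (rho t : R) (z : C) (N : nat) : 0 < rho -> Cmod z < rho ->
  cauchy_kernel rho z t = csum (fun n => (/ circ rho t) ^ n * z ^ n) N +
    (z / circ rho t) ^ N * cauchy_kernel rho z t.
Proof.
  intros Hrho Hz; pose proof (circ_neq_0 rho t Hrho); pose proof (Cminus_circ_neq_0 rho t z Hrho Hz).
  assert (E : forall n, (z / circ rho t) ^ n = (/ circ rho t) ^ n * z ^ n).
  { intros n; unfold Cdiv; rewrite Cpow_mult_l; ring. }
  unfold cauchy_kernel; rewrite E; induction N as [|N IH]; [simpl; ring|].
  rewrite IH at 1; rewrite !Cpow_S; simpl csum.
  generalize ((/ circ rho t) ^ N) (z ^ N); intros u v; field; auto.
Qed.

Lemma circle_int_csum (g : R -> C) (c : nat -> C) (k : nat -> R -> C) (z : C) (N : nat) :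
  (forall n, circle_int (fun t => g t * k n t) (c n)) ->
  circle_int (fun t => g t * csum (fun n => k n t * z ^ n) N) (csum (fun n => c n * z ^ n) N).
Proof.
  intros H; induction N as [|N IH].
  - assert (I := circle_int_const 0); rewrite Cmult_0_r in I.
    refine (circle_int_ext _ _ _ _ I); intros t; simpl; ring.
  - simpl csum.
    replace (csum (fun n => c n * z ^ n) N + c N * z ^ N) with
      (csum (fun n => c n * z ^ n) N + z ^ N * c N) by ring.
    refine (circle_int_ext _ _ _ _ (circle_int_plus _ _ _ _ IH (circle_int_scal (z ^ N) _ _ (H N)))).
    intros t; cbv beta; ring.
Qed.

(** The function [g] on the circle is arbitrary: the constant 1 gives the integral of the kernel,
    and boundary values of [f] give its Taylor expansion. *)
Lemma cauchy_kernel_remainder (g : R -> C) (c : nat -> C) (rho M : R) (z l : C) (N : nat) :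
  0 < rho -> Cmod z < rho ->
  (forall t, (0 <= t <= 2 * PI)%R -> Cmod (g t) <= M) ->
  (forall n, circle_int (fun t => g t * (/ circ rho t) ^ n) (c n)) ->
  circle_int (fun t => g t * cauchy_kernel rho z t) l ->
  (Cmod (l - csum (fun n => (c n * z ^ n)%C) N) <=
    2 * PI * (M * (Cmod z / rho) ^ N / (1 - Cmod z / rho)))%R.
Proof.
  intros Hrho Hz HM Hc Hl.
  assert (I := circle_int_plus _ _ _ _ Hl (circle_int_scal (- (1)) _ _
    (circle_int_csum g c (fun n t => (/ circ rho t) ^ n) z N Hc))).
  replace (l - csum (fun n => c n * z ^ n) N) with
    (l + - (1) * csum (fun n => c n * z ^ n) N) by ring.
  apply (fun M H => circle_int_bound _ _ M H I); intros t Ht; cbv beta.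
  rewrite (cauchy_kernel_expand rho t z N Hrho Hz).
  replace (g t * (csum (fun n => (/ circ rho t) ^ n * z ^ n) N +
      (z / circ rho t) ^ N * cauchy_kernel rho z t) +
      - (1) * (g t * csum (fun n => (/ circ rho t) ^ n * z ^ n) N)) with
    (g t * (z / circ rho t) ^ N * cauchy_kernel rho z t) by ring.
  pose proof (circ_neq_0 rho t Hrho) as H1; pose proof (Cminus_circ_neq_0 rho t z Hrho Hz) as H2.
  unfold cauchy_kernel; rewrite !Cmod_mult, Cmod_pow, !Cmod_div, !circ_Cmod by assumption.
  pose proof (Cmod_rtriangle (circ rho t) z) as T; rewrite circ_Cmod in T by assumption.
  apply Cmod_gt_0 in H2; pose proof (Cmod_ge_0 z); specialize (HM t Ht); pose proof (Cmod_ge_0 (g t)).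
  assert (0 <= (Cmod z / rho) ^ N)%R by (apply pow_le, Rdiv_le_0_compat; lra).
  replace (M * (Cmod z / rho) ^ N / (1 - Cmod z / rho))%R with
    (M * (Cmod z / rho) ^ N * (rho / (rho - Cmod z)))%R by (field; lra).
  apply Rmult_le_compat.
  - now apply Rmult_le_pos.
  - apply Rdiv_le_0_compat; lra.
  - now apply Rmult_le_compat_r.
  - apply Rmult_le_compat_l; [lra|]; apply Rinv_le_contravar; lra.
Qed.

Lemma pow_small (q K eps : R) : (0 <= q < 1)%R -> 0 < eps -> exists N, (K * q ^ N <= eps)%R.
Proof.
  intros Hq Heps; pose proof (Rabs_pos K).
  destruct (pow_lt_1_zero q ltac:(rewrite Rabs_pos_eq; lra) (eps / (Rabs K + 1))%R) as [N HN].
  { apply Rdiv_lt_0_compat; lra. }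
  exists N; specialize (HN N (le_n _)).
  assert (0 <= q ^ N)%R by (apply pow_le; lra).
  rewrite Rabs_pos_eq in HN by assumption.
  apply Rle_trans with ((Rabs K + 1) * (eps / (Rabs K + 1)))%R.
  - apply Rle_trans with ((Rabs K + 1) * q ^ N)%R.
    + apply Rmult_le_compat_r; [assumption|]; pose proof (Rle_abs K); lra.
    + apply Rmult_le_compat_l; lra.
  - right; field; lra.
Qed.

(** All coefficients of positive index vanish by [circ_pow_integral], so every nonempty partial sum
    equals [2 * PI] while the remainder tends to 0. *)
Lemma cauchy_kernel_integral (rho : R) (z : C) : 0 < rho -> Cmod z < rho ->
  circle_int (cauchy_kernel rho z) (RtoC (2 * PI)).
Proof.
  intros Hrho Hz.
  destruct (circle_int_ex (cauchy_kernel rho z)) as [l Hl].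
  { intros t _; now apply cauchy_kernel_cont. }
  replace (RtoC (2 * PI)) with l; [assumption|].
  pose (c := fun n : nat => match n with O => RtoC (2 * PI) | S _ => 0 end).
  assert (Hc : forall n, circle_int (fun t => 1 * (/ circ rho t) ^ n) (c n)).
  { intros [|n].
    - simpl c; replace (RtoC (2 * PI)) with (RtoC (2 * PI) * 1) by ring.
      refine (circle_int_ext _ _ _ _ (circle_int_const 1)); intros t; simpl; ring.
    - refine (circle_int_ext _ _ _ _ (circ_pow_integral rho n Hrho)); intros t; ring. }
  assert (Hs : forall N, csum (fun n => c n * z ^ n) (S N) = RtoC (2 * PI)).
  { induction N as [|N IH]; [simpl; ring|].
    change (csum (fun n => c n * z ^ n) (S N) + 0 * z ^ S N = RtoC (2 * PI)); rewrite IH; ring. }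
  apply Ceq_of_small; intros eps Heps.
  assert (Hq : (0 <= Cmod z / rho < 1)%R).
  { split; [apply Rdiv_le_0_compat; [apply Cmod_ge_0|assumption]|].
    apply Rmult_lt_reg_r with rho; [assumption|]; unfold Rdiv; rewrite Rmult_assoc, Rinv_l; lra. }
  destruct (pow_small (Cmod z / rho) (2 * PI * (1 / (1 - Cmod z / rho))) eps Hq Heps) as [N HN].
  rewrite <- (Hs N).
  eapply Rle_trans.
  - apply (cauchy_kernel_remainder (fun _ => 1) c rho 1 z l (S N) Hrho Hz).
    + intros t _; rewrite Cmod_1; lra.
    + exact Hc.
    + refine (circle_int_ext _ _ _ _ Hl); intros t; ring.
  - eapply Rle_trans; [|apply HN].
    replace (2 * PI * (1 / (1 - Cmod z / rho)) * (Cmod z / rho) ^ N)%R with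
     (2 * PI * (1 * (Cmod z / rho) ^ N / (1 - Cmod z / rho)))%R by (unfold Rdiv; ring).
    apply Rmult_le_compat_l; [left; apply two_PI_pos|].
    apply Rmult_le_compat_r; [left; apply Rinv_0_lt_compat; lra|].
    apply Rmult_le_compat_l; [lra|]; simpl pow.
    assert (0 <= (Cmod z / rho) ^ N)%R by (apply pow_le; lra); nra.
Qed.

(** The remainder is kept explicit, because Schwarz's lemma exploits how it depends on [M] and
    [N]. *)
Lemma cauchy_expansion (f : C -> C) (r rho M : R) :
  (0 < rho < r)%R -> (forall z, Cmod z < r -> exists d, sdiff f z d) ->
  (forall z, Cmod z = rho -> Cmod (f z) <= M) ->
  exists a : nat -> C, forall (z : C) (N : nat), Cmod z < rho ->
    (Cmod (f z - csum (fun n => (a n * z ^ n)%C) N) <=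
      M * (Cmod z / rho) ^ N / (1 - Cmod z / rho))%R.
Proof.
  intros Hrho Hf HM.
  assert (Hf' : forall z, exists d, Cmod z < r -> sdiff f z d).
  { intros z; destruct (Rlt_dec (Cmod z) r) as [H|H].
    - destruct (Hf z H) as [d Hd]; eauto.
    - exists 0; intros; contradiction. }
  pose (f' := fun z => proj1_sig (constructive_indefinite_description _ (Hf' z))).
  assert (Hsd : forall z, Cmod z < r -> sdiff f z (f' z)).
  { intros z; exact (proj2_sig (constructive_indefinite_description _ (Hf' z))). }
  assert (Hcont : forall t, curve_cont (fun t => f (circ rho t)) t).
  { intros t; eapply curve_derive_cont, sdiff_curve; [|apply circ_derive].
    apply Hsd; rewrite circ_Cmod; lra. }
  assert (Hc : forall n, exists c, circle_int (fun t => f (circ rho t) * (/ circ rho t) ^ n) c).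
  { intros n; apply circle_int_ex; intros t _; apply curve_cont_mult; [apply Hcont|].
    apply circ_pow_cont; lra. }
  pose (c := fun n => proj1_sig (constructive_indefinite_description _ (Hc n))).
  assert (Hcn : forall n, circle_int (fun t => f (circ rho t) * (/ circ rho t) ^ n) (c n)).
  { intros n; exact (proj2_sig (constructive_indefinite_description _ (Hc n))). }
  pose proof two_PI_pos as HPI.
  assert (HPC : RtoC (2 * PI) <> 0) by (intros E; apply RtoC_inj in E; lra).
  exists (fun n => / RtoC (2 * PI) * c n); intros z N Hz.
  destruct (cauchy_homotopy f f' r rho z Hrho Hz Hsd) as [l [Hl1 Hl2]].
  assert (E : l = f z * RtoC (2 * PI)).
  { apply (circle_int_unique _ _ _ Hl2), circle_int_scal, cauchy_kernel_integral; lra. }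
  assert (B := cauchy_kernel_remainder (fun t => f (circ rho t)) c rho M z l N ltac:(lra) Hz
    (fun t _ => HM _ (circ_Cmod rho t ltac:(lra))) Hcn Hl1).
  rewrite (csum_ext _ (fun n => / RtoC (2 * PI) * (c n * z ^ n)) N) by (intros k; ring).
  rewrite csum_scal.
  replace (f z - / RtoC (2 * PI) * csum (fun n => c n * z ^ n) N) with
    (/ RtoC (2 * PI) * (l - csum (fun n => c n * z ^ n) N)) by (rewrite E; field; assumption).
  rewrite Cmod_mult, Cmod_inv, Cmod_R, Rabs_pos_eq by (assumption || lra).
  apply Rmult_le_reg_l with (2 * PI)%R; [assumption|].
  rewrite <- Rmult_assoc, Rinv_r, Rmult_1_l by lra; exact B.
Qed.

(** * Analyticity from strict differentiability *)

Lemma sdiff_translate (f : C -> C) (z0 z d : C) :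
  sdiff f (z0 + z) d <-> sdiff (fun h => f (z0 + h)) z d.
Proof.
  assert (T : forall (f : C -> C) (a z d : C), sdiff f (a + z) d -> sdiff (fun h => f (a + h)) z d).
  { clear; intros f a z d H eps Heps; destruct (H eps Heps) as [de [Hd H1]].
    exists de; split; [assumption|]; intros x y Hx Hy.
    replace (x - y) with (a + x - (a + y)) by ring; apply H1.
    - replace (a + x - (a + z)) with (x - z) by ring; assumption.
    - replace (a + y - (a + z)) with (y - z) by ring; assumption. }
  split; [apply T|]; intros H.
  assert (H' := T (fun h => f (z0 + h)) (- z0) (z0 + z) d).
  replace (- z0 + (z0 + z)) with z in H' by ring.
  refine (sdiff_ext_loc _ _ _ _ 1 Rlt_0_1 _ (H' H)); intros x _; cbv beta; f_equal; ring.
Qed.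

Lemma cauchy_expansion_csums (f : C -> C) (r : R) : 0 < r ->
  (forall z, Cmod z < r -> exists d, sdiff f z d) ->
  exists (rho : R) (a : nat -> C), 0 < rho /\
    forall z, Cmod z < rho -> csums (fun n => a n * z ^ n) (f z).
Proof.
  intros Hr Hf.
  destruct (Hf 0) as [d Hd]; [rewrite Cmod_0; assumption|].
  (* On a circle inside the region of the local Lipschitz bound, that bound supplies [M] without a
     compactness argument. *)
  destruct (sdiff_lip f 0 d Hd) as [de [Hde Hl]].
  set (rho := (Rmin de r / 2)%R).
  assert (0 < Rmin de r) by (now apply Rmin_pos).
  pose proof (Rmin_l de r); pose proof (Rmin_r de r).
  assert (Hrho : (0 < rho < r)%R) by (unfold rho; lra).
  destruct (cauchy_expansion f r rho (Cmod (f 0) + (Cmod d + 1) * rho)%R Hrho Hf) as [a Ha].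
  { intros z Hz; specialize (Hl z 0).
    replace (z - 0) with z in Hl by ring; rewrite Cmod_self_minus, Hz in Hl.
    specialize (Hl ltac:(unfold rho; lra) Hde); pose proof (Cmod_rtriangle (f z) (f 0)); lra. }
  exists rho, a; split; [lra|]; intros z Hz eps Heps.
  assert (Hq : (0 <= Cmod z / rho < 1)%R).
  { split; [apply Rdiv_le_0_compat; [apply Cmod_ge_0|lra]|].
    apply Rmult_lt_reg_r with rho; [lra|]; unfold Rdiv; rewrite Rmult_assoc, Rinv_l; lra. }
  set (K := ((Cmod (f 0) + (Cmod d + 1) * rho) / (1 - Cmod z / rho))%R).
  destruct (pow_small (Cmod z / rho) K eps Hq Heps) as [N HN].
  assert (HK : (0 <= K)%R).
  { apply Rdiv_le_0_compat; [|lra]; pose proof (Cmod_ge_0 (f 0)); pose proof (Cmod_ge_0 d); nra. }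
  exists N; intros n Hn; rewrite Cmod_minus_sym.
  eapply Rle_trans; [apply (Ha z n Hz)|]; eapply Rle_trans; [|apply HN].
  unfold K, Rdiv; rewrite (Rmult_assoc _ (_ ^ n)), (Rmult_comm (_ ^ n)), <- Rmult_assoc.
  apply Rmult_le_compat_l; [exact HK|].
  replace n with (N + (n - N))%nat by lia; rewrite pow_add.
  rewrite <- (Rmult_1_r ((Cmod z * / rho) ^ N)) at 2; apply Rmult_le_compat_l; [apply pow_le, Hq|].
  rewrite <- (pow1 (n - N)); apply pow_incr; unfold Rdiv in Hq; lra.
Qed.

Lemma sdiff_analytic_on (U : C -> Prop) (f : C -> C) :
  (forall z, U z -> exists r, 0 < r /\ forall x, Cmod (x - z) < r -> exists d, sdiff f x d) ->
  analytic_on U f.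
Proof.
  intros H z0 Hz0; destruct (H z0 Hz0) as [r [Hr Hf]].
  destruct (cauchy_expansion_csums (fun h => f (z0 + h)) r Hr) as [rho [a [Hrho Ha]]].
  { intros z Hz; destruct (Hf (z0 + z)) as [d Hd].
    - now replace (z0 + z - z0) with z by ring.
    - exists d; now apply sdiff_translate. }
  exists rho, a; split; [assumption|]; intros z Hz; apply is_pseries_csums.
  replace (f z) with (f (z0 + (z - z0))) by (f_equal; ring); auto.
Qed.

(** * Local inversion *)

(** Near [z], [f] deviates from its linear part by at most half of [Cmod d * Cmod (x - y)], hence
    separates points. *)
Lemma sdiff_expand (f : C -> C) (z d : C) : d <> 0 -> sdiff f z d ->
  exists delta : R, 0 < delta /\ forall x y : C,
    Cmod (x - z) < delta -> Cmod (y - z) < delta ->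
    (Cmod (x - y) <= 2 / Cmod d * Cmod (f x - f y))%R.
Proof.
  intros Hd Hf; apply Cmod_gt_0 in Hd.
  destruct (Hf (Cmod d / 2)%R) as [de [Hde H]]; [lra|].
  exists de; split; [assumption|]; intros x y Hx Hy; specialize (H x y Hx Hy).
  pose proof (Cmod_triangle (f x - f y) (- (f x - f y - d * (x - y)))) as T.
  replace (f x - f y + - (f x - f y - d * (x - y))) with (d * (x - y)) in T by ring.
  rewrite Cmod_opp, Cmod_mult in T.
  apply Rmult_le_reg_l with (Cmod d / 2)%R; [lra|].
  replace (Cmod d / 2 * (2 / Cmod d * Cmod (f x - f y)))%R with (Cmod (f x - f y)) by (field; lra).
  lra.
Qed.

Lemma sdiff_open (f : C -> C) (z d : C) (eps : R) : d <> 0 -> sdiff f z d -> 0 < eps ->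
  exists eta : R, 0 < eta /\ forall w : C, Cmod (w - f z) < eta ->
    exists x : C, Cmod (x - z) < eps /\ f x = w.
Proof.
  intros Hd0 Hf Heps; apply Cmod_gt_0 in Hd0 as Hd.
  destruct (Hf (Cmod d / 2)%R) as [de [Hde H]]; [lra|].
  set (s := Rmin de eps).
  assert (Hs : 0 < s) by (now apply Rmin_pos).
  assert (Hs1 : (s <= de)%R) by apply Rmin_l; assert (Hs2 : (s <= eps)%R) by apply Rmin_r.
  exists (Cmod d * (s / 4))%R; split; [apply Rmult_lt_0_compat; lra|]; intros w Hw.
  set (ka := (Cmod (w - f z) / Cmod d)%R).
  assert (Hka : (0 <= ka)%R) by (apply Rdiv_le_0_compat; [apply Cmod_ge_0|assumption]).
  assert (Hka2 : (2 * ka < s)%R).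
  { enough (ka < s / 4)%R by lra; apply Rmult_lt_reg_l with (Cmod d); [assumption|].
    unfold ka; replace (Cmod d * (Cmod (w - f z) / Cmod d))%R with (Cmod (w - f z))
      by (field; lra); assumption. }
  (* Newton's iteration with the slope frozen at [d]. The tolerance [Cmod d / 2] makes successive
     steps halve, starting from [ka], so all iterates stay within [2 * ka < s] of [z]. *)
  pose (T := fun x : C => x + (w - f x) / d).
  pose (X := fix X n := match n with O => z | S m => T (X m) end).
  assert (HXS : forall n, X (S n) = X n + (w - f (X n)) / d) by reflexivity.
  assert (EX : forall n, w - f (X n) = d * (X (S n) - X n)).
  { intros n; rewrite HXS; field; assumption. }
  pose (g := fun n => X (S n) - X n).
  assert (HX : forall n, csum g n = X n - z).
  { induction n as [|n IH]; [simpl; ring|]; simpl csum; rewrite IH; unfold g; ring. }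
  assert (Hgeo : forall n, (rsum (fun k => ka * (1 / 2) ^ k)%R n = 2 * ka * (1 - (1 / 2) ^ n))%R).
  { induction n as [|n IH]; [simpl; ring|]; simpl rsum; rewrite IH; simpl pow; field. }
  assert (Hgeo2 : forall n, (rsum (fun k => ka * (1 / 2) ^ k)%R n <= 2 * ka)%R).
  { intros n; rewrite Hgeo; assert (0 <= (1 / 2) ^ n)%R by (apply pow_le; lra); nra. }
  (* Halving of the next step and confinement of the iterates depend on each other; the induction
     therefore carries the bounds on all earlier steps. *)
  assert (Hg : forall n, (forall k, (k <= n)%nat -> Cmod (g k) <= ka * (1 / 2) ^ k)%R).
  { assert (Hloc : forall n, (forall k, (k < n)%nat -> Cmod (g k) <= ka * (1 / 2) ^ k)%R ->
      (Cmod (X n - z) <= 2 * ka)%R).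
    { intros n Hn; rewrite <- HX; eapply Rle_trans; [|apply (Hgeo2 n)].
      clear -Hn; induction n as [|n IH]; simpl; [rewrite Cmod_0; lra|].
      eapply Rle_trans; [apply Cmod_triangle|].
      specialize (Hn n ltac:(lia)) as Hn'. specialize (IH ltac:(intros; apply Hn; lia)); lra. }
    induction n as [|n IH]; intros k Hk.
    - replace k with 0%nat by lia.
      replace (g 0%nat) with ((w - f z) / d) by (unfold g; rewrite HXS; simpl; ring).
      change ((1 / 2) ^ 0)%R with 1%R.
      rewrite Cmod_div by assumption; fold ka; lra.
    - destruct (Nat.eq_dec k (S n)) as [->|]; [|apply IH; lia].
      assert (L1 := Hloc n ltac:(intros; apply IH; lia)).
      assert (L2 := Hloc (S n) ltac:(intros; apply IH; lia)).
      assert (B := H (X (S n)) (X n) ltac:(lra) ltac:(lra)).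
      replace (g (S n)) with (- ((f (X (S n)) - f (X n) - d * (X (S n) - X n)) / d)).
      2:{ rewrite <- EX; unfold g; rewrite (HXS (S n)); field; assumption. }
      rewrite Cmod_opp, Cmod_div by assumption.
      apply Rmult_le_reg_r with (Cmod d); [assumption|].
      unfold Rdiv at 1; rewrite Rmult_assoc, Rinv_l, Rmult_1_r by lra.
      eapply Rle_trans; [exact B|]; specialize (IH n (le_n _)); unfold g in IH; simpl pow; nra. }
  destruct (csums_ex g _ (2 * ka)%R (fun n => Hg n n (le_n _)) Hgeo2) as [l [Hl Hlb]].
  exists (z + l).
  assert (Hin : Cmod (z + l - z) < s) by (replace (z + l - z) with l by ring; lra).
  split; [lra|].
  apply Ceq_of_small; intros e He.
  destruct (Hl (e / (4 * Cmod d))%R) as [N HN]; [apply Rdiv_lt_0_compat; lra|].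
  assert (A1 := HN N (le_n _)); assert (A2 := HN (S N) ltac:(lia)).
  rewrite !HX in A1, A2.
  assert (HXN : (Cmod (X N - z) <= 2 * ka)%R).
  { rewrite <- HX; eapply Rle_trans; [apply (csum_Cmod g _ N (fun n => Hg n n (le_n _)))|apply Hgeo2]. }
  assert (B := H (z + l) (X N) ltac:(lra) ltac:(lra)).
  replace (f (z + l) - w) with
    ((f (z + l) - f (X N) - d * (z + l - X N)) - d * (X (S N) - z - l)).
  2:{ replace w with (f (X N) + d * (X (S N) - X N)) by (rewrite <- EX; ring). ring. }
  eapply Rle_trans; [apply Cmod_triangle|]; rewrite Cmod_opp, Cmod_mult.
  replace (X N - z - l) with (- (z + l - X N)) in A1 by ring; rewrite Cmod_opp in A1.
  assert (Cmod d * Cmod (z + l - X N) <= Cmod d * (e / (4 * Cmod d)))%R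
    by (apply Rmult_le_compat_l; lra).
  assert (Cmod d * Cmod (X (S N) - z - l) <= Cmod d * (e / (4 * Cmod d)))%R
    by (apply Rmult_le_compat_l; lra).
  assert (Cmod d * (e / (4 * Cmod d)) = e / 4)%R by (field; lra).
  lra.
Qed.

Lemma sdiff_inverse (f g : C -> C) (z d : C) (r : R) : d <> 0 -> 0 < r -> sdiff f z d ->
  (forall w, Cmod (w - f z) < r -> f (g w) = w) ->
  (forall eps : R, 0 < eps -> exists delta : R, 0 < delta /\
     forall w, Cmod (w - f z) < delta -> Cmod (g w - z) < eps) ->
  sdiff g (f z) (/ d).
Proof.
  intros Hd0 Hr Hf Hfg Hg eps Heps; apply Cmod_gt_0 in Hd0 as Hd.
  destruct (sdiff_expand f z d Hd0 Hf) as [d1 [Hd1 H1]].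
  (* One factor [Cmod d] pays for the division by [d], and [Cmod d / 2] for the passage from
     [g x - g y] to [x - y]. *)
  destruct (Hf (eps * (Cmod d * Cmod d) / 2)%R) as [d2 [Hd2 H2]].
  { apply Rdiv_lt_0_compat; [|lra]; apply Rmult_lt_0_compat; [assumption|nra]. }
  destruct (Hg (Rmin d1 d2)) as [d3 [Hd3 H3]]; [now apply Rmin_pos|].
  exists (Rmin d3 r); split; [now apply Rmin_pos|]; intros x y Hx Hy.
  pose proof (Rmin_l d3 r); pose proof (Rmin_r d3 r).
  pose proof (Rmin_l d1 d2); pose proof (Rmin_r d1 d2).
  assert (Hgx := H3 x ltac:(lra)); assert (Hgy := H3 y ltac:(lra)).
  assert (Ex := Hfg x ltac:(lra)); assert (Ey := Hfg y ltac:(lra)).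
  specialize (H1 (g x) (g y) ltac:(lra) ltac:(lra)).
  specialize (H2 (g x) (g y) ltac:(lra) ltac:(lra)).
  rewrite Ex, Ey in H1, H2.
  replace (g x - g y - / d * (x - y)) with (- ((x - y - d * (g x - g y)) / d)) by (field; assumption).
  rewrite Cmod_opp, Cmod_div by assumption.
  apply Rmult_le_reg_r with (Cmod d); [assumption|].
  unfold Rdiv at 1; rewrite Rmult_assoc, Rinv_l, Rmult_1_r by lra.
  eapply Rle_trans; [exact H2|].
  apply Rle_trans with (eps * (Cmod d * Cmod d) / 2 * (2 / Cmod d * Cmod (x - y)))%R.
  - apply Rmult_le_compat_l; [|assumption].
    apply Rdiv_le_0_compat; [|lra]; apply Rmult_le_pos; [lra|nra].
  - right; field; lra.
Qed.

Lemma sdiff_inverse_ex (f : C -> C) (z d : C) : d <> 0 -> sdiff f z d ->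
  exists g : C -> C, sdiff g (f z) (/ d) /\ g (f z) = z /\
    exists r : R, 0 < r /\ forall w, Cmod (w - f z) < r -> f (g w) = w.
Proof.
  intros Hd Hf.
  destruct (sdiff_expand f z d Hd Hf) as [d1 [Hd1 H1]].
  destruct (sdiff_open f z d d1 Hd Hf Hd1) as [eta [Heta H2]].
  assert (Hex : forall w, exists x, Cmod (w - f z) < eta -> Cmod (x - z) < d1 /\ f x = w).
  { intros w; destruct (Rlt_dec (Cmod (w - f z)) eta) as [L|L].
    - destruct (H2 w L) as [x Hx]; exists x; auto.
    - exists 0; intros; contradiction. }
  pose (g := fun w => proj1_sig (constructive_indefinite_description _ (Hex w))).
  assert (Hg : forall w, Cmod (w - f z) < eta -> Cmod (g w - z) < d1 /\ f (g w) = w).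
  { intros w; exact (proj2_sig (constructive_indefinite_description _ (Hex w))). }
  assert (B : forall w, Cmod (w - f z) < eta -> (Cmod (g w - z) <= 2 / Cmod d * Cmod (w - f z))%R).
  { intros w Hw; destruct (Hg w Hw) as [G1 G2].
    specialize (H1 (g w) z G1); rewrite Cmod_self_minus in H1; specialize (H1 Hd1).
    now rewrite G2 in H1. }
  apply Cmod_gt_0 in Hd as Hd'.
  exists g; split; [|split].
  - apply (sdiff_inverse f g z d eta); [assumption|assumption|assumption|apply Hg|].
    intros eps Heps; exists (Rmin eta (eps * (Cmod d / 2))); split.
    { apply Rmin_pos; [assumption|apply Rmult_lt_0_compat; lra]. }
    intros w Hw; pose proof (Rmin_l eta (eps * (Cmod d / 2))).
    pose proof (Rmin_r eta (eps * (Cmod d / 2))).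
    eapply Rle_lt_trans; [apply B; lra|].
    apply Rlt_le_trans with (2 / Cmod d * (eps * (Cmod d / 2)))%R.
    + apply Rmult_lt_compat_l; [apply Rdiv_lt_0_compat|]; lra.
    + right; field; lra.
  - apply Ceq_of_small; intros eps Heps; specialize (B (f z)).
    rewrite Cmod_self_minus in B; specialize (B Heta); lra.
  - exists eta; split; [assumption|]; apply Hg.
Qed.

(** * Zeros of power series and derivatives of univalent functions *)

Lemma Cpow_0_l (n : nat) : n <> O -> 0 ^ n = 0.
Proof. destruct n; [contradiction|]; intros _; simpl; ring. Qed.

Lemma csums_shift_n (a : nat -> C) (l : C) (n : nat) :
  (forall k, (k < n)%nat -> a k = 0) -> csums a l -> csums (fun k => a (n + k)%nat) l.
Proof.
  revert a; induction n as [|n IH]; intros a H0 Ha; [assumption|].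
  apply (IH (fun k => a (S k))).
  - intros k Hk; apply H0; lia.
  - apply csums_shift; [apply H0; lia|assumption].
Qed.

Lemma csums_only_head (a : nat -> C) : (forall k, a (S k) = 0) -> csums a (a 0%nat).
Proof.
  intros H eps Heps; exists 1%nat; intros n Hn; destruct n as [|n]; [lia|].
  rewrite csum_head, (csum_ext _ (fun k => 0 * a k)) by (intros k; rewrite H; ring).
  rewrite csum_scal; replace (a 0%nat + 0 * csum a n - a 0%nat) with (RtoC 0) by ring.
  rewrite Cmod_0; lra.
Qed.

Lemma csums_at_0 (a : nat -> C) : csums (fun k => a k * 0 ^ k) (a 0%nat).
Proof.
  replace (a 0%nat) with (a 0%nat * 0 ^ 0) by (simpl; ring).
  apply (csums_only_head (fun k => a k * 0 ^ k)); intros k; simpl; ring.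
Qed.

Lemma power_series_factor (a : nat -> C) (r : R) (f : C -> C) (n : nat) :
  (forall h, Cmod h < r -> csums (fun k => a k * h ^ k) (f h)) ->
  (forall k, (k < n)%nat -> a k = 0) ->
  exists u : C -> C, u 0 = a n /\
    (forall h, Cmod h < r -> csums (fun k => a (n + k)%nat * h ^ k) (u h)) /\
    (forall h, Cmod h < r -> f h = h ^ n * u h).
Proof.
  intros Hf Ha.
  (* The removable singularity is filled with the leading coefficient. *)
  exists (fun h => if Ceq_dec h 0 then a n else f h / h ^ n).
  split; [destruct (Ceq_dec 0 0); congruence|split]; intros h Hh; specialize (Hf h Hh).
  - destruct (Ceq_dec h 0) as [->|Hn].
    + pose proof (csums_at_0 (fun k => a (n + k)%nat)) as H; cbv beta in H.
      now rewrite Nat.add_0_r in H.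
    + apply (csums_shift_n _ _ n) in Hf.
      * assert (H := csums_scal (/ h ^ n) _ _ Hf).
        replace (f h / h ^ n) with (/ h ^ n * f h) by (unfold Cdiv; ring).
        refine (csums_ext _ _ _ _ H); intros k; rewrite Cpow_add_r; field.
        now apply Cpow_nz.
      * intros k Hk; rewrite Ha by assumption; ring.
  - destruct (Ceq_dec h 0) as [->|Hn].
    + apply (csums_unique _ _ _ Hf).
      destruct n as [|n].
      * simpl; rewrite Cmult_1_l; apply csums_at_0.
      * rewrite Cpow_0_l, Cmult_0_l by discriminate.
        pose proof (csums_at_0 a) as H; now rewrite (Ha 0%nat) in H by lia.
    + field; now apply Cpow_nz.
Qed.

Lemma cis_add (s t : R) : cis (s + t) = cis s * cis t.
Proof. unfold cis, Cmult; simpl; rewrite cos_plus, sin_plus; f_equal; ring. Qed.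

Lemma cis_pow (t : R) (n : nat) : cis t ^ n = cis (INR n * t).
Proof.
  induction n as [|n IH].
  - simpl; rewrite Rmult_0_l; unfold cis; rewrite cos_0, sin_0; reflexivity.
  - rewrite Cpow_S, IH, S_INR, <- cis_add; f_equal; ring.
Qed.

Lemma root_of_unity (n : nat) : (2 <= n)%nat -> exists xi : C, xi <> 1 /\ xi ^ n = 1 /\ Cmod xi = 1%R.
Proof.
  intros Hn; exists (cis (2 * PI / INR n)).
  assert (Hn2 : (2 <= INR n)%R) by (apply (le_INR 2); assumption).
  pose proof PI_RGT_0.
  split; [|split; [|apply cis_Cmod]].
  - intros E; apply (f_equal fst) in E; simpl in E.
    assert (Hx : (0 < 2 * PI / INR n <= PI)%R).
    { split; [apply Rdiv_lt_0_compat; lra|].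
      (* The angle is at most [PI] because [n >= 2], and there cosine is injective, so the root
         differs from 1. *)
      apply Rmult_le_reg_r with (INR n); [lra|]; unfold Rdiv; rewrite Rmult_assoc, Rinv_l by lra; nra. }
    pose proof (cos_decreasing_1 0 (2 * PI / INR n)) as D; rewrite cos_0, E in D; lra.
  - rewrite cis_pow; replace (INR n * (2 * PI / INR n))%R with (2 * PI)%R by (field; lra).
    rewrite cis_period; unfold cis; now rewrite cos_0, sin_0.
Qed.

(* Near [z] the function [f] is [f z + u0 * psi ^ n] with [psi] locally invertible,
   and [psi ^ n] is not injective when [n >= 2]. *)
Lemma univalent_derive_neq_0 (U : C -> Prop) (f : C -> C) (z d : C) (r : R) :
  0 < r -> (forall x, Cmod (x - z) < r -> U x) -> univalent_on U f -> sdiff f z d -> d <> 0.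
Proof.
  intros Hr HU [Hana Hinj] Hd Hd0; subst d.
  assert (Uz : U z) by (apply HU; rewrite Cmod_self_minus; assumption).
  destruct (Hana z Uz) as [r1 [a [Hr1 Ha]]].
  pose (F := fun h => f (z + h)).
  assert (HF : forall h, Cmod h < r1 -> csums (fun k => a k * h ^ k) (F h)).
  { intros h Hh; apply is_pseries_csums; specialize (Ha (z + h)).
    replace (z + h - z) with h in Ha by ring; auto. }
  assert (H0 : F 0 = a 0%nat).
  { refine (csums_unique _ _ _ (HF 0 ltac:(rewrite Cmod_0; assumption)) _).
    apply csums_at_0. }
  assert (H1 : a 1%nat = 0).
  { destruct (power_series_sdiff a r1 F 0 HF ltac:(rewrite Cmod_0; assumption)) as [e [He Hs]].
    assert (e = 0).
    { apply (sdiff_unique F 0); [assumption|]; apply sdiff_translate.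
      now replace (z + 0) with z by ring. }
    subst e.
    apply (csums_unique (fun k => INR (S k) * a (S k) * 0 ^ k)).
    - pose proof (csums_at_0 (fun k => INR (S k) * a (S k))) as H; cbv beta in H.
      simpl (INR 1) in H; now rewrite Cmult_1_l in H.
    - apply (csums_shift (fun n => INR n * a n * 0 ^ pred n)); [simpl; ring|assumption]. }
  (* If all higher coefficients vanish, [f] is constant near [z], which already contradicts
     injectivity. *)
  destruct (classic (forall n, (1 <= n)%nat -> a n = 0)) as [Hall|Hsome].
  - set (t := (Rmin r r1 / 2)%R).
    assert (Ht : (0 < Rmin r r1)%R) by (now apply Rmin_pos).
    pose proof (Rmin_l r r1); pose proof (Rmin_r r r1).
    assert (Et : Cmod (RtoC t) = t) by (rewrite Cmod_R; apply Rabs_pos_eq; unfold t; lra).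
    assert (E : F t = F 0).
    { rewrite H0; refine (csums_unique _ _ _ (HF t ltac:(rewrite Et; unfold t; lra)) _).
      replace (a 0%nat) with (a 0%nat * t ^ 0) by (simpl; ring).
      apply (csums_only_head (fun k => a k * t ^ k)); intros k; rewrite Hall by lia; ring. }
    apply Hinj in E.
    + assert (E2 : RtoC t = 0) by (replace (RtoC t) with (z + t - (z + 0)) by ring; rewrite E; ring).
      rewrite E2, Cmod_0 in Et; unfold t in Et; lra.
    + apply HU; replace (z + t - z) with (RtoC t) by ring; rewrite Et; unfold t; lra.
    + now replace (z + 0) with z by ring.
  - assert (Hmin : exists n, ((1 <= n)%nat /\ a n <> 0) /\
      forall k, (1 <= k)%nat /\ a k <> 0 -> (n <= k)%nat).
    { assert (Hex : exists n, (1 <= n)%nat /\ a n <> 0).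
      { apply not_all_ex_not in Hsome; destruct Hsome as [n Hn].
        apply imply_to_and in Hn; eauto. }
      destruct (Wf_nat.dec_inh_nat_subset_has_unique_least_element
        (fun n => (1 <= n)%nat /\ a n <> 0)) as [n [Hn _]]; [|assumption|eauto].
      intros n; apply classic. }
    destruct Hmin as [n [[Hn1 Hn2] Hmin]].
    assert (Hn : (2 <= n)%nat).
    { destruct (Nat.eq_dec n 1) as [->|]; [contradiction|lia]. }
    destruct (power_series_factor (fun k => match k with O => 0 | S _ => a k end) r1
      (fun h => F h - F 0) n) as [u [Hu0 [Hus Huf]]].
    { intros h Hh; rewrite H0.
      assert (S := csums_plus _ _ _ _ (HF h Hh) (csums_scal (- a 0%nat) _ _
        (csums_only_head (fun k => match k with O => 1 | S _ => 0 end) (fun _ => eq_refl)))).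
      cbv beta iota in S.
      replace (F h - a 0%nat) with (F h + - a 0%nat * 1) by ring.
      refine (csums_ext _ _ _ _ S); intros [|k]; simpl; ring. }
    { intros [|k] Hk; [reflexivity|]; apply NNPP; intros Hc.
      assert (1 <= S k)%nat by lia.
      specialize (Hmin (S k) (conj H Hc)); lia. }
    assert (Hun : u 0 = a n) by (rewrite Hu0; destruct n; [lia|reflexivity]).
    clear Hu0; rename Hun into Hu0.
    destruct (power_series_sdiff _ r1 u 0 Hus ltac:(rewrite Cmod_0; assumption)) as [u' [Hu' _]].
    assert (Hnn : RtoC (INR n) <> 0).
    { intros E; apply RtoC_inj in E; apply (not_0_INR n); [lia|assumption]. }
    assert (Hpow := sdiff_pow _ 1 _ n (sdiff_id 1)); cbv beta in Hpow.
    rewrite Cpow_1_l in Hpow; replace (INR n * 1 * 1) with (RtoC (INR n)) in Hpow by ring.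
    (* The local inverse of [x ^ n] at 1 is a branch of the [n]-th root; applied to [u / a n], which
       equals 1 at 0, it yields [v] with [v ^ n = u / a n]. *)
    destruct (sdiff_inverse_ex (fun x => x ^ n) 1 (INR n) Hnn Hpow) as [g [Hg [Hg1 [r2 [Hr2 Hgr]]]]].
    rewrite Cpow_1_l in Hg, Hg1, Hgr.
    pose (v := fun h => g (/ a n * u h)).
    assert (Hv0 : / a n * u 0 = 1) by (rewrite Hu0; field; assumption).
    assert (Hv : exists v', sdiff v 0 v').
    { eexists; apply (sdiff_comp g (fun h => / a n * u h)).
      - apply sdiff_scal; exact Hu'.
      - rewrite Hv0; exact Hg. }
    destruct Hv as [v' Hv].
    assert (Hpsi : sdiff (fun h => h * v h) 0 1).
    { pose proof (sdiff_mult _ _ _ _ _ (sdiff_id 0) Hv) as H; cbv beta in H.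
      replace (1 * v 0 + 0 * v') with (RtoC 1) in H; [exact H|].
      unfold v; rewrite Hv0, Hg1; ring. }
    destruct (sdiff_cont _ _ _ (sdiff_scal (/ a n) _ _ _ Hu') r2 Hr2) as [d1 [Hd1 Hvr]].
    assert (Hvn : forall h, Cmod h < d1 -> v h ^ n = / a n * u h).
    { intros h Hh; apply Hgr; specialize (Hvr h); cbv beta in Hvr; rewrite Hv0 in Hvr.
      apply Hvr; now replace (h - 0) with h by ring. }
    set (e := Rmin (Rmin r r1) d1).
    assert (He : 0 < e) by (repeat apply Rmin_pos; assumption).
    assert (He1 : (e <= r)%R /\ (e <= r1)%R /\ (e <= d1)%R).
    { unfold e; pose proof (Rmin_l (Rmin r r1) d1); pose proof (Rmin_r (Rmin r r1) d1).
      pose proof (Rmin_l r r1); pose proof (Rmin_r r r1); lra. }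
    destruct (sdiff_open _ _ _ e C1_nz Hpsi He) as [eta [Heta Hop]].
    (* The values [t] and [t * xi] of [h * v h] have equal [n]-th powers, so their distinct
       preimages get the same value of [F]. *)
    destruct (root_of_unity n Hn) as [xi [Hxi1 [Hxin Hxim]]].
    set (t := (eta / 2)%R).
    assert (Et : Cmod (RtoC t) = t) by (rewrite Cmod_R; apply Rabs_pos_eq; unfold t; lra).
    assert (Ht0 : RtoC t <> 0) by (intros E; apply RtoC_inj in E; unfold t in E; lra).
    destruct (Hop t) as [h1 [Hh1 Eh1]].
    { replace (t - 0 * v 0) with (RtoC t) by ring; rewrite Et; unfold t; lra. }
    destruct (Hop (t * xi)) as [h2 [Hh2 Eh2]].
    { replace (t * xi - 0 * v 0) with (t * xi) by ring.
      rewrite Cmod_mult, Et, Hxim; unfold t; lra. }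
    replace (h1 - 0) with h1 in Hh1 by ring; replace (h2 - 0) with h2 in Hh2 by ring.
    assert (Hval : forall h, Cmod h < e -> F h = F 0 + a n * (h * v h) ^ n).
    { intros h Hh; rewrite Cpow_mult_l, Hvn by lra.
      replace (F h) with (F 0 + (F h - F 0)) by ring; rewrite Huf by lra.
      field; assumption. }
    assert (E : F h1 = F h2).
    { rewrite (Hval h1), (Hval h2) by assumption; rewrite Eh1, Eh2, Cpow_mult_l, Hxin; ring. }
    apply Hinj in E.
    + assert (E2 : h1 = h2).
      { replace h1 with (z + h1 - z) by ring; rewrite E; ring. }
      subst h2; rewrite Eh1 in Eh2; apply Hxi1.
      apply (f_equal (fun x => x / t)) in Eh2.
      replace (t / t) with (RtoC 1) in Eh2 by (field; assumption).
      rewrite Eh2; field; assumption.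
    + apply HU; replace (z + h1 - z) with h1 by ring; lra.
    + apply HU; replace (z + h2 - z) with h2 by ring; lra.
Qed.

(** * Schwarz's lemma *)

Lemma csum_Cmod_le (a : nat -> C) (z : C) (N : nat) : Cmod z <= 1 ->
  (Cmod (csum (fun n => (a n * z ^ n)%C) N) <= rsum (fun n => Cmod (a n)) N)%R.
Proof.
  intros Hz; apply csum_Cmod; intros k; rewrite Cmod_mult, Cmod_pow.
  rewrite <- (Rmult_1_r (Cmod (a k))) at 2; apply Rmult_le_compat_l; [apply Cmod_ge_0|].
  rewrite <- (pow1 k); apply pow_incr; split; [apply Cmod_ge_0|assumption].
Qed.

Lemma Cmod_RtoC_pos (t : R) : (0 <= t)%R -> Cmod (RtoC t) = t.
Proof. intros H; rewrite Cmod_R; now apply Rabs_pos_eq. Qed.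

(** A polynomial of degree below [N] that is of order [|z| ^ N] at 0 vanishes: small [z] kills the
    constant term, then one factor [z] is divided out. Excluding [z = 0] keeps the hypothesis stable
    under this division. *)
Lemma csum_power_eq_0 (N : nat) (a : nat -> C) (K de : R) : 0 < de -> (0 <= K)%R ->
  (forall z : C, z <> 0 -> Cmod z < de ->
    (Cmod (csum (fun n => (a n * z ^ n)%C) N) <= K * Cmod z ^ N)%R) ->
  forall n, (n < N)%nat -> a n = 0.
Proof.
  intros Hde HK; revert a; induction N as [|N IH]; intros a H n Hn; [lia|].
  set (Q := fun z : C => csum (fun n => a (S n) * z ^ n) N).
  assert (E : forall z : C, csum (fun n => a n * z ^ n) (S N) = a 0%nat + z * Q z).
  { intros z; rewrite csum_head; unfold Q; rewrite <- csum_scal.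
    replace (a 0%nat * z ^ 0) with (a 0%nat) by (simpl; ring); f_equal.
    apply csum_ext; intros k; rewrite Cpow_S; ring. }
  assert (E0 : a 0%nat = 0).
  { apply Ceq_of_small; intros eps Heps; replace (a 0%nat - 0) with (a 0%nat) by ring.
    set (L := (K + rsum (fun n => Cmod (a (S n))) N + 1)%R).
    assert (HL1 : (0 <= rsum (fun n => Cmod (a (S n))) N)%R).
    { apply (rsum_mono (fun n => Cmod (a (S n))) 0 N); [intros; apply Cmod_ge_0|lia]. }
    set (t := Rmin (Rmin (de / 2) 1) (eps / L)).
    assert (Ht : 0 < t).
    { repeat apply Rmin_pos; try lra; apply Rdiv_lt_0_compat; unfold L; lra. }
    assert (T1 : (t <= de / 2 /\ t <= 1 /\ t <= eps / L)%R).
    { unfold t; pose proof (Rmin_l (Rmin (de / 2) 1) (eps / L)).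
      pose proof (Rmin_r (Rmin (de / 2) 1) (eps / L)).
      pose proof (Rmin_l (de / 2) 1); pose proof (Rmin_r (de / 2) 1); lra. }
    assert (Ct : Cmod (RtoC t) = t) by (apply Cmod_RtoC_pos; lra).
    assert (B := H (RtoC t) ltac:(intros E1; apply RtoC_inj in E1; lra) ltac:(lra)).
    rewrite E, Ct in B.
    assert (HQ : (Cmod (Q t) <= rsum (fun n => Cmod (a (S n))) N)%R).
    { apply (csum_Cmod_le (fun n => a (S n))); lra. }
    pose proof (Cmod_triangle (a 0%nat + t * Q t) (- (t * Q t))) as T.
    replace (a 0%nat + t * Q t + - (t * Q t)) with (a 0%nat) in T by ring.
    rewrite Cmod_opp, Cmod_mult, Ct in T.
    assert (t ^ S N <= t)%R.
    { simpl; rewrite <- (Rmult_1_r t) at 3; apply Rmult_le_compat_l; [lra|].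
      rewrite <- (pow1 N); apply pow_incr; lra. }
    assert (K * t ^ S N <= K * t)%R by (now apply Rmult_le_compat_l).
    assert (t * Cmod (Q t) <= t * rsum (fun n => Cmod (a (S n))) N)%R
      by (apply Rmult_le_compat_l; lra).
    assert (t * L <= eps)%R.
    { apply Rle_trans with (eps / L * L)%R; [apply Rmult_le_compat_r; [unfold L|]; lra|].
      right; field; unfold L; lra. }
    unfold L in *; lra. }
  destruct n as [|n]; [assumption|].
  apply (IH (fun n => a (S n))); [|lia]; intros z Hz0 Hz.
  specialize (H z Hz0 Hz); rewrite E, E0, Cplus_0_l, Cmod_mult in H; fold (Q z).
  apply Cmod_gt_0 in Hz0; apply Rmult_le_reg_l with (Cmod z); [assumption|].
  simpl pow in H; lra.
Qed.

(** No maximum principle is used. Since [om ^ N] vanishes to order [N] at 0, its first [N] Taylor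
    coefficients are 0, and the Cauchy remainder gives [|om z| ^ N <= q ^ N / (1 - q)] with
    [q = |z| / rho]. For large [N] this forces [|om z| <= q]; then [rho] tends to [r]. *)
Lemma schwarz (om : C -> C) (r : R) :
  (forall z, Cmod z < r -> exists d, sdiff om z d) ->
  (forall z, Cmod z < r -> Cmod (om z) <= 1) -> om 0 = 0 ->
  forall z, Cmod z < r -> (Cmod (om z) * r <= Cmod z)%R.
Proof.
  intros Hsd H1 H0 z Hz.
  pose proof (Cmod_ge_0 z) as Hz0.
  assert (Hr : 0 < r) by lra.
  assert (Main : forall rho, (Cmod z < rho < r)%R -> (Cmod (om z) * rho <= Cmod z)%R).
  { intros rho Hrho; apply Rnot_lt_le; intros Hlt.
    assert (Hom : 0 < Cmod (om z)).
    { destruct (Req_dec (Cmod (om z)) 0) as [E|E]; [rewrite E in Hlt; lra|].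
      pose proof (Cmod_ge_0 (om z)); lra. }
    set (q := (Cmod z / rho)%R) in *.
    assert (Hq : (0 <= q < 1)%R).
    { unfold q; split; [apply Rdiv_le_0_compat; lra|].
      apply Rmult_lt_reg_r with rho; [lra|]; unfold Rdiv; rewrite Rmult_assoc, Rinv_l; lra. }
    assert (Hqo : (q < Cmod (om z))%R).
    { unfold q; apply Rmult_lt_reg_r with rho; [lra|].
      unfold Rdiv; rewrite Rmult_assoc, Rinv_l; lra. }
    assert (Hpow : forall N, (Cmod (om z) ^ N <= q ^ N / (1 - q))%R).
    { intros N.
      destruct (cauchy_expansion (fun x => om x ^ N) r rho 1 ltac:(lra)) as [a Ha].
      - intros x Hx; destruct (Hsd x Hx) as [d Hd]; eexists; apply sdiff_pow, Hd.
      - intros x Hx; rewrite Cmod_pow, <- (pow1 N); apply pow_incr.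
        split; [apply Cmod_ge_0|apply H1; lra].
      - destruct (Hsd 0 ltac:(rewrite Cmod_0; lra)) as [d Hd].
        destruct (sdiff_lip om 0 d Hd) as [de [Hde Hlip]].
        set (L := (Cmod d + 1)%R); assert (HL : (0 <= L)%R) by (pose proof (Cmod_ge_0 d); unfold L; lra).
        assert (HLx : forall x, Cmod x < de -> (Cmod (om x) <= L * Cmod x)%R).
        { intros x Hx; specialize (Hlip x 0); rewrite H0 in Hlip.
          replace (x - 0) with x in Hlip by ring; replace (om x - 0) with (om x) in Hlip by ring.
          replace (0 - 0) with (RtoC 0) in Hlip by ring; rewrite Cmod_0 in Hlip; now apply Hlip. }
        (* Near 0 both [om x ^ N] and the Cauchy remainder are of order [|x| ^ N], hence so is the
           Taylor polynomial. *)
        assert (Hz' : forall n, (n < N)%nat -> a n = 0).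
        { apply (csum_power_eq_0 N a (L ^ N + (/ rho) ^ N * 2) (Rmin de (rho / 2))).
          - apply Rmin_pos; lra.
          - assert (0 <= L ^ N)%R by (now apply pow_le).
            assert (0 <= (/ rho) ^ N)%R by (apply pow_le; left; apply Rinv_0_lt_compat; lra).
            lra.
          - intros x _ Hx; pose proof (Rmin_l de (rho / 2)); pose proof (Rmin_r de (rho / 2)).
            specialize (Ha x N ltac:(lra)).
            pose proof (Cmod_ge_0 x) as Hx0.
            assert (P1 : (Cmod (om x ^ N) <= L ^ N * Cmod x ^ N)%R).
            { rewrite Cmod_pow, <- Rpow_mult_distr; apply pow_incr.
              split; [apply Cmod_ge_0|apply HLx; lra]. }
            assert (P2 : (1 * (Cmod x / rho) ^ N / (1 - Cmod x / rho) <=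
                (/ rho) ^ N * 2 * Cmod x ^ N)%R).
            { unfold Rdiv at 1 2; rewrite Rpow_mult_distr.
              replace ((/ rho) ^ N * 2 * Cmod x ^ N)%R with
                (1 * (Cmod x ^ N * (/ rho) ^ N) * 2)%R by ring.
              apply Rmult_le_compat_l.
              - rewrite Rmult_1_l; apply Rmult_le_pos; apply pow_le; [assumption|].
                left; apply Rinv_0_lt_compat; lra.
              - replace 2%R with (/ (1 / 2))%R by field; apply Rinv_le_contravar; [lra|].
                enough (Cmod x / rho <= 1 / 2)%R by lra.
                apply Rmult_le_reg_r with rho; [lra|].
                unfold Rdiv; rewrite Rmult_assoc, Rinv_l; lra. }
            pose proof (Cmod_rtriangle (csum (fun n => (a n * x ^ n)%C) N) (om x ^ N)) as T.
            rewrite Cmod_minus_sym in T; lra. }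
        specialize (Ha z N ltac:(lra)); fold q in Ha.
        rewrite <- Cmod_pow.
        replace (om z ^ N) with (om z ^ N - csum (fun n => a n * z ^ n) N).
        + eapply Rle_trans; [exact Ha|right; unfold Rdiv; ring].
        + replace (csum (fun n => a n * z ^ n) N) with (RtoC 0); [ring|].
          clear -Hz'; induction N as [|N IH]; [reflexivity|].
          simpl; rewrite <- IH by (intros; apply Hz'; lia); rewrite Hz' by lia; ring. }
    destruct (pow_small (q / Cmod (om z)) (/ (1 - q)) (1 / 2)) as [N HN]; [|lra|].
    { split; [apply Rdiv_le_0_compat; lra|]; apply Rmult_lt_reg_r with (Cmod (om z)); [lra|].
      unfold Rdiv; rewrite Rmult_assoc, Rinv_l; lra. }
    specialize (Hpow N).
    assert (0 < Cmod (om z) ^ N)%R by (now apply pow_lt).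
    unfold Rdiv in HN at 1; rewrite Rpow_mult_distr, pow_inv in HN.
    apply (Rmult_le_compat_r (Cmod (om z) ^ N)) in HN; [|lra].
    replace (/ (1 - q) * (q ^ N * / Cmod (om z) ^ N) * Cmod (om z) ^ N)%R with
      (q ^ N / (1 - q))%R in HN by (field; lra).
    lra. }
  apply Rnot_lt_le; intros Hlt.
  assert (Hom := H1 z Hz); pose proof (Cmod_ge_0 (om z)).
  (* If the bound failed at [r], it would already fail at the smaller radius [m / Cmod (om z)]. *)
  set (m := ((Cmod z + Cmod (om z) * r) / 2)%R).
  assert (Hm : (Cmod z < m < Cmod (om z) * r)%R) by (unfold m; lra).
  assert (Hom0 : 0 < Cmod (om z)) by nra.
  assert (Hmr : (Cmod z < m / Cmod (om z) < r)%R).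
  { split.
    - apply Rmult_lt_reg_r with (Cmod (om z)); [assumption|].
      unfold Rdiv; rewrite Rmult_assoc, Rinv_l by lra; nra.
    - apply Rmult_lt_reg_r with (Cmod (om z)); [assumption|].
      unfold Rdiv; rewrite Rmult_assoc, Rinv_l by lra; lra. }
  specialize (Main _ Hmr).
  replace (Cmod (om z) * (m / Cmod (om z)))%R with m in Main by (field; lra).
  lra.
Qed.

(** Bolzano-Weierstrass through compactness of a square. Without a cluster point, every point has a
    neighbourhood avoided by [u s] for all small [s]; a uniform size [d] then excludes [u d] itself.
    The factor 2 on [de] covers the comparison of squares with disks. *)
Lemma cluster_point (u : R -> C) (M : R) : (forall s, 0 < s -> Cmod (u s) <= M) ->
  exists l : C, forall eps : R, 0 < eps -> exists s : R, (0 < s < eps)%R /\ Cmod (u s - l) < eps.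
Proof.
  intros HM; apply NNPP; intros Hno.
  assert (Hex : forall x y : R, exists de : posreal, forall s, (0 < s < 2 * de)%R ->
    (2 * de <= Cmod (u s - (x, y)))%R).
  { intros x y; apply NNPP; intros Hc; apply Hno; exists (x, y); intros eps Heps.
    apply NNPP; intros Hc2; apply Hc.
    assert (He : (0 < eps / 2)%R) by lra; exists (mkposreal _ He); simpl; intros s Hs.
    apply Rnot_lt_le; intros Hlt; apply Hc2; exists s; lra. }
  pose (delta := fun x y => proj1_sig (constructive_indefinite_description _ (Hex x y))).
  assert (Hdelta : forall x y s, (0 < s < 2 * delta x y)%R ->
    (2 * delta x y <= Cmod (u s - (x, y)))%R).
  { intros x y; exact (proj2_sig (constructive_indefinite_description _ (Hex x y))). }
  destruct (compactness_value_2d (- M) M (- M) M delta) as [d Hd].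
  pose proof (cond_pos d) as Hd0.
  set (s := pos d); assert (Hs : 0 < s) by exact Hd0.
  assert (B : (Rabs (fst (u s)) <= M /\ Rabs (snd (u s)) <= M)%R).
  { specialize (HM s Hs); pose proof (Rmax_Cmod (u s)).
    pose proof (Rmax_l (Rabs (fst (u s))) (Rabs (snd (u s)))).
    pose proof (Rmax_r (Rabs (fst (u s))) (Rabs (snd (u s)))); lra. }
  destruct B as [B1 B2]; apply Rabs_le_between in B1; apply Rabs_le_between in B2.
  apply (Hd _ _ B1 B2); intros [x [y [_ [_ [Hx [Hy Hle]]]]]].
  specialize (Hdelta x y s); fold s in Hle; pose proof (cond_pos (delta x y)) as Hp.
  specialize (Hdelta ltac:(unfold s in *; lra)).
  pose proof (Cmod_2Rmax (u s - (x, y))) as H.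
  assert (Hm : (Rmax (Rabs (fst (u s - (x, y))%C)) (Rabs (snd (u s - (x, y))%C)) < delta x y)%R).
  { apply Rmax_lub_lt; assumption. }
  assert (Hs2 : (sqrt 2 <= 2)%R).
  { rewrite <- (sqrt_Rsqr 2) at 2 by lra; apply sqrt_le_1_alt; unfold Rsqr; lra. }
  set (mm := Rmax (Rabs (fst (u s - (x, y))%C)) (Rabs (snd (u s - (x, y))%C))) in *.
  assert (0 <= mm)%R by (eapply Rle_trans; [apply Rabs_pos|apply Rmax_l]).
  assert (sqrt 2 * mm <= 2 * mm)%R by (now apply Rmult_le_compat_r).
  lra.
Qed.

(** * Boundary contact *)

Lemma Re_le_Cmod (z : C) : (Re z <= Cmod z)%R.
Proof. pose proof (re_le_Cmod z); pose proof (Rle_abs (Re z)); lra. Qed.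

(** From [2 * m <= 1 + m ^ 2] with [m] the modulus on the left. *)
Lemma Cmod_one_minus_le (s : R) (u : C) : (0 <= s)%R ->
  (Cmod (1 - s * u) <= 1 - s * Re u + s * s * (Cmod u) ^ 2 / 2)%R.
Proof.
  intros Hs.
  assert (E : (Cmod (1 - s * u) ^ 2 = 1 - 2 * s * Re u + s * s * (Cmod u) ^ 2)%R).
  { rewrite !Cmod2_alt; destruct u as [x y]; simpl; ring. }
  set (m := Cmod (1 - s * u)) in *; assert (0 <= (m - 1) ^ 2)%R by apply pow2_ge_0.
  nra.
Qed.

Lemma local_lip_of_derive (h : C -> C) (z0 e : C) :
  (forall eps : R, 0 < eps -> exists de : R, 0 < de /\ forall z, Cmod (z - z0) < de ->
    (Cmod (h z - h z0 - e * (z - z0)) <= eps * Cmod (z - z0))%R) ->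
  exists de : R, 0 < de /\ forall z, Cmod (z - z0) < de ->
    (Cmod (h z - h z0) <= (Cmod e + 1) * Cmod (z - z0))%R.
Proof.
  intros H; destruct (H 1%R Rlt_0_1) as [de [Hd Hz]]; exists de; split; [assumption|].
  intros z Hlt; specialize (Hz z Hlt).
  pose proof (Cmod_triangle (h z - h z0 - e * (z - z0)) (e * (z - z0))) as T.
  replace (h z - h z0 - e * (z - z0) + e * (z - z0)) with (h z - h z0) in T by ring.
  rewrite Cmod_mult in T; lra.
Qed.

(* The values of [|om - ze0|] cannot lie in [[eps/2, eps)], so by the intermediate value
   theorem the cluster point [ze0] of the radial values is an unrestricted limit. *)
Lemma contact_limit (om K h : C -> C) (r0 : R) (z0 ze0 k e : C) :
  0 < r0 -> Cmod z0 = r0 ->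
  (forall z, Cmod z < r0 -> exists d, sdiff om z d) ->
  k <> 0 -> sdiff K ze0 k -> K ze0 = h z0 ->
  (forall eps : R, 0 < eps -> exists de : R, 0 < de /\ forall z, Cmod (z - z0) < de ->
    (Cmod (h z - h z0 - e * (z - z0)) <= eps * Cmod (z - z0))%R) ->
  (exists eta : R, 0 < eta /\ forall z, Cmod z < r0 -> Cmod (z - z0) < eta ->
    Cmod (om z - ze0) < eta -> K (om z) = h z) ->
  (forall eps : R, 0 < eps -> exists s : R, (0 < s < eps)%R /\
    Cmod (om ((1 - s)%R * z0) - ze0) < eps) ->
  exists (de L : R), 0 < de /\ (0 <= L)%R /\ forall z, Cmod z < r0 -> Cmod (z - z0) < de ->
    (Cmod (om z - ze0) <= L * Cmod (z - z0))%R /\ K (om z) = h z.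
Proof.
  intros Hr0 Hz0 Hom Hk HK HK0 Hh [eta [Heta HKh]] Hcl.
  destruct (sdiff_expand K ze0 k Hk HK) as [d1 [Hd1 H1]].
  destruct (local_lip_of_derive h z0 e Hh) as [d2 [Hd2 H2]].
  apply Cmod_gt_0 in Hk; pose proof (Cmod_ge_0 e).
  set (L := (2 / Cmod k * (Cmod e + 1))%R).
  assert (HL : (0 <= L)%R) by (apply Rmult_le_pos; [apply Rdiv_le_0_compat|]; lra).
  set (ep := Rmin d1 eta); assert (Hep : 0 < ep) by (now apply Rmin_pos).
  assert (Hep1 : (ep <= d1)%R) by apply Rmin_l; assert (Hep2 : (ep <= eta)%R) by apply Rmin_r.
  set (de := Rmin (Rmin d2 eta) (ep / (2 * (L + 1)))).
  assert (Hde : 0 < de).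
  { repeat apply Rmin_pos; try assumption; apply Rdiv_lt_0_compat; lra. }
  assert (Hdes : (de <= d2)%R /\ (de <= eta)%R /\ (L * de < ep / 2)%R).
  { unfold de; pose proof (Rmin_l (Rmin d2 eta) (ep / (2 * (L + 1)))).
    pose proof (Rmin_r (Rmin d2 eta) (ep / (2 * (L + 1)))).
    pose proof (Rmin_l d2 eta); pose proof (Rmin_r d2 eta); repeat split; try lra.
    fold de in H3, H4 |- *.
    apply Rlt_le_trans with ((L + 1) * de)%R; [lra|].
    apply Rle_trans with ((L + 1) * (ep / (2 * (L + 1))))%R.
    - apply Rmult_le_compat_l; lra.
    - right; field; lra. }
  destruct Hdes as [De1 [De2 De3]].
  assert (Key : forall z, Cmod z < r0 -> Cmod (z - z0) < de -> Cmod (om z - ze0) < ep ->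
    (Cmod (om z - ze0) <= L * Cmod (z - z0))%R /\ K (om z) = h z).
  { intros z Hz Hzz Ho.
    assert (E : K (om z) = h z) by (apply HKh; lra); split; [|exact E].
    specialize (H1 (om z) ze0 ltac:(lra) ltac:(rewrite Cmod_self_minus; assumption)).
    rewrite E, HK0 in H1; specialize (H2 z ltac:(lra)).
    eapply Rle_trans; [exact H1|]; unfold L; rewrite Rmult_assoc.
    apply Rmult_le_compat_l; [apply Rdiv_le_0_compat; lra|assumption]. }
  exists de, L; split; [assumption|split; [assumption|]]; intros z Hz Hzz.
  apply Key; [assumption|assumption|].
  destruct (Hcl (Rmin (Rmin 1 (de / r0)) (ep / 2))) as [s [Hs Hos]].
  { repeat apply Rmin_pos; try lra; now apply Rdiv_lt_0_compat. }
  pose proof (Rmin_l (Rmin 1 (de / r0)) (ep / 2)); pose proof (Rmin_r (Rmin 1 (de / r0)) (ep / 2)).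
  pose proof (Rmin_l 1 (de / r0)); pose proof (Rmin_r 1 (de / r0)).
  set (zs := (1 - s)%R * z0) in *.
  assert (Hzs : Cmod zs < r0).
  { unfold zs; rewrite Cmod_mult, Cmod_RtoC_pos, Hz0 by lra; nra. }
  assert (Hzs0 : Cmod (zs - z0) < de).
  { replace (zs - z0) with (- (s * z0)) by (unfold zs; rewrite RtoC_minus; ring).
    rewrite Cmod_opp, Cmod_mult, Cmod_RtoC_pos, Hz0 by lra.
    apply Rlt_le_trans with (de / r0 * r0)%R; [apply Rmult_lt_compat_r; lra|right; field; lra]. }
  assert (Hg1 : forall t, (0 <= t <= 1)%R -> Cmod (ray zs z t) < r0).
  { intros t Ht; now apply ray_Cmod. }
  assert (Hg2 : forall t, (0 <= t <= 1)%R -> Cmod (ray zs z t - z0) < de).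
  { intros t Ht; replace (ray zs z t - z0) with (ray (zs - z0) (z - z0) t) by (unfold ray; ring).
    now apply ray_Cmod. }
  apply Rnot_le_lt; intros Hbad.
  (* The value [3 / 4 * ep] lies in the forbidden gap: the distance is below [ep / 2] at [zs] and,
     by assumption, at least [ep] at [z]. *)
  destruct (IVT_interv (fun t => Cmod (om (ray zs z t) - ze0) - 3 / 4 * ep)%R 0 1) as [t [Ht1 Ht2]].
  - intros t Ht eps Heps; destruct (Hom _ (Hg1 t Ht)) as [d Hd].
    destruct (sdiff_cont _ _ _ Hd eps Heps) as [d3 [Hd3 H3']].
    exists (d3 / (Cmod (z - zs) + 1))%R; pose proof (Cmod_ge_0 (z - zs)).
    split; [apply Rdiv_lt_0_compat; lra|]; intros x [_ Hx].
    change (Rabs (Cmod (om (ray zs z x) - ze0) - 3 / 4 * ep -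
      (Cmod (om (ray zs z t) - ze0) - 3 / 4 * ep)) < eps).
    change (Rabs (x - t) < d3 / (Cmod (z - zs) + 1)) in Hx.
    assert (B : Cmod (om (ray zs z x) - om (ray zs z t)) < eps).
    { apply H3'; rewrite ray_diff, Cmod_mult, Cmod_R.
      apply Rle_lt_trans with (Rabs (x - t) * (Cmod (z - zs) + 1))%R.
      - apply Rmult_le_compat_l; [apply Rabs_pos|lra].
      - apply Rlt_le_trans with (d3 / (Cmod (z - zs) + 1) * (Cmod (z - zs) + 1))%R.
        + apply Rmult_lt_compat_r; lra.
        + right; field; lra. }
    pose proof (Cmod_triangle_minus (om (ray zs z x)) (om (ray zs z t)) ze0).
    pose proof (Cmod_triangle_minus (om (ray zs z t)) (om (ray zs z x)) ze0) as T2.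
    rewrite (Cmod_minus_sym (om (ray zs z t)) (om (ray zs z x))) in T2.
    apply Rabs_def1; lra.
  - lra.
  - replace (ray zs z 0) with zs by (unfold ray; ring); lra.
  - replace (ray zs z 1) with z by (unfold ray; ring); lra.
  - assert (B := proj1 (Key _ (Hg1 t Ht1) (Hg2 t Ht1) ltac:(lra))).
    specialize (Hg2 t Ht1).
    assert (L * Cmod (ray zs z t - z0) <= L * de)%R by (apply Rmult_le_compat_l; lra).
    lra.
Qed.

(** The chain rule read backwards: to first order [k * (om z - ze0)] equals [e * (z - z0)]. The
    result is a derivative at [z0] taken from within the disk only. *)
Lemma contact_derivative (om K h : C -> C) (r0 : R) (z0 ze0 k e : C) :
  0 < r0 -> Cmod z0 = r0 ->
  (forall z, Cmod z < r0 -> exists d, sdiff om z d) ->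
  k <> 0 -> sdiff K ze0 k -> K ze0 = h z0 ->
  (forall eps : R, 0 < eps -> exists de : R, 0 < de /\ forall z, Cmod (z - z0) < de ->
    (Cmod (h z - h z0 - e * (z - z0)) <= eps * Cmod (z - z0))%R) ->
  (exists eta : R, 0 < eta /\ forall z, Cmod z < r0 -> Cmod (z - z0) < eta ->
    Cmod (om z - ze0) < eta -> K (om z) = h z) ->
  (forall eps : R, 0 < eps -> exists s : R, (0 < s < eps)%R /\
    Cmod (om ((1 - s)%R * z0) - ze0) < eps) ->
  forall eps : R, 0 < eps -> exists de : R, 0 < de /\ forall z, Cmod z < r0 ->
    Cmod (z - z0) < de -> (Cmod (om z - ze0 - e / k * (z - z0)) <= eps * Cmod (z - z0))%R.
Proof.
  intros Hr0 Hz0 Hom Hk HK HK0 Hh HKh Hcl eps Heps.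
  destruct (contact_limit om K h r0 z0 ze0 k e Hr0 Hz0 Hom Hk HK HK0 Hh HKh Hcl)
    as [d1 [L [Hd1 [HL H1]]]].
  apply Cmod_gt_0 in Hk as Hk'.
  (* The error of [K] is measured in [om z - ze0]; the Lipschitz constant [L] converts it to
     [z - z0]. *)
  set (e1 := (eps * Cmod k / (2 * (L + 1)))%R).
  assert (He1 : 0 < e1) by (apply Rdiv_lt_0_compat; [apply Rmult_lt_0_compat|]; lra).
  destruct (HK e1 He1) as [d2 [Hd2 H2]].
  destruct (Hh (eps * Cmod k / 2)%R) as [d3 [Hd3 H3]].
  { apply Rdiv_lt_0_compat; [apply Rmult_lt_0_compat|]; lra. }
  exists (Rmin (Rmin d1 d3) (d2 / (L + 1))); split.
  { repeat apply Rmin_pos; try assumption; apply Rdiv_lt_0_compat; lra. }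
  intros z Hz Hzz.
  pose proof (Rmin_l (Rmin d1 d3) (d2 / (L + 1))); pose proof (Rmin_r (Rmin d1 d3) (d2 / (L + 1))).
  pose proof (Rmin_l d1 d3); pose proof (Rmin_r d1 d3).
  destruct (H1 z Hz ltac:(lra)) as [B1 E1]; specialize (H3 z ltac:(lra)).
  set (u := Cmod (z - z0)) in *; assert (Hu : (0 <= u)%R) by apply Cmod_ge_0.
  assert (B2 : Cmod (om z - ze0) < d2).
  { apply Rle_lt_trans with (L * u)%R; [assumption|].
    apply Rle_lt_trans with ((L + 1) * u)%R; [lra|].
    apply Rlt_le_trans with ((L + 1) * (d2 / (L + 1)))%R.
    - apply Rmult_lt_compat_l; lra.
    - right; field; lra. }
  specialize (H2 (om z) ze0 B2 ltac:(rewrite Cmod_self_minus; assumption)).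
  rewrite E1, HK0 in H2.
  replace (om z - ze0 - e / k * (z - z0)) with
    (((h z - h z0 - e * (z - z0)) - (h z - h z0 - k * (om z - ze0))) / k) by (field; assumption).
  rewrite Cmod_div by assumption.
  apply Rmult_le_reg_r with (Cmod k); [assumption|].
  unfold Rdiv; rewrite Rmult_assoc, Rinv_l, Rmult_1_r by lra.
  eapply Rle_trans; [apply Cmod_triangle|]; rewrite Cmod_opp.
  assert (e1 * Cmod (om z - ze0) <= e1 * ((L + 1) * u))%R.
  { apply Rmult_le_compat_l; lra. }
  assert (e1 * ((L + 1) * u) = eps * Cmod k / 2 * u)%R by (unfold e1; field; lra).
  lra.
Qed.

(* A version of the Jack and Julia-Wolff lemmas which needs no extension of [om] across [z0]:
   comparing [|om z| <= |z| / r0] to first order along [z = z0 (1 - s u)] gives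
   [Re (mu u) >= Re u] whenever [Re u > 0], which forces [mu] to be real and at least one. *)
Lemma boundary_contact (om K h : C -> C) (r0 : R) (z0 ze0 k e : C) :
  0 < r0 -> Cmod z0 = r0 -> Cmod ze0 = 1%R ->
  (forall z, Cmod z < r0 -> exists d, sdiff om z d) ->
  (forall z, Cmod z < r0 -> (Cmod (om z) * r0 <= Cmod z)%R) ->
  k <> 0 -> sdiff K ze0 k -> K ze0 = h z0 ->
  (forall eps : R, 0 < eps -> exists de : R, 0 < de /\ forall z, Cmod (z - z0) < de ->
    (Cmod (h z - h z0 - e * (z - z0)) <= eps * Cmod (z - z0))%R) ->
  (exists eta : R, 0 < eta /\ forall z, Cmod z < r0 -> Cmod (z - z0) < eta ->
    Cmod (om z - ze0) < eta -> K (om z) = h z) ->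
  (forall eps : R, 0 < eps -> exists s : R, (0 < s < eps)%R /\
    Cmod (om ((1 - s)%R * z0) - ze0) < eps) ->
  exists m : R, (1 <= m)%R /\ z0 * e = m * (ze0 * k).
Proof.
  intros Hr0 Hz0 Hze0 Hom Hsch Hk HK HK0 Hh HKh Hcl.
  pose proof (contact_derivative om K h r0 z0 ze0 k e Hr0 Hz0 Hom Hk HK HK0 Hh HKh Hcl) as Hd.
  (* As [ze0] has modulus 1, [z0 * e = mu * (ze0 * k)]; it remains to show that [mu] is real and at
     least 1. *)
  set (mu := Cconj ze0 * (e / k) * z0).
  assert (Hcc : Cconj ze0 * ze0 = 1).
  { rewrite Cmult_comm, <- Cmod2_conj, Hze0; f_equal; ring. }
  assert (Main : forall u : C, 0 < Re u -> (Re u <= Re (mu * u))%R).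
  { intros u Hu; apply Rnot_lt_le; intros Hlt.
    assert (Hu0 : 0 < Cmod u) by (pose proof (Re_le_Cmod u); lra).
    set (g := (Re u - Re (mu * u))%R) in *; assert (Hg : 0 < g) by (unfold g; lra).
    set (eps := (g / (4 * r0 * Cmod u))%R).
    assert (Heps : 0 < eps).
    { apply Rdiv_lt_0_compat; [assumption|]; apply Rmult_lt_0_compat; lra. }
    destruct (Hd eps Heps) as [de [Hde HD]].
    set (U2 := ((Cmod u) ^ 2)%R); assert (HU2 : 0 < U2) by (apply pow_lt; assumption).
    (* The first bound keeps [z] where the derivative estimate holds, the second makes the quadratic
       term smaller than the gap [g], and the third keeps [z] in the disk. *)
    set (s := Rmin (de / (2 * r0 * Cmod u)) (Rmin (g / U2) (Re u / U2))).
    assert (Hs : 0 < s).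
    { repeat apply Rmin_pos; apply Rdiv_lt_0_compat; try assumption.
      apply Rmult_lt_0_compat; lra. }
    assert (Hs1 : (s * (r0 * Cmod u) <= de / 2)%R).
    { apply Rle_trans with (de / (2 * r0 * Cmod u) * (r0 * Cmod u))%R.
      - apply Rmult_le_compat_r; [apply Rmult_le_pos; lra|apply Rmin_l].
      - right; field; lra. }
    assert (Hs2 : (s * U2 <= g)%R).
    { apply Rle_trans with (g / U2 * U2)%R; [|right; field; lra].
      apply Rmult_le_compat_r; [lra|].
      eapply Rle_trans; [apply Rmin_r|apply Rmin_l]. }
    assert (Hs3 : (s * U2 <= Re u)%R).
    { apply Rle_trans with (Re u / U2 * U2)%R; [|right; field; lra].
      apply Rmult_le_compat_r; [lra|].
      eapply Rle_trans; [apply Rmin_r|apply Rmin_r]. }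
    pose proof (Cmod_one_minus_le s u ltac:(lra)) as Bu; fold U2 in Bu.
    set (z := z0 * (1 - s * u)).
    assert (Ez : Cmod z = (r0 * Cmod (1 - s * u))%R) by (unfold z; now rewrite Cmod_mult, Hz0).
    assert (Ezz : Cmod (z - z0) = (s * (r0 * Cmod u))%R).
    { replace (z - z0) with (- (s * (z0 * u))) by (unfold z; ring).
      rewrite Cmod_opp, !Cmod_mult, Hz0, Cmod_RtoC_pos by lra; reflexivity. }
    assert (Hz1 : Cmod (1 - s * u) < 1) by nra.
    assert (Hz : Cmod z < r0) by (rewrite Ez; nra).
    specialize (HD z Hz ltac:(lra)); specialize (Hsch z Hz).
    assert (Ho : (Cmod (om z) <= Cmod (1 - s * u))%R).
    { apply Rmult_le_reg_r with r0; [assumption|lra]. }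
    set (E := Cconj ze0 * (om z - ze0 - e / k * (z - z0))).
    assert (HE : (Cmod E <= eps * (s * (r0 * Cmod u)))%R).
    { unfold E; rewrite Cmod_mult, Cmod_conj, Hze0, Rmult_1_l, <- Ezz; exact HD. }
    assert (EE : Cconj ze0 * om z = 1 - s * (mu * u) + E).
    { unfold E, mu; replace (z - z0) with (- (s * (z0 * u))) by (unfold z; ring).
      rewrite <- Hcc; ring. }
    assert (HR : (Re (1 - s * (mu * u) + E) <= Cmod (om z))%R).
    { rewrite <- EE; eapply Rle_trans; [apply Re_le_Cmod|].
      rewrite Cmod_mult, Cmod_conj, Hze0; lra. }
    assert (ER : (Re (1 - s * (mu * u) + E) = 1 - s * Re (mu * u) + Re E)%R).
    { destruct (mu * u), E; simpl; ring. }
    assert (HRE : (- Cmod E <= Re E)%R).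
    { pose proof (re_le_Cmod E); pose proof (Rle_abs (- Re E)); rewrite Rabs_Ropp in H0; lra. }
    assert (X : (eps * (s * (r0 * Cmod u)) = s * g / 4)%R) by (unfold eps; field; lra).
    assert (s * g <= s * s * U2 / 2 + s * g / 4)%R by (unfold g in *; lra).
    assert (s * (s * U2) <= s * g)%R by (apply Rmult_le_compat_l; lra).
    nra. }
  destruct mu as [x y] eqn:Emu.
  assert (Hx : (1 <= x)%R).
  { specialize (Main 1); simpl in Main; lra. }
  assert (Hy : y = 0%R).
  { apply NNPP; intros Hy; set (N := ((x + 1) / (y * y))%R).
    assert (Hyy : (0 < y * y)%R) by nra.
    specialize (Main (1%R, (N * y)%R)); simpl in Main.
    assert (N * y * y = x + 1)%R by (unfold N; field; assumption).
    nra. }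
  subst y; exists x; split; [assumption|].
  change (x, 0%R) with (RtoC x) in Emu; rewrite <- Emu; unfold mu.
  replace (Cconj ze0 * (e / k) * z0 * (ze0 * k)) with (z0 * e * (Cconj ze0 * ze0))
    by (field; assumption).
  rewrite Hcc; ring.
Qed.

(** * Corners, and the reciprocal at a zero *)

Lemma Rpower_small (be c : R) : 0 < be -> exists s0 : R, 0 < s0 /\
  forall s, (0 < s < s0)%R -> (c * Rpower s be < 1)%R.
Proof.
  intros Hb; set (c1 := (Rabs c + 1)%R); pose proof (Rabs_pos c).
  exists (Rpower (/ c1) (/ be)); split; [apply exp_pos|]; intros s Hs.
  assert (Hlt : (Rpower s be < / c1)%R).
  { replace (/ c1)%R with (Rpower (Rpower (/ c1) (/ be)) be).
    - now apply Rlt_Rpower_l.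
    - rewrite Rpower_mult, Rinv_l, Rpower_1; [reflexivity| |lra].
      apply Rinv_0_lt_compat; unfold c1; lra. }
  pose proof (Rle_abs c); assert (0 < Rpower s be) by apply exp_pos.
  apply Rle_lt_trans with (c1 * Rpower s be)%R.
  - apply Rmult_le_compat_r; unfold c1; lra.
  - replace 1%R with (c1 * / c1)%R by (field; unfold c1; lra).
    apply Rmult_lt_compat_l; [unfold c1; lra|assumption].
Qed.

(** [sdiff_expand] turns the bound on [K] into [|om - ze0| <= 2 / |k| * D * s ^ be], while Schwarz's
    bound forces [|om - ze0| >= s]. *)
Lemma corner_exclusion (om K : C -> C) (r0 be D : R) (z0 ze0 k : C) :
  0 < r0 -> Cmod z0 = r0 -> Cmod ze0 = 1%R ->
  (forall z, Cmod z < r0 -> (Cmod (om z) * r0 <= Cmod z)%R) ->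
  k <> 0 -> sdiff K ze0 k -> K ze0 = 0 -> 1 < be ->
  (exists eta : R, 0 < eta /\ forall s, (0 < s < eta)%R ->
    Cmod (om ((1 - s)%R * z0) - ze0) < eta ->
    (Cmod (K (om ((1 - s)%R * z0)%C)) <= D * Rpower s be)%R) ->
  (forall eps : R, 0 < eps -> exists s : R, (0 < s < eps)%R /\
    Cmod (om ((1 - s)%R * z0) - ze0) < eps) -> False.
Proof.
  intros Hr0 Hz0 Hze0 Hsch Hk HK HK0 Hbe [eta [Heta HD]] Hcl.
  destruct (sdiff_expand K ze0 k Hk HK) as [d1 [Hd1 H1]].
  apply Cmod_gt_0 in Hk.
  destruct (Rpower_small (be - 1) (2 / Cmod k * D)) as [s0 [Hs0 Hsm]]; [lra|].
  destruct (Hcl (Rmin (Rmin d1 eta) (Rmin s0 1))) as [s [Hs Hos]].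
  { repeat apply Rmin_pos; lra. }
  pose proof (Rmin_l (Rmin d1 eta) (Rmin s0 1)); pose proof (Rmin_r (Rmin d1 eta) (Rmin s0 1)).
  pose proof (Rmin_l d1 eta); pose proof (Rmin_r d1 eta).
  pose proof (Rmin_l s0 1); pose proof (Rmin_r s0 1).
  specialize (HD s ltac:(lra) ltac:(lra)); specialize (Hsm s ltac:(lra)).
  set (o := om ((1 - s)%R * z0)) in *.
  specialize (H1 o ze0 ltac:(lra) ltac:(rewrite Cmod_self_minus; assumption)).
  rewrite HK0 in H1; replace (K o - 0) with (K o) in H1 by ring.
  assert (Hz : Cmod ((1 - s)%R * z0) = ((1 - s) * r0)%R).
  { rewrite Cmod_mult, Cmod_RtoC_pos, Hz0 by lra; reflexivity. }
  assert (So : (Cmod o <= 1 - s)%R).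
  { apply Rmult_le_reg_r with r0; [assumption|]; rewrite <- Hz; apply Hsch; rewrite Hz; nra. }
  pose proof (Cmod_rtriangle ze0 o) as T; rewrite Hze0, Cmod_minus_sym in T.
  assert (P : (Rpower s be = s * Rpower s (be - 1))%R).
  { rewrite <- (Rpower_1 s) at 2 by lra; rewrite <- Rpower_plus; f_equal; ring. }
  assert (B : (s <= 2 / Cmod k * (D * Rpower s be))%R).
  { eapply Rle_trans; [|eapply Rle_trans; [exact H1|]]; [lra|].
    apply Rmult_le_compat_l; [apply Rdiv_le_0_compat; lra|assumption]. }
  rewrite P in B.
  assert (s * (2 / Cmod k * D * Rpower s (be - 1)) < s * 1)%R by (apply Rmult_lt_compat_l; lra).
  lra.
Qed.

(** With [h = z - z0], write [f = h ^ k * u] and [f' = h ^ (k - 1) * v], where [v 0 = k * u 0]. The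
    quotient becomes [h * u / (z * v)], whose derivative at [h = 0] is [1 / (k * z0)]. The last
    hypothesis excludes [f] vanishing identically near [z0]. *)
Lemma zero_quotient (f : C -> C) (z0 : C) (r : R) : 0 < r -> z0 <> 0 -> f z0 = 0 ->
  (forall z, Cmod (z - z0) < r -> exists d, sdiff f z d) ->
  (forall eps : R, 0 < eps -> exists z, Cmod (z - z0) < eps /\ f z <> 0) ->
  exists k : nat, (1 <= k)%nat /\
    sdiff (fun z => f z / (z * C_derive f z)) z0 (/ (INR k * z0)) /\
    exists rho : R, 0 < rho /\ forall z : C, z <> z0 -> Cmod (z - z0) < rho ->
      z * C_derive f z <> 0.
Proof.
  intros Hr Hz0 Hf0 Hsd Hnz.
  pose (F := fun h => f (z0 + h)).
  destruct (cauchy_expansion_csums F r Hr) as [rho [a [Hrho Ha]]].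
  { intros h Hh; destruct (Hsd (z0 + h)) as [d Hd].
    - now replace (z0 + h - z0) with h by ring.
    - exists d; now apply sdiff_translate. }
  assert (Ha0 : a 0%nat = 0).
  { rewrite <- (csums_unique _ _ _ (Ha 0 ltac:(rewrite Cmod_0; assumption)) (csums_at_0 a)).
    unfold F; now replace (z0 + 0) with z0 by ring. }
  assert (Hex : exists n, a n <> 0).
  { apply NNPP; intros Hno; destruct (Hnz rho Hrho) as [z [Hz Hfz]]; apply Hfz.
    replace (f z) with (F (z - z0)) by (unfold F; f_equal; ring).
    apply (csums_unique _ _ _ (Ha _ Hz)).
    assert (Hall : forall n, a n = 0) by (intros n; apply NNPP; intros H; apply Hno; eauto).
    pose proof (csums_only_head (fun k => a k * (z - z0) ^ k)) as H; cbv beta in H.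
    rewrite Hall, Cmult_0_l in H; apply H; intros k; rewrite Hall; ring. }
  destruct (Wf_nat.dec_inh_nat_subset_has_unique_least_element (fun n => a n <> 0))
    as [k [[Hk1 Hk2] _]]; [intros n; apply classic|assumption|].
  assert (Hlow : forall n, (n < k)%nat -> a n = 0).
  { intros n Hn; apply NNPP; intros H; specialize (Hk2 n H); lia. }
  assert (Hk : (1 <= k)%nat) by (destruct k; [contradiction|lia]).
  destruct (power_series_factor a rho F k Ha Hlow) as [u [Hu0 [Hus Huf]]].
  assert (HF' : forall h, Cmod h < rho ->
    csums (fun n => INR (S n) * a (S n) * h ^ n) (C_derive f (z0 + h))).
  { intros h Hh; destruct (power_series_sdiff a rho F h Ha Hh) as [d [Hd Hds]].
    apply sdiff_translate, sdiff_C_derive in Hd; rewrite Hd.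
    apply (csums_shift (fun n => INR n * a n * h ^ pred n)); [simpl; ring|assumption]. }
  destruct (power_series_factor (fun n => INR (S n) * a (S n)) rho
    (fun h => C_derive f (z0 + h)) (pred k) HF') as [v [Hv0 [Hvs Hvf]]].
  { intros n Hn; rewrite Hlow by lia; ring. }
  replace (S (pred k)) with k in Hv0 by lia.
  assert (HkC : RtoC (INR k) <> 0).
  { intros E; apply RtoC_inj in E; apply (not_0_INR k); [lia|assumption]. }
  exists k; split; [assumption|].
  assert (HC0 : Cmod 0 < rho) by (rewrite Cmod_0; assumption).
  destruct (power_series_sdiff _ rho u 0 Hus HC0) as [u' [Hu' _]].
  destruct (power_series_sdiff _ rho v 0 Hvs HC0) as [v' [Hv' _]].
  assert (Hv00 : v 0 <> 0) by (rewrite Hv0; now apply Cmult_neq_0).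
  assert (Hden : (z0 + 0) * v 0 <> 0).
  { apply Cmult_neq_0; [|assumption]; now replace (z0 + 0) with z0 by ring. }
  assert (HS : sdiff (fun h => h * (u h / ((z0 + h) * v h))) 0 (/ (INR k * z0))).
  { assert (S1 := sdiff_mult _ _ _ _ _ (sdiff_id 0)
      (sdiff_div u (fun h => (z0 + h) * v h) 0 _ _ Hden Hu'
      (sdiff_mult _ _ _ _ _ (sdiff_plus _ _ _ _ _ (sdiff_const z0 0) (sdiff_id 0)) Hv'))).
    cbv beta in S1.
    match type of S1 with sdiff _ _ ?d => replace (/ (INR k * z0)) with d end; [exact S1|].
    rewrite Hu0, Hv0; field; repeat split; try assumption. }
  destruct (sdiff_cont v 0 v' Hv' (Cmod (v 0))) as [de [Hde Hvn]]; [now apply Cmod_gt_0|].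
  set (r1 := Rmin (Rmin rho de) (Cmod z0)).
  assert (Hr1 : 0 < r1) by (repeat apply Rmin_pos; try assumption; now apply Cmod_gt_0).
  assert (Hnear : forall h, Cmod h < r1 -> Cmod h < rho /\ v h <> 0 /\ z0 + h <> 0).
  { intros h Hh; unfold r1 in Hh; pose proof (Rmin_l (Rmin rho de) (Cmod z0)).
    pose proof (Rmin_r (Rmin rho de) (Cmod z0)); pose proof (Rmin_l rho de); pose proof (Rmin_r rho de).
    specialize (Hvn h); replace (h - 0) with h in Hvn by ring; specialize (Hvn ltac:(lra)).
    split; [lra|split; intros E].
    - rewrite E, Cmod_minus_sym in Hvn; replace (v 0 - 0) with (v 0) in Hvn by ring; lra.
    - assert (E2 : z0 = - h) by (replace z0 with (z0 + h - h) by ring; rewrite E; ring).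
      rewrite E2, Cmod_opp in *; lra. }
  split.
  2:{ exists r1; split; [assumption|]; intros z Hzz Hz.
      destruct (Hnear (z - z0) Hz) as [H1 [H2 H3]].
      assert (E : z0 + (z - z0) = z) by ring; rewrite E in H3.
      apply Cmult_neq_0; [assumption|].
      rewrite <- E, Hvf by assumption; apply Cmult_neq_0; [|assumption].
      apply Cpow_nz; intros E2; apply Hzz; now apply Ceq_minus. }
  assert (HT : sdiff (fun h => f (z0 + h) / ((z0 + h) * C_derive f (z0 + h))) 0 (/ (INR k * z0))).
  { refine (sdiff_ext_loc _ _ _ _ r1 Hr1 _ HS); intros h Hh.
    replace (h - 0) with h in Hh by ring; destruct (Hnear h Hh) as [Hh1 [Hvh Hzh]].
    rewrite Hvf by lra; change (f (z0 + h)) with (F h); rewrite Huf by lra.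
    (* At [h = 0] the original quotient may divide by zero; its numerator is 0, so the total
       division still returns 0. *)
    destruct (Ceq_dec h 0) as [->|Hh0].
    - rewrite (Cpow_0_l k) by lia; unfold Cdiv; ring.
    - destruct k as [|k]; [lia|]; simpl pred; rewrite Cpow_S.
      field; repeat split; try assumption; now apply Cpow_nz. }
  apply (sdiff_translate (fun z => f z / (z * C_derive f z)) z0 0) in HT.
  now replace (z0 + 0) with z0 in HT by ring.
Qed.

(** * The hypergeometric series *)

Definition hyp_coef (a b c : C) (n : nat) : C :=
  pochhammer a n * pochhammer b n / (pochhammer c n * INR (fact n)).

Lemma Cplus_INR_neq_0 (c : C) : (forall n : nat, c <> - RtoC (INR n)) ->
  forall n, c + INR n <> 0.
Proof.
  intros hc n E; apply (hc n); replace c with (c + INR n - INR n) by ring; rewrite E; ring.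
Qed.

Lemma pochhammer_neq_0 (c : C) (n : nat) : (forall n : nat, c <> - RtoC (INR n)) ->
  pochhammer c n <> 0.
Proof.
  intros hc; induction n as [|n IH]; simpl; [apply C1_nz|].
  apply Cmult_neq_0; [assumption|now apply Cplus_INR_neq_0].
Qed.

Lemma INR_fact_C_neq_0 (n : nat) : RtoC (INR (fact n)) <> 0.
Proof. intros E; apply RtoC_inj in E; now apply INR_fact_neq_0 in E. Qed.

Lemma hyp_coef_rec (a b c : C) (n : nat) : (forall n : nat, c <> - RtoC (INR n)) ->
  INR (S n) * (c + INR n) * hyp_coef a b c (S n) = (a + INR n) * (b + INR n) * hyp_coef a b c n.
Proof.
  intros hc; unfold hyp_coef; simpl pochhammer.
  change (fact (S n)) with (S n * fact n)%nat; rewrite mult_INR, RtoC_mult.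
  field; repeat split; [apply INR_fact_C_neq_0|now apply pochhammer_neq_0| |].
  - intros E; apply RtoC_inj in E; now apply (not_0_INR (S n)) in E.
  - now apply Cplus_INR_neq_0.
Qed.

(** Comparison of [s * n ^ 2] with [n ^ 2]: once [n * (1 - s)] exceeds [k], the gap absorbs all
    terms of lower order. *)
Lemma ratio_eventually (s A B D : R) : (0 < s < 1)%R -> (0 <= A)%R -> (0 <= B)%R -> (0 <= D)%R ->
  exists N : nat, forall n : nat, (N <= n)%nat ->
    (D < INR n)%R /\ ((INR n + A) * (INR n + B) * s <= (INR n + 1) * (INR n - D))%R.
Proof.
  intros Hs HA HB HD.
  set (k := (2 * D + A + B + A * B + 1)%R).
  destruct (nfloor_ex (k / (1 - s))) as [N HN].
  { apply Rdiv_le_0_compat; unfold k; nra. }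
  exists (S N); intros n Hn; apply le_INR in Hn; rewrite S_INR in Hn.
  assert (Hk : (k <= INR n * (1 - s))%R).
  { apply Rmult_le_reg_r with (/ (1 - s))%R; [apply Rinv_0_lt_compat; lra|].
    rewrite Rmult_assoc, Rinv_r, Rmult_1_r by lra; unfold Rdiv in HN; lra. }
  set (x := INR n) in *; assert (Hx : (1 <= x)%R) by (pose proof (pos_INR N); lra).
  assert (HAB : (0 <= A * B)%R) by (now apply Rmult_le_pos).
  assert (HkD : (D < x)%R) by (unfold k in Hk; nra).
  split; [assumption|].
  assert (H1 : (k * x <= x * (1 - s) * x)%R) by (apply Rmult_le_compat_r; lra).
  assert (H2 : (s * (x * (A + B)) <= x * (A + B))%R).
  { rewrite <- (Rmult_1_l (x * (A + B))) at 2; apply Rmult_le_compat_r; [nra|lra]. }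
  assert (H3 : (s * (A * B) <= A * B)%R).
  { rewrite <- (Rmult_1_l (A * B)) at 2; apply Rmult_le_compat_r; lra. }
  assert (H4 : (D <= D * x)%R) by nra.
  assert (H5 : (A * B <= A * B * x)%R) by nra.
  unfold k in H1; nra.
Qed.

(** A ratio test without quotients, since coefficients may vanish: by the recurrence the terms
    [|a n| * s ^ n] are eventually nonincreasing. *)
Lemma hyp_coef_radius (a b c : C) : (forall n : nat, c <> - RtoC (INR n)) ->
  radius_ge (hyp_coef a b c) 1.
Proof.
  intros hc s Hs.
  destruct (ratio_eventually s (Cmod a) (Cmod b) (Cmod c) Hs (Cmod_ge_0 a) (Cmod_ge_0 b)
    (Cmod_ge_0 c)) as [N HN].
  set (w := fun n => (Cmod (hyp_coef a b c n) * s ^ n)%R).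
  assert (Hdec : forall n, (N <= n)%nat -> (w (S n) <= w n)%R).
  { intros n Hn; destruct (HN n Hn) as [HD HR]; unfold w.
    pose proof (f_equal Cmod (hyp_coef_rec a b c n hc)) as E.
    rewrite !Cmod_mult, Cmod_INR, S_INR in E.
    set (x := Cmod (hyp_coef a b c (S n))) in *; set (y := Cmod (hyp_coef a b c n)) in *.
    assert (Hx : (0 <= x)%R) by apply Cmod_ge_0; assert (Hy : (0 <= y)%R) by apply Cmod_ge_0.
    assert (Hsn : (0 <= s ^ n)%R) by (apply pow_le; lra).
    pose proof (Cmod_triangle a (INR n)) as Ta; pose proof (Cmod_triangle b (INR n)) as Tb.
    pose proof (Cmod_rtriangle (INR n) (- c)) as Tc.
    replace (INR n - - c) with (c + INR n) in Tc by ring.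
    rewrite Cmod_opp in Tc; rewrite Cmod_INR in Ta, Tb, Tc.
    pose proof (pos_INR n) as Hn0.
    set (p := ((INR n + 1) * (INR n - Cmod c))%R) in *.
    assert (Hp : (0 < p)%R) by (apply Rmult_lt_0_compat; lra).
    assert (L1 : (p * x <= (INR n + 1) * Cmod (c + INR n) * x)%R).
    { apply Rmult_le_compat_r; [assumption|]; apply Rmult_le_compat_l; lra. }
    assert (L2 : (Cmod (a + INR n) * Cmod (b + INR n) * y <=
       (INR n + Cmod a) * (INR n + Cmod b) * y)%R).
    { apply Rmult_le_compat_r; [assumption|].
      apply Rmult_le_compat; try apply Cmod_ge_0; lra. }
    assert (L3 : (s * (p * x) <= p * y)%R).
    { apply Rle_trans with (s * ((INR n + Cmod a) * (INR n + Cmod b) * y))%R.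
      - apply Rmult_le_compat_l; lra.
      - replace (s * ((INR n + Cmod a) * (INR n + Cmod b) * y))%R with
          ((INR n + Cmod a) * (INR n + Cmod b) * s * y)%R by ring.
        apply Rmult_le_compat_r; assumption. }
    assert (L4 : (s * x <= y)%R).
    { apply Rmult_le_reg_l with p; [assumption|lra]. }
    simpl pow; replace (x * (s * s ^ n))%R with (s * x * s ^ n)%R by ring.
    now apply Rmult_le_compat_r. }
  assert (Fin : forall n, exists M, forall k, (k <= n)%nat -> (w k <= M)%R).
  { induction n as [|n [M HM]].
    - exists (w 0%nat); intros k Hk; replace k with 0%nat by lia; lra.
    - exists (Rmax M (w (S n))); intros k Hk.
      destruct (Nat.eq_dec k (S n)) as [->|]; [apply Rmax_r|].
      eapply Rle_trans; [apply HM; lia|apply Rmax_l]. }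
  destruct (Fin N) as [M HM]; exists M; intros n; fold (w n).
  destruct (Nat.le_ge_cases n N) as [H|H]; [now apply HM|].
  induction H as [|n Hn IH]; [apply HM; lia|].
  eapply Rle_trans; [apply Hdec; lia|exact IH].
Qed.

Lemma csums_Series (t : nat -> C) (l : C) : csums t l ->
  (Series (fun n => Re (t n)), Series (fun n => Im (t n))) = l.
Proof.
  intros H.
  assert (P : forall p : C -> R, (forall x, Rabs (p x) <= Cmod x) -> p 0 = 0%R ->
    (forall x y : C, p (x + y) = (p x + p y)%R) -> (forall x y : C, p (x - y) = (p x - p y)%R) ->
    Series (fun n => p (t n)) = p l).
  { intros p Hp Hp0 Hpp Hpm; apply is_series_unique, is_series_Reals.
    intros eps Heps; destruct (H (eps / 2)%R) as [N HN]; [lra|]; exists N; intros n Hn.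
    assert (E : sum_f_R0 (fun n => p (t n)) n = p (csum t (S n))).
    { clear -Hp0 Hpp; induction n as [|n IH].
      - change (p (t 0%nat) = p (0 + t 0%nat)); now rewrite Cplus_0_l.
      - rewrite tech5, IH; change (csum t (S (S n))) with (csum t (S n) + t (S n)).
        now rewrite Hpp. }
    unfold R_dist; rewrite E, <- Hpm; eapply Rle_lt_trans; [apply Hp|].
    specialize (HN (S n) ltac:(lia)); lra. }
  rewrite (P Re), (P Im).
  - now destruct l.
  - intros x; eapply Rle_trans; [|apply Rmax_Cmod]; apply Rmax_r.
  - reflexivity.
  - reflexivity.
  - reflexivity.
  - apply re_le_Cmod.
  - reflexivity.
  - reflexivity.
  - reflexivity.
Qed.

Lemma hyp2F1_csums (a b c z : C) : (forall n : nat, c <> - RtoC (INR n)) -> Cmod z < 1 ->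
  csums (fun n => hyp_coef a b c n * z ^ n) (hyp2F1 a b c z).
Proof.
  intros hc Hz.
  destruct (radius_ge_csums (hyp_coef a b c) 1 z Hz (hyp_coef_radius a b c hc)) as [l Hl].
  replace (hyp2F1 a b c z) with l; [assumption|].
  symmetry; exact (csums_Series _ _ Hl).
Qed.

Lemma power_series_theta (a : nat -> C) (r : R) (f : C -> C) (z : C) :
  (forall x, Cmod x < r -> csums (fun n => a n * x ^ n) (f x)) -> Cmod z < r ->
  sdiff f z (C_derive f z) /\ csums (fun n => INR n * a n * z ^ n) (z * C_derive f z).
Proof.
  intros Hf Hz; destruct (power_series_sdiff a r f z Hf Hz) as [d [Hd Hs]].
  rewrite (sdiff_C_derive f z d Hd); split; [assumption|].
  refine (csums_ext _ _ _ _ (csums_scal z _ _ Hs)).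
  intros [|n]; [simpl; ring|]; simpl pred; rewrite Cpow_S; ring.
Qed.

(** The Euler operator, which multiplies the [n]-th Taylor coefficient by [n]. *)
Definition theta (f : C -> C) (z : C) : C := z * C_derive f z.

(** The equation is [hyp_coef_rec] summed over [n]. Its left series has no constant term, so it may
    be shifted by one index, which matches the factor [z] on the right. *)
Lemma hyp2F1_theta (a b c z : C) : (forall n : nat, c <> - RtoC (INR n)) -> Cmod z < 1 ->
  let F := hyp2F1 a b c in
  sdiff F z (C_derive F z) /\ sdiff (theta F) z (C_derive (theta F) z) /\
  theta (theta F) z + (c - 1) * theta F z =
    z * (theta (theta F) z + (a + b) * theta F z + a * b * F z).
Proof.
  intros hc Hz F.
  assert (HF : forall x, Cmod x < 1 -> csums (fun n => hyp_coef a b c n * x ^ n) (F x))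
    by (intros x Hx; now apply hyp2F1_csums).
  assert (HH : forall x, Cmod x < 1 -> csums (fun n => INR n * hyp_coef a b c n * x ^ n) (theta F x))
    by (intros x Hx; now apply (power_series_theta _ 1)).
  assert (HJ := proj2 (power_series_theta _ 1 (theta F) z HH Hz)); cbv beta in HJ.
  split; [now apply (power_series_theta _ 1 F z HF)|].
  split; [now apply (power_series_theta _ 1 (theta F) z HH)|].
  fold (theta (theta F) z) in HJ.
  assert (S1 := csums_plus _ _ _ _ HJ (csums_scal (c - 1) _ _ (HH z Hz))); cbv beta in S1.
  apply csums_shift in S1; [|simpl; ring].
  refine (csums_unique _ _ _ S1 _).
  refine (csums_ext _ _ _ _ (csums_scal z _ _ (csums_plus _ _ _ _ (csums_plus _ _ _ _ HJ
    (csums_scal (a + b) _ _ (HH z Hz))) (csums_scal (a * b) _ _ (HF z Hz))))).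
  intros n; cbv beta; pose proof (hyp_coef_rec a b c n hc) as E.
  rewrite Cpow_S; rewrite S_INR, RtoC_plus in *.
  replace ((INR n + 1) * ((INR n + 1) * hyp_coef a b c (S n)) * (z * z ^ n) +
    (c - 1) * ((INR n + 1) * hyp_coef a b c (S n) * (z * z ^ n))) with
    ((INR n + 1) * (c + INR n) * hyp_coef a b c (S n) * (z * z ^ n)) by ring.
  rewrite E; ring.
Qed.

Lemma hyp2F1_at_0 (a b c : C) : (forall n : nat, c <> - RtoC (INR n)) -> hyp2F1 a b c 0 = 1.
Proof.
  intros hc; refine (csums_unique _ _ _ (hyp2F1_csums a b c 0 hc _) _).
  - rewrite Cmod_0; lra.
  - pose proof (csums_at_0 (hyp_coef a b c)) as H.
    replace (hyp_coef a b c 0) with (RtoC 1) in H; [exact H|].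
    unfold hyp_coef; simpl; field; apply C1_nz.
Qed.

(** * The first exit from the image domain *)

(** Here [om] is a bare choice of preimages, without assumed continuity. Injectivity of [Q] on the
    disk identifies it near [z0] with the differentiable local inverse of [Q] applied to [g]. *)
Lemma univalent_lift (Q g om : C -> C) (z0 e : C) (r : R) : 0 < r ->
  univalent_on unit_disk Q -> sdiff g z0 e ->
  (forall z, Cmod (z - z0) < r -> Cmod (om z) < 1 /\ Q (om z) = g z) ->
  exists d, sdiff om z0 d.
Proof.
  intros Hr HQ Hg Hom.
  destruct (Hom z0) as [H1 H2]; [rewrite Cmod_self_minus; assumption|].
  destruct (analytic_on_sdiff _ Q (om z0) (proj1 HQ) H1) as [k Hk].
  assert (Hk0 : k <> 0).
  { apply (univalent_derive_neq_0 unit_disk Q (om z0) k (1 - Cmod (om z0))); [lra| |assumption|assumption].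
    intros x Hx; pose proof (Cmod_rtriangle x (om z0)); unfold unit_disk; lra. }
  destruct (sdiff_inverse_ex Q (om z0) k Hk0 Hk) as [q [Hq [Hq0 [r2 [Hr2 Hqr]]]]].
  rewrite H2 in Hq, Hq0, Hqr.
  pose proof (sdiff_comp q g z0 _ _ Hg Hq) as Hc.
  destruct (sdiff_cont _ _ _ Hc (1 - Cmod (om z0))%R) as [d1 [Hd1 C1]]; [lra|].
  destruct (sdiff_cont _ _ _ Hg r2 Hr2) as [d2 [Hd2 C2]].
  exists (/ k * e).
  refine (sdiff_ext_loc _ _ _ _ (Rmin r (Rmin d1 d2)) _ _ Hc).
  - repeat apply Rmin_pos; assumption.
  - intros z Hz; pose proof (Rmin_l r (Rmin d1 d2)); pose proof (Rmin_r r (Rmin d1 d2)).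
    pose proof (Rmin_l d1 d2); pose proof (Rmin_r d1 d2).
    destruct (Hom z ltac:(lra)) as [Ho1 Ho2].
    apply (proj2 HQ); unfold unit_disk; [|assumption|].
    + specialize (C1 z ltac:(lra)); cbv beta in C1; rewrite Hq0 in C1.
      pose proof (Cmod_rtriangle (q (g z)) (om z0)); lra.
    + rewrite Ho2; apply Hqr, C2; lra.
Qed.

(** Let [r0] be the supremum of the radii of centred disks inside [S]. Points outside [S] with
    modulus below [r0 + s] accumulate as [s] tends to 0, and openness of [S] keeps their cluster
    point outside. *)
Lemma minimal_modulus (S : C -> Prop) (z1 : C) :
  (forall z, Cmod z <= Cmod z1 -> S z -> exists r, 0 < r /\ forall x, Cmod (x - z) < r -> S x) ->
  ~ S z1 -> exists z0, Cmod z0 <= Cmod z1 /\ ~ S z0 /\ forall z, Cmod z < Cmod z0 -> S z.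
Proof.
  intros Hop Hz1.
  pose (E := fun r : R => forall z, Cmod z < r -> S z).
  destruct (completeness E) as [r0 [Hub Hlub]].
  { exists (Cmod z1); intros r Hr; apply Rnot_lt_le; intros Hlt; apply Hz1, Hr, Hlt. }
  { exists 0%R; intros z Hz; pose proof (Cmod_ge_0 z); lra. }
  assert (Hr01 : (r0 <= Cmod z1)%R).
  { apply Hlub; intros r Hr; apply Rnot_lt_le; intros Hlt; apply Hz1, Hr, Hlt. }
  assert (Hin : forall z, Cmod z < r0 -> S z).
  { intros z Hz; apply NNPP; intros Hno.
    assert (r0 <= Cmod z)%R; [|lra].
    apply Hlub; intros r Hr; apply Rnot_lt_le; intros Hlt; apply Hno, Hr, Hlt. }
  assert (Hex : forall s : R, exists z, 0 < s -> Cmod z < (r0 + Rmin s 1)%R /\ ~ S z).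
  { intros s; destruct (Rlt_dec 0 s) as [Hs|Hs].
    - assert (Hm : 0 < Rmin s 1) by (apply Rmin_pos; lra).
      assert (Hno : ~ E (r0 + Rmin s 1)%R) by (intros H; apply Hub in H; lra).
      apply not_all_ex_not in Hno; destruct Hno as [z Hz].
      apply imply_to_and in Hz; exists z; auto.
    - exists 0; intros; lra. }
  pose (u := fun s => proj1_sig (constructive_indefinite_description _ (Hex s))).
  assert (Hu : forall s, 0 < s -> Cmod (u s) < (r0 + Rmin s 1)%R /\ ~ S (u s)).
  { intros s; exact (proj2_sig (constructive_indefinite_description _ (Hex s))). }
  destruct (cluster_point u (r0 + 1)%R) as [l Hl].
  { intros s Hs; destruct (Hu s Hs) as [B _]; pose proof (Rmin_r s 1); lra. }
  assert (Hl0 : (Cmod l <= r0)%R).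
  { apply Rnot_lt_le; intros Hlt; destruct (Hl ((Cmod l - r0) / 2)%R) as [s [Hs Hd]]; [lra|].
    destruct (Hu s ltac:(lra)) as [B _]; pose proof (Rmin_l s 1).
    pose proof (Cmod_rtriangle l (u s)); rewrite Cmod_minus_sym in H0; lra. }
  exists l; split; [lra|split].
  - intros Sl; destruct (Hop l ltac:(lra) Sl) as [r [Hr Hx]].
    destruct (Hl r Hr) as [s [Hs Hd]]; destruct (Hu s ltac:(lra)) as [_ B]; apply B, Hx, Hd.
  - intros z Hz; apply Hin; lra.
Qed.

(** * Power branches and the contact inequality *)

Lemma Cmod_Cexp (z : C) : Cmod (Cexp z) = exp (Re z).
Proof.
  unfold Cmod, Cexp; simpl fst; simpl snd.
  replace ((exp (Re z) * cos (Im z)) ^ 2 + (exp (Re z) * sin (Im z)) ^ 2)%R with (exp (Re z) ^ 2)%R.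
  - apply sqrt_pow2; left; apply exp_pos.
  - pose proof (sin2_cos2 (Im z)) as H; unfold Rsqr in H.
    transitivity (exp (Re z) ^ 2 * (sin (Im z) * sin (Im z) + cos (Im z) * cos (Im z)))%R; [|ring].
    rewrite H; ring.
Qed.

(** The modulus of a real power does not depend on the branch. *)
Lemma power_branch_Cmod (U : C -> Prop) (h : C -> C) (be : R) (k : C -> C) (z : C) :
  power_branch U h be k -> U z -> 0 < Cmod (h z) /\ Cmod (k z) = Rpower (Cmod (h z)) be.
Proof.
  intros [L [_ H]] Hz; destruct (H z Hz) as [H1 H2].
  rewrite <- H1, H2, !Cmod_Cexp; split; [apply exp_pos|].
  unfold Rpower; rewrite ln_exp, re_scal_l; reflexivity.
Qed.

Lemma Cexp_opp (z : C) : Cexp z * Cexp (- z) = 1.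
Proof.
  destruct z as [x y]; unfold Cexp, Cmult, RtoC; simpl.
  rewrite cos_neg, sin_neg, exp_Ropp; pose proof (exp_pos x).
  pose proof (sin2_cos2 y) as H1; unfold Rsqr in H1; f_equal.
  - transitivity (sin y * sin y + cos y * cos y)%R; [field; lra|assumption].
  - field; lra.
Qed.

(** The branch condition holds only inside the disk and prescribes no value at [ze]; continuity
    along the radius supplies it. *)
Lemma extension_zero (K : C -> C) (N : C -> R) (be : R) (ze k : C) : 0 < be ->
  Cmod ze = 1%R -> sdiff K ze k ->
  (exists de : R, 0 < de /\ forall x, Cmod x < 1 -> Cmod (x - ze) < de ->
    0 < N x /\ Cmod (K x) = Rpower (N x) be) ->
  (forall eps : R, 0 < eps -> exists de : R, 0 < de /\ forall x, Cmod x < 1 ->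
    Cmod (x - ze) < de -> N x < eps) -> K ze = 0.
Proof.
  intros Hbe Hze HK [d1 [Hd1 H1]] HN; apply Ceq_of_small; intros eps Heps.
  destruct (sdiff_cont K ze k HK (eps / 2)%R) as [d2 [Hd2 H2]]; [lra|].
  destruct (HN (Rpower (eps / 2) (/ be))) as [d3 [Hd3 H3]]; [apply exp_pos|].
  set (de := Rmin 1 (Rmin d1 (Rmin d2 d3))).
  assert (Hde : 0 < de) by (repeat apply Rmin_pos; lra).
  assert (Hd : (de <= 1 /\ de <= d1 /\ de <= d2 /\ de <= d3)%R).
  { unfold de; pose proof (Rmin_l 1 (Rmin d1 (Rmin d2 d3))).
    pose proof (Rmin_r 1 (Rmin d1 (Rmin d2 d3))).
    pose proof (Rmin_l d1 (Rmin d2 d3)); pose proof (Rmin_r d1 (Rmin d2 d3)).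
    pose proof (Rmin_l d2 d3); pose proof (Rmin_r d2 d3); lra. }
  set (x := (1 - de / 2)%R * ze).
  assert (Hx1 : Cmod x < 1) by (unfold x; rewrite Cmod_mult, Cmod_RtoC_pos, Hze; lra).
  assert (Hx2 : Cmod (x - ze) < de).
  { replace (x - ze) with (- ((de / 2)%R * ze)) by (unfold x; rewrite RtoC_minus; ring).
    rewrite Cmod_opp, Cmod_mult, Cmod_RtoC_pos, Hze; lra. }
  specialize (H2 x ltac:(lra)); specialize (H3 x Hx1 ltac:(lra)).
  destruct (H1 x Hx1 ltac:(lra)) as [N0 E].
  assert (B : (Rpower (N x) be < eps / 2)%R).
  { replace (eps / 2)%R with (Rpower (Rpower (eps / 2) (/ be)) be) at 1.
    - now apply Rlt_Rpower_l.
    - rewrite Rpower_mult, Rinv_l, Rpower_1; lra. }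
  replace (K ze - 0) with (K ze) by ring.
  pose proof (Cmod_rtriangle (K ze) (K x)) as T; rewrite Cmod_minus_sym in T; lra.
Qed.

(** Let [t] be the positive quantity in the hypotheses. Expanding squares,
    [|m W + B| ^ 2 - |m W + A| ^ 2] is [|B| ^ 2 - |A| ^ 2 - m * t], at most [(1 - m) * t <= 0]. With
    [|z| < 1] both sides of the equation vanish, so [A = B] and [t = 0]. Positivity of [t] is used
    in both places. *)
Lemma no_contact (A B W z : C) (m : R) : (1 <= m)%R -> Cmod z < 1 ->
  m * W + A = z * (m * W + B) ->
  (0 < - 2 * Re ((B - A) * Cconj W))%R ->
  (Cmod B ^ 2 - Cmod A ^ 2 <= - 2 * Re ((B - A) * Cconj W))%R -> False.
Proof.
  intros Hm Hz E HT HB.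
  assert (Hid : (Cmod (m * W + B) ^ 2 - Cmod (m * W + A) ^ 2 =
    Cmod B ^ 2 - Cmod A ^ 2 + 2 * m * Re ((B - A) * Cconj W))%R).
  { rewrite !Cmod2_alt; destruct A, B, W; simpl; ring. }
  set (T := Re ((B - A) * Cconj W)) in *.
  pose proof (f_equal Cmod E) as E2; rewrite Cmod_mult in E2.
  set (X := Cmod (m * W + B)) in *; set (Y := Cmod (m * W + A)) in *.
  assert (HX : (0 <= X)%R) by apply Cmod_ge_0; pose proof (Cmod_ge_0 z) as Hz0.
  assert (HY : (Y <= X)%R) by (rewrite E2; nra).
  assert (HY0 : (0 <= Y)%R) by apply Cmod_ge_0.
  assert (HXY : (X ^ 2 <= Y ^ 2)%R) by nra.
  assert (X0 : X = 0%R).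
  { apply NNPP; intros Hn; assert (0 < X)%R by lra.
    assert (Y < X)%R by (rewrite E2; nra); nra. }
  assert (Y0 : Y = 0%R) by lra.
  apply Cmod_eq_0 in X0; apply Cmod_eq_0 in Y0.
  assert (EAB : B - A = 0).
  { replace (B - A) with ((m * W + B) - (m * W + A)) by ring; rewrite X0, Y0; ring. }
  unfold T in HT; rewrite EAB, Cmult_0_l in HT; simpl in HT; lra.
Qed.

(** * Cluster values along the radius *)

Definition radial_cluster (om : C -> C) (z0 ze0 : C) : Prop :=
  forall eps : R, 0 < eps -> exists s : R, (0 < s < eps)%R /\
    Cmod (om ((1 - s)%R * z0) - ze0) < eps.

Lemma radial_Cmod (z0 : C) (s : R) : 0 < Cmod z0 -> (0 < s <= 1)%R ->
  Cmod ((1 - s)%R * z0) < Cmod z0.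
Proof. intros H Hs; rewrite Cmod_mult, Cmod_RtoC_pos by lra; nra. Qed.

Lemma radial_dist (z0 : C) (s : R) : (0 <= s)%R ->
  Cmod ((1 - s)%R * z0 - z0) = (s * Cmod z0)%R.
Proof.
  intros Hs; replace ((1 - s)%R * z0 - z0) with (- (s * z0)) by (rewrite RtoC_minus; ring).
  now rewrite Cmod_opp, Cmod_mult, Cmod_RtoC_pos.
Qed.

Lemma radial_cluster_near (om : C -> C) (z0 ze0 : C) (r e : R) :
  (0 < Cmod z0 <= 1)%R -> radial_cluster om z0 ze0 -> 0 < r -> 0 < e ->
  exists s : R, (0 < s < 1)%R /\ Cmod ((1 - s)%R * z0) < Cmod z0 /\
    Cmod ((1 - s)%R * z0 - z0) < r /\ Cmod (om ((1 - s)%R * z0) - ze0) < e.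
Proof.
  intros Hz0 Hcl Hr He.
  destruct (Hcl (Rmin (Rmin 1 r) e)) as [s [Hs Ho]]; [repeat apply Rmin_pos; lra|].
  pose proof (Rmin_l (Rmin 1 r) e); pose proof (Rmin_r (Rmin 1 r) e).
  pose proof (Rmin_l 1 r); pose proof (Rmin_r 1 r).
  exists s; split; [lra|split; [|split]].
  - apply radial_Cmod; lra.
  - rewrite radial_dist by lra; nra.
  - lra.
Qed.

Lemma radial_cluster_ex (om : C -> C) (z0 : C) : 0 < Cmod z0 ->
  (forall z, Cmod z < Cmod z0 -> Cmod (om z) < 1) ->
  exists ze0, Cmod ze0 <= 1 /\ radial_cluster om z0 ze0.
Proof.
  intros Hz0 Hom.
  (* Truncation at 1 keeps the argument in the disk for every [s > 0], as [cluster_point] demands;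
     it disappears for small [s]. *)
  destruct (cluster_point (fun s => om ((1 - Rmin s 1)%R * z0)) 1) as [ze0 Hze].
  { intros s Hs; left; apply Hom, radial_Cmod; [assumption|].
    split; [apply Rmin_pos; lra|apply Rmin_r]. }
  exists ze0; split.
  - apply Rnot_lt_le; intros Hlt; destruct (Hze (Cmod ze0 - 1)%R) as [s [Hs Hd]]; [lra|].
    assert (B : Cmod (om ((1 - Rmin s 1)%R * z0)) < 1).
    { apply Hom, radial_Cmod; [assumption|]; split; [apply Rmin_pos; lra|apply Rmin_r]. }
    cbv beta in Hd; rewrite Cmod_minus_sym in Hd.
    pose proof (Cmod_rtriangle ze0 (om ((1 - Rmin s 1)%R * z0))); lra.
  - intros eps Heps; destruct (Hze (Rmin eps 1)) as [s [Hs Hd]]; [apply Rmin_pos; lra|].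
    pose proof (Rmin_l eps 1); pose proof (Rmin_r eps 1).
    cbv beta in Hd; rewrite Rmin_left in Hd by lra; exists s; split; lra.
Qed.

(** For [g = theta F / F] this is [z g' = theta (theta F) / F - g ^ 2], which turns the linear
    equation for [F] into a Riccati equation for [g]. *)
Lemma theta_quotient_sdiff (F : C -> C) (z : C) : F z <> 0 ->
  sdiff F z (C_derive F z) -> sdiff (theta F) z (C_derive (theta F) z) ->
  exists e, sdiff (fun x => theta F x / F x) z e /\
    z * e = theta (theta F) z / F z - (theta F z / F z) * (theta F z / F z).
Proof.
  intros H0 HF HG; eexists; split; [apply (sdiff_div _ _ _ _ _ H0 HG HF)|].
  change (theta (theta F) z) with (z * C_derive (theta F) z).
  replace (theta F z * theta F z) with (theta F z * (z * C_derive F z)) by reflexivity.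
  assert (E : theta F z = z * C_derive F z) by reflexivity; rewrite E; field; assumption.
Qed.

(** At a first zero of [F] the reciprocal of [g] stays regular. Nonvanishing on the smaller disk
    shows that [F] is not identically zero near [z0]. *)
Lemma pole_data (F : C -> C) (z0 : C) : (0 < Cmod z0 < 1)%R -> F z0 = 0 ->
  (forall z, Cmod z < 1 -> sdiff F z (C_derive F z)) ->
  (forall z, Cmod z < Cmod z0 -> F z <> 0) ->
  exists k : nat, (1 <= k)%nat /\ sdiff (fun z => F z / theta F z) z0 (/ (INR k * z0)) /\
    F z0 / theta F z0 = 0 /\
    exists rho, 0 < rho /\ forall z, Cmod z < Cmod z0 -> Cmod (z - z0) < rho ->
      theta F z / F z <> 0 /\ F z / theta F z = / (theta F z / F z).
Proof.
  intros Hz0 HF0 HF Hnz.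
  destruct (zero_quotient F z0 (1 - Cmod z0)) as [k [Hk [Hs [rho [Hrho Hn]]]]].
  - lra.
  - apply Cmod_gt_0; lra.
  - assumption.
  - intros z Hz; exists (C_derive F z); apply HF.
    pose proof (Cmod_rtriangle z z0); lra.
  - intros eps Heps; set (s := Rmin (eps / 2) 1).
    assert (0 < s) by (apply Rmin_pos; lra); assert (s <= eps / 2)%R by apply Rmin_l.
    assert (s <= 1)%R by apply Rmin_r.
    exists ((1 - s)%R * z0); split.
    + rewrite radial_dist by lra; nra.
    + apply Hnz, radial_Cmod; lra.
  - exists k; split; [assumption|split; [exact Hs|split]].
    + rewrite HF0; unfold Cdiv; ring.
    + exists rho; split; [assumption|]; intros z Hz Hzz.
      assert (HG : theta F z <> 0).
      { apply Hn; [|assumption]; intros E; rewrite E in Hz; lra. }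
      specialize (Hnz z Hz); split; [|field; auto].
      unfold Cdiv; apply Cmult_neq_0; [assumption|].
      intros E; apply C1_nz; rewrite <- (Cinv_r (F z)) by assumption; rewrite E; ring.
Qed.

Lemma sdiff_at_base (h : C -> C) (z0 e : C) : sdiff h z0 e ->
  forall eps : R, 0 < eps -> exists de : R, 0 < de /\ forall z, Cmod (z - z0) < de ->
    (Cmod (h z - h z0 - e * (z - z0)) <= eps * Cmod (z - z0))%R.
Proof.
  intros Hh eps Heps; destruct (Hh eps Heps) as [de [Hde H]]; exists de; split; [assumption|].
  intros z Hz; apply H; [assumption|rewrite Cmod_self_minus; assumption].
Qed.

(** If [F] vanished at [z0], then [1 / g] would tend to 0 there, whereas [g = Q (om z)] comes close
    to [w] at points of the radius arbitrarily near [z0]. *)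
Lemma finite_cluster (F Q om : C -> C) (z0 ze0 w : C) : (0 < Cmod z0 < 1)%R ->
  (forall z, Cmod z < 1 -> sdiff F z (C_derive F z)) ->
  (forall z, Cmod z < 1 -> sdiff (theta F) z (C_derive (theta F) z)) ->
  (forall z, Cmod z < Cmod z0 -> F z <> 0 /\ Cmod (om z) < 1 /\ Q (om z) = theta F z / F z) ->
  radial_cluster om z0 ze0 ->
  (forall eps : R, 0 < eps -> exists de : R, 0 < de /\ forall x, Cmod x < 1 ->
    Cmod (x - ze0) < de -> Cmod (Q x - w) < eps) ->
  F z0 <> 0 /\ theta F z0 / F z0 = w.
Proof.
  intros Hz0 HF HG Hom Hcl HQ.
  assert (HF0 : F z0 <> 0).
  { intros E.
    destruct (pole_data F z0 Hz0 E HF (fun z Hz => proj1 (Hom z Hz)))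
      as [k [_ [Hs [H0 [rho [Hrho Hn]]]]]].
    destruct (HQ 1%R Rlt_0_1) as [de [Hde HQ1]].
    pose proof (Cmod_ge_0 w).
    destruct (sdiff_cont _ _ _ Hs (/ (Cmod w + 1))%R) as [d1 [Hd1 H1]].
    { apply Rinv_0_lt_compat; lra. }
    destruct (radial_cluster_near om z0 ze0 (Rmin d1 rho) de ltac:(lra) Hcl) as [s [Hs1 [Hz [Hzz Ho]]]];
      [now apply Rmin_pos|assumption|].
    pose proof (Rmin_l d1 rho); pose proof (Rmin_r d1 rho).
    set (z := (1 - s)%R * z0) in *.
    destruct (Hom z Hz) as [Fz [Oz Qz]]; destruct (Hn z Hz ltac:(lra)) as [N1 N2].
    specialize (HQ1 _ Oz Ho); rewrite Qz in HQ1.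
    specialize (H1 z ltac:(lra)); rewrite H0, N2 in H1.
    replace (/ (theta F z / F z) - 0) with (/ (theta F z / F z)) in H1 by ring.
    rewrite Cmod_inv in H1 by assumption.
    apply Cmod_gt_0 in N1; pose proof (Cmod_rtriangle (theta F z / F z) w).
    set (g := Cmod (theta F z / F z)) in *.
    assert (/ (Cmod w + 1) < / g)%R; [|lra].
    apply Rinv_lt_contravar; [apply Rmult_lt_0_compat|]; lra. }
  split; [assumption|].
  destruct (theta_quotient_sdiff F z0 HF0 (HF z0 ltac:(lra)) (HG z0 ltac:(lra))) as [e [He _]].
  apply Ceq_of_small; intros eps Heps.
  destruct (HQ (eps / 2)%R) as [de [Hde HQ1]]; [lra|].
  destruct (sdiff_cont _ _ _ He (eps / 2)%R) as [d1 [Hd1 H1]]; [lra|].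
  destruct (radial_cluster_near om z0 ze0 d1 de ltac:(lra) Hcl Hd1 Hde) as [s [Hs1 [Hz [Hzz Ho]]]].
  set (z := (1 - s)%R * z0) in *.
  destruct (Hom z Hz) as [Fz [Oz Qz]].
  specialize (HQ1 _ Oz Ho); rewrite Qz in HQ1; specialize (H1 z Hzz); cbv beta in H1.
  pose proof (Cmod_triangle_minus (theta F z0 / F z0) (theta F z / F z) w).
  rewrite (Cmod_minus_sym (theta F z0 / F z0) (theta F z / F z)) in H; lra.
Qed.

Lemma infinite_cluster (F Q om : C -> C) (z0 ze0 : C) : (0 < Cmod z0 < 1)%R ->
  (forall z, Cmod z < 1 -> sdiff F z (C_derive F z)) ->
  (forall z, Cmod z < 1 -> sdiff (theta F) z (C_derive (theta F) z)) ->
  (forall z, Cmod z < Cmod z0 -> F z <> 0 /\ Cmod (om z) < 1 /\ Q (om z) = theta F z / F z) ->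
  radial_cluster om z0 ze0 ->
  (forall M : R, exists de : R, 0 < de /\ forall x, Cmod x < 1 ->
    Cmod (x - ze0) < de -> M < Cmod (Q x)) ->
  F z0 = 0.
Proof.
  intros Hz0 HF HG Hom Hcl HQ; apply NNPP; intros HF0.
  destruct (theta_quotient_sdiff F z0 HF0 (HF z0 ltac:(lra)) (HG z0 ltac:(lra))) as [e [He _]].
  destruct (HQ (Cmod (theta F z0 / F z0) + 1)%R) as [de [Hde HQ1]].
  destruct (sdiff_cont _ _ _ He 1%R Rlt_0_1) as [d1 [Hd1 H1]].
  destruct (radial_cluster_near om z0 ze0 d1 de ltac:(lra) Hcl Hd1 Hde) as [s [Hs1 [Hz [Hzz Ho]]]].
  set (z := (1 - s)%R * z0) in *.
  destruct (Hom z Hz) as [Fz [Oz Qz]].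
  specialize (HQ1 _ Oz Ho); rewrite Qz in HQ1; specialize (H1 z Hzz); cbv beta in H1.
  pose proof (Cmod_rtriangle (theta F z / F z) (theta F z0 / F z0)); lra.
Qed.

Lemma disk_limit_eps (Q : C -> C) (ze : C) (w : option C) (P : C -> Prop) :
  disk_limit Q ze w -> sphere_nbhs w P ->
  exists de : R, 0 < de /\ forall x, Cmod x < 1 -> Cmod (x - ze) < de -> P (Q x).
Proof.
  intros HQ HP; specialize (HQ P HP); unfold filtermap, within in HQ.
  apply locally_Cmod in HQ; destruct HQ as [r [Hr H]]; exists r; split; [assumption|].
  intros x Hx Hxz; now apply H.
Qed.

Lemma open_Cmod (U : C -> Prop) (z : C) : open (T := C_UniformSpace) U -> U z ->
  exists r : R, 0 < r /\ forall x, Cmod (x - z) < r -> U x.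
Proof. intros HU Hz; now apply locally_Cmod, HU. Qed.

(* Both kinds of corners: [N] is [|Q - w|] at a finite corner and [1 / |Q|] at infinity,
   [h] is [theta F / F] or its inverse. *)
Lemma no_corner (Q om h K : C -> C) (N : C -> R) (z0 ze0 k e : C) (be : R) :
  (0 < Cmod z0 < 1)%R -> Cmod ze0 = 1%R -> 1 < be ->
  (forall z, Cmod z < Cmod z0 -> Cmod (om z) < 1) ->
  (forall z, Cmod z < Cmod z0 -> (Cmod (om z) * Cmod z0 <= Cmod z)%R) ->
  radial_cluster om z0 ze0 -> k <> 0 -> sdiff K ze0 k -> sdiff h z0 e -> K ze0 = 0 ->
  (exists de : R, 0 < de /\ forall x, Cmod x < 1 -> Cmod (x - ze0) < de ->
    0 < N x /\ Cmod (K x) = Rpower (N x) be) ->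
  (exists de : R, 0 < de /\ forall z, Cmod z < Cmod z0 -> Cmod (z - z0) < de ->
    N (om z) = Cmod (h z - h z0)) -> False.
Proof.
  intros Hz0 Hze Hbe Hom Hsch Hcl Hk HK Hh HK0 [d1 [Hd1 HN]] [d2 [Hd2 HNh]].
  destruct (sdiff_lip h z0 e Hh) as [d3 [Hd3 Hlip]].
  pose proof (Cmod_ge_0 e).
  (* On the radius [z] is at distance [s * Cmod z0] from [z0], so [L * s] bounds the variation of
     [h], and its power [be] is [Rpower L be * Rpower s be]. *)
  set (L := ((Cmod e + 1) * Cmod z0)%R); assert (HL : 0 < L) by (apply Rmult_lt_0_compat; lra).
  refine (corner_exclusion om K (Cmod z0) be (Rpower L be) z0 ze0 k (proj1 Hz0) eq_refl Hze
    Hsch Hk HK HK0 Hbe _ Hcl).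
  exists (Rmin (Rmin 1 d1) (Rmin d2 d3)); split; [repeat apply Rmin_pos; lra|].
  intros s Hs Ho.
  pose proof (Rmin_l (Rmin 1 d1) (Rmin d2 d3)); pose proof (Rmin_r (Rmin 1 d1) (Rmin d2 d3)).
  pose proof (Rmin_l 1 d1); pose proof (Rmin_r 1 d1).
  pose proof (Rmin_l d2 d3); pose proof (Rmin_r d2 d3).
  assert (Hz : Cmod ((1 - s)%R * z0) < Cmod z0) by (apply radial_Cmod; lra).
  assert (Hzz := radial_dist z0 s ltac:(lra)).
  set (z := (1 - s)%R * z0) in *.
  assert (Hss : (s * Cmod z0 < s)%R) by nra.
  destruct (HN (om z) (Hom z Hz) ltac:(lra)) as [N0 E]; rewrite E.
  rewrite Rpower_mult_distr by lra.
  apply Rle_Rpower_l; [lra|]; split; [assumption|].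
  rewrite HNh by lra.
  eapply Rle_trans; [apply Hlip; [lra|rewrite Cmod_self_minus; assumption]|].
  rewrite Hzz; unfold L; right; ring.
Qed.

Lemma no_exceptional_contact (F Q om : C -> C) (z0 ze0 : C) :
  (0 < Cmod z0 < 1)%R -> Cmod ze0 = 1%R ->
  (forall z, Cmod z < 1 -> sdiff F z (C_derive F z)) ->
  (forall z, Cmod z < 1 -> sdiff (theta F) z (C_derive (theta F) z)) ->
  (forall z, Cmod z < Cmod z0 -> F z <> 0 /\ Cmod (om z) < 1 /\ Q (om z) = theta F z / F z) ->
  (forall z, Cmod z < Cmod z0 -> exists d, sdiff om z d) ->
  (forall z, Cmod z < Cmod z0 -> (Cmod (om z) * Cmod z0 <= Cmod z)%R) ->
  radial_cluster om z0 ze0 -> ~ exceptional_point Q ze0.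
Proof.
  intros Hz0 Hze HF HG Hom Homd Hsch Hcl [w [Hlim Hw]].
  assert (Hom1 : forall z, Cmod z < Cmod z0 -> Cmod (om z) < 1) by (intros; now apply Hom).
  destruct w as [w|].
  - destruct Hw as [be [K [Hbe [U [HU [Uze [HK Hpb]]]]]]].
    destruct (open_Cmod U ze0 HU Uze) as [r [Hr HUr]].
    destruct (analytic_on_sdiff U K ze0 (proj1 HK) Uze) as [k Hk].
    assert (Hk0 := univalent_derive_neq_0 U K ze0 k r Hr HUr HK Hk).
    assert (HQw : forall eps : R, 0 < eps -> exists de : R, 0 < de /\ forall x, Cmod x < 1 ->
      Cmod (x - ze0) < de -> Cmod (Q x - w) < eps).
    { intros eps Heps; apply (disk_limit_eps Q ze0 _ (fun y => Cmod (y - w) < eps) Hlim).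
      apply locally_Cmod; eauto. }
    destruct (finite_cluster F Q om z0 ze0 w Hz0 HF HG Hom Hcl HQw) as [HF0 Hg0].
    destruct (theta_quotient_sdiff F z0 HF0 (HF z0 ltac:(lra)) (HG z0 ltac:(lra))) as [e [He _]].
    assert (HN : exists de : R, 0 < de /\ forall x, Cmod x < 1 -> Cmod (x - ze0) < de ->
      0 < Cmod (Q x - w) /\ Cmod (K x) = Rpower (Cmod (Q x - w)) be).
    { exists r; split; [assumption|]; intros x Hx Hxz.
      apply (power_branch_Cmod _ _ _ _ x Hpb); split; [now apply HUr|assumption]. }
    assert (HK0 := extension_zero K (fun x => Cmod (Q x - w)) be ze0 k ltac:(lra) Hze Hk HN HQw).
    apply (no_corner Q om _ K (fun x => Cmod (Q x - w)) z0 ze0 k e be Hz0 Hze Hbe Hom1 Hsch Hcl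
      Hk0 Hk He HK0 HN).
    exists 1%R; split; [lra|]; intros z Hz _; cbv beta.
    rewrite Hg0; destruct (Hom z Hz) as [_ [_ ->]]; reflexivity.
  - destruct Hw as [be [K [Hbe [[U [HU [Uze [HK Hpb]]]] Hvi]]]].
    destruct (open_Cmod U ze0 HU Uze) as [r [Hr HUr]].
    destruct (analytic_on_sdiff U K ze0 (proj1 HK) Uze) as [k Hk].
    assert (Hk0 := univalent_derive_neq_0 U K ze0 k r Hr HUr HK Hk).
    assert (HQM : forall M : R, exists de : R, 0 < de /\ forall x, Cmod x < 1 ->
      Cmod (x - ze0) < de -> M < Cmod (Q x)).
    { intros M; apply (disk_limit_eps Q ze0 None (fun y => M < Cmod y) Hlim).
      exists M; auto. }
    assert (HF0 := infinite_cluster F Q om z0 ze0 Hz0 HF HG Hom Hcl HQM).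
    destruct (pole_data F z0 Hz0 HF0 HF (fun z Hz => proj1 (Hom z Hz)))
      as [n [Hn [Hs [Hh0 [rho [Hrho Hnz]]]]]].
    (* Passing to [1 / |Q|] makes the exponent positive, so that a corner at infinity has the form
       of a finite one. *)
    assert (HN : exists de : R, 0 < de /\ forall x, Cmod x < 1 -> Cmod (x - ze0) < de ->
      0 < (/ Cmod (Q x))%R /\ Cmod (K x) = Rpower (/ Cmod (Q x)) be).
    { exists r; split; [assumption|]; intros x Hx Hxz.
      destruct (power_branch_Cmod _ _ _ _ x Hpb) as [H1 H2]; [split; [now apply HUr|assumption]|].
      split; [now apply Rinv_0_lt_compat|]; rewrite H2; unfold Rpower; rewrite ln_Rinv by assumption.
      f_equal; ring. }
    assert (HNl : forall eps : R, 0 < eps -> exists de : R, 0 < de /\ forall x, Cmod x < 1 ->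
      Cmod (x - ze0) < de -> (/ Cmod (Q x) < eps)%R).
    { intros eps Heps; destruct (HQM (/ eps)%R) as [de [Hde H]]; exists de; split; [assumption|].
      intros x Hx Hxz; specialize (H x Hx Hxz); assert (0 < / eps) by (now apply Rinv_0_lt_compat).
      rewrite <- (Rinv_inv eps); apply Rinv_lt_contravar; [apply Rmult_lt_0_compat; lra|assumption]. }
    assert (HK0 := extension_zero K (fun x => / Cmod (Q x))%R be ze0 k ltac:(lra) Hze Hk HN HNl).
    destruct (Req_dec be 1) as [E1|E1].
    + destruct (boundary_contact om K (fun z => F z / theta F z) (Cmod z0) z0 ze0 k
        (/ (INR n * z0)) (proj1 Hz0) eq_refl Hze Homd Hsch Hk0 Hk) as [m [Hm Em]].
      * now rewrite Hh0.
      * exact (sdiff_at_base _ _ _ Hs).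
      * exists (Rmin r rho); split; [now apply Rmin_pos|]; intros z Hz Hzz Ho.
        pose proof (Rmin_l r rho); pose proof (Rmin_r r rho).
        destruct (Hom z Hz) as [Fz [Oz Qz]]; destruct (Hnz z Hz ltac:(lra)) as [N1 N2].
        rewrite N2, <- Qz.
        destruct Hpb as [L [_ HL]]; destruct (HL (om z)) as [L1 L2].
        { split; [apply HUr; lra|assumption]. }
        (* For [be = 1] the branch gives [K = exp (- L)] with [exp L = Q], that is, [K = 1 / Q]
           exactly and not only in modulus. *)
        rewrite <- L1, L2, E1; replace ((- (1))%R * L (om z)) with (- L (om z))
          by (rewrite RtoC_opp; ring).
        assert (Hc : Cexp (L (om z)) <> 0).
        { rewrite L1, Qz; assumption. }
        rewrite <- (Cmult_1_r (/ Cexp (L (om z)))), <- (Cexp_opp (L (om z))).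
        rewrite Cmult_assoc, Cinv_l by assumption; ring.
      * exact Hcl.
      * apply (Hvi E1); exists (/ (INR n * m))%R.
        assert (Hn1 : (1 <= INR n)%R) by (apply (le_INR 1); assumption).
        assert (Hnm : (1 <= INR n * m)%R) by nra.
        split.
        { split; [left; apply Rinv_0_lt_compat; lra|].
          rewrite <- Rinv_1; apply Rinv_le_contravar; lra. }
        rewrite (sdiff_C_derive K ze0 k Hk).
        assert (Hz00 : z0 <> 0) by (apply Cmod_gt_0; lra).
        assert (HnC : RtoC (INR n) <> 0) by (intros E; apply RtoC_inj in E; lra).
        assert (HmC : RtoC m <> 0) by (intros E; apply RtoC_inj in E; lra).
        rewrite RtoC_inv, RtoC_mult by lra.
        replace (ze0 * k) with (/ m * (m * (ze0 * k))) by (field; assumption).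
        rewrite <- Em; field; repeat split; assumption.
    + apply (no_corner Q om _ K (fun x => / Cmod (Q x))%R z0 ze0 k _ be Hz0 Hze ltac:(lra) Hom1 Hsch
        Hcl Hk0 Hk Hs HK0 HN).
      exists rho; split; [assumption|]; intros z Hz Hzz; cbv beta.
      destruct (Hom z Hz) as [Fz [Oz Qz]]; destruct (Hnz z Hz Hzz) as [N1 N2].
      rewrite Hh0, N2, Qz; replace (/ (theta F z / F z) - 0) with (/ (theta F z / F z)) by ring.
      now rewrite Cmod_inv.
Qed.

Lemma class_Q_regular (Q : C -> C) (zetas : list C) (z : C) : class_Q Q zetas ->
  Cmod z <= 1 -> ~ In z zetas -> exists k, sdiff Q z k /\ k <> 0.
Proof.
  intros [_ [[V [HV [HVin HVQ]]] _]] Hz Hnz.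
  assert (Vz : V z) by (apply HVin; assumption).
  destruct (open_Cmod V z HV Vz) as [r [Hr HVr]].
  destruct (analytic_on_sdiff V Q z (proj1 HVQ) Vz) as [k Hk].
  exists k; split; [assumption|]; now apply (univalent_derive_neq_0 V Q z k r).
Qed.

Lemma class_Q_univalent_disk (Q : C -> C) (zetas : list C) : class_Q Q zetas ->
  (forall z, Cmod z < 1 -> ~ In z zetas) /\ univalent_on unit_disk Q.
Proof.
  intros [Hz [[V [_ [HVin [HVa HVi]]]] _]].
  assert (Hd : forall z, Cmod z < 1 -> ~ In z zetas).
  { intros z Hlt Hin; specialize (Hz z Hin); lra. }
  assert (HD : forall z, unit_disk z -> V z).
  { intros z Hlt; apply HVin; [left; exact Hlt|apply Hd, Hlt]. }
  split; [assumption|split].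
  - intros z Hlt; apply HVa, HD, Hlt.
  - intros x y Hx Hy; apply HVi; now apply HD.
Qed.

(** The conclusion says that [z0] still admits a preimage inside the disk, so a point of minimal
    modulus without one cannot exist. *)
Lemma no_first_exit (a b c : C) (Q om : C -> C) (zetas : list C) (z0 : C) :
  (forall n : nat, c <> - RtoC (INR n)) -> class_Q Q zetas ->
  (forall ze : C, Cmod ze = 1%R -> ~ In ze zetas ->
    let T := (- 2 * Re (((a + b + 1 - c) * Q ze + a * b) * Cconj (ze * C_derive Q ze)))%R in
    (0 < T)%R /\ (Cmod ((Q ze + a) * (Q ze + b)) ^ 2 -
      Cmod (Q ze * (Q ze + c - 1)) ^ 2 <= T)%R) ->
  let F := hyp2F1 a b c in
  (0 < Cmod z0 < 1)%R ->
  (forall z, Cmod z < Cmod z0 -> F z <> 0 /\ Cmod (om z) < 1 /\ Q (om z) = theta F z / F z) ->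
  (forall z, Cmod z < Cmod z0 -> exists d, sdiff om z d) -> om 0 = 0 ->
  F z0 <> 0 /\ exists ze, Cmod ze < 1 /\ Q ze = theta F z0 / F z0.
Proof.
  intros hc hQ HT F Hz0 Hom Homd Hom0.
  assert (HF : forall z, Cmod z < 1 -> sdiff F z (C_derive F z)).
  { intros z Hz; now apply (hyp2F1_theta a b c z hc). }
  assert (HG : forall z, Cmod z < 1 -> sdiff (theta F) z (C_derive (theta F) z)).
  { intros z Hz; now apply (hyp2F1_theta a b c z hc). }
  assert (Hom1 : forall z, Cmod z < Cmod z0 -> Cmod (om z) < 1) by (intros; now apply Hom).
  assert (Hsch : forall z, Cmod z < Cmod z0 -> (Cmod (om z) * Cmod z0 <= Cmod z)%R).
  { apply schwarz; [assumption| |assumption]; intros z Hz; left; now apply Hom1. }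
  destruct (radial_cluster_ex om z0 (proj1 Hz0) Hom1) as [ze0 [Hze Hcl]].
  destruct (classic (In ze0 zetas)) as [Hin|Hnin].
  { exfalso; apply (no_exceptional_contact F Q om z0 ze0 Hz0 (proj1 hQ ze0 Hin) HF HG Hom Homd
      Hsch Hcl).
    now apply hQ. }
  destruct (class_Q_regular Q zetas ze0 hQ Hze Hnin) as [k [Hk Hk0]].
  destruct (finite_cluster F Q om z0 ze0 (Q ze0) Hz0 HF HG Hom Hcl) as [HF0 Hg0].
  { intros eps Heps; destruct (sdiff_cont Q ze0 k Hk eps Heps) as [de [Hde H]].
    exists de; split; [assumption|]; intros x _; apply H. }
  split; [assumption|].
  (* A cluster point inside the disk is itself the required preimage; only contact with the circle
     has to be refuted. *)
  destruct (Rlt_dec (Cmod ze0) 1) as [Hlt|Hge]; [exists ze0; auto|exfalso].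
  assert (Hze1 : Cmod ze0 = 1%R) by lra.
  destruct (theta_quotient_sdiff F z0 HF0 (HF z0 ltac:(lra)) (HG z0 ltac:(lra))) as [e [He Ee]].
  destruct (boundary_contact om Q (fun z => theta F z / F z) (Cmod z0) z0 ze0 k e
    (proj1 Hz0) eq_refl Hze1 Homd Hsch Hk0 Hk) as [m [Hm Em]].
  - now rewrite Hg0.
  - exact (sdiff_at_base _ _ _ He).
  - exists 1%R; split; [lra|]; intros z Hz _ _; now apply Hom.
  - exact Hcl.
  - destruct (HT ze0 Hze1 Hnin) as [T1 T2]; rewrite (sdiff_C_derive Q ze0 k Hk) in T1, T2.
    destruct (hyp2F1_theta a b c z0 hc ltac:(lra)) as [_ [_ ODE]]; fold F in ODE.
    set (q := Q ze0) in *.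
    assert (EJ : theta (theta F) z0 = F z0 * (m * (ze0 * k) + q * q)).
    { rewrite <- Em, Ee, Hg0; field; assumption. }
    assert (EG : theta F z0 = F z0 * q) by (rewrite <- Hg0; field; assumption).
    rewrite EJ, EG in ODE.
    (* The linear factor [p * Q + a * b] of the hypotheses is exactly [B - A]. *)
    assert (EB : (q + a) * (q + b) - q * (q + c - 1) = (a + b + 1 - c) * q + a * b) by ring.
    apply (no_contact (q * (q + c - 1)) ((q + a) * (q + b)) (ze0 * k) z0 m Hm ltac:(lra)).
    + apply (f_equal (fun x => / F z0 * x)) in ODE.
      match type of ODE with ?l = ?r =>
        transitivity l; [field; assumption|rewrite ODE; field; assumption] end.
    + rewrite EB; exact T1.
    + rewrite EB; exact T2.
Qed.

Theorem theorem1 (a b c : C) (Q : C -> C) (zetas : list C)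
    (hc : forall n : nat, c <> - RtoC (INR n))
    (hQ : class_Q Q zetas) :
  let p := a + b + 1 - c in
  let A := fun z : C => Q z * (Q z + c - 1) in
  let B := fun z : C => (Q z + a) * (Q z + b) in
  let phi := fun z : C => 1 + Q z in
  let f := fun z : C => z * hyp2F1 a b c z in
  let T := fun zeta : C =>
    (- 2 * Re ((p * Q zeta + a * b) * Cconj (zeta * C_derive Q zeta)))%R in
  (forall zeta : C, Cmod zeta = 1%R -> ~ In zeta zetas ->
     (0 < T zeta)%R /\
     ((Cmod (B zeta)) ^ 2 - (Cmod (A zeta)) ^ 2 <= T zeta)%R) ->
  Sstar phi f.
Proof.
  intros p A B phi f T HT.
  pose (F := hyp2F1 a b c).
  destruct (class_Q_univalent_disk Q zetas hQ) as [Hdisk HQu].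
  assert (HQ0 : Q 0 = 0) by apply hQ.
  assert (HF : forall z, Cmod z < 1 -> sdiff F z (C_derive F z)).
  { intros z Hz; now apply (hyp2F1_theta a b c z hc). }
  assert (HG : forall z, Cmod z < 1 -> sdiff (theta F) z (C_derive (theta F) z)).
  { intros z Hz; now apply (hyp2F1_theta a b c z hc). }
  assert (HF1 : F 0 = 1) by now apply hyp2F1_at_0.
  (* The set where the lift exists. It must contain the whole disk; the clause on [F] also yields
     the nonvanishing of [f] off 0 demanded by [Sstar]. *)
  pose (S := fun z => F z <> 0 /\ exists ze, Cmod ze < 1 /\ Q ze = theta F z / F z).
  assert (Hex : forall z, exists ze, S z -> Cmod ze < 1 /\ Q ze = theta F z / F z).
  { intros z; destruct (classic (S z)) as [[H1 [ze H2]]|H].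
    - exists ze; auto.
    - exists 0; intros; contradiction. }
  pose (om := fun z => proj1_sig (constructive_indefinite_description _ (Hex z))).
  assert (Hom : forall z, S z -> F z <> 0 /\ Cmod (om z) < 1 /\ Q (om z) = theta F z / F z).
  { intros z Hz; split; [apply Hz|].
    exact (proj2_sig (constructive_indefinite_description _ (Hex z)) Hz). }
  assert (S0 : S 0).
  { split; [rewrite HF1; apply C1_nz|]; exists 0; split; [rewrite Cmod_0; lra|].
    rewrite HQ0; unfold theta, Cdiv; ring. }
  assert (Hom0 : om 0 = 0).
  { destruct (Hom 0 S0) as [_ [H1 H2]]; apply (proj2 HQu); [exact H1| |].
    - unfold unit_disk; rewrite Cmod_0; lra.
    - rewrite H2, HQ0; unfold theta, Cdiv; ring. }
  (* Nearby values of [theta F / F] are again values of [Q] in the disk, since [Q] is an open map at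
     [ze]. *)
  assert (Sopen : forall z, Cmod z < 1 -> S z -> exists r, 0 < r /\ forall x, Cmod (x - z) < r -> S x).
  { intros z Hz [Fz [ze [Hze Eze]]].
    destruct (class_Q_regular Q zetas ze hQ ltac:(lra) (Hdisk ze Hze)) as [k [Hk Hk0]].
    destruct (sdiff_open Q ze k (1 - Cmod ze) Hk0 Hk ltac:(lra)) as [eta [Heta Hop]].
    destruct (theta_quotient_sdiff F z Fz (HF z Hz) (HG z Hz)) as [e [He _]].
    destruct (sdiff_cont _ _ _ He eta Heta) as [d1 [Hd1 C1]].
    destruct (sdiff_cont _ _ _ (HF z Hz) (Cmod (F z))) as [d2 [Hd2 C2]]; [now apply Cmod_gt_0|].
    exists (Rmin d1 d2); split; [now apply Rmin_pos|]; intros x Hx.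
    pose proof (Rmin_l d1 d2); pose proof (Rmin_r d1 d2).
    split.
    - intros E; specialize (C2 x ltac:(lra)); rewrite E, Cmod_minus_sym in C2.
      replace (F z - 0) with (F z) in C2 by ring; lra.
    - destruct (Hop (theta F x / F x)) as [y [Hy Ey]].
      + rewrite Eze; apply C1; lra.
      + exists y; split; [|assumption]; pose proof (Cmod_rtriangle y ze); lra. }
  assert (Homd : forall z, Cmod z < 1 -> S z -> exists d, sdiff om z d).
  { intros z Hz Sz; destruct (Sopen z Hz Sz) as [r [Hr HS]].
    destruct (theta_quotient_sdiff F z (proj1 Sz) (HF z Hz) (HG z Hz)) as [e [He _]].
    apply (univalent_lift Q _ om z e r Hr HQu He); intros x Hx; now apply Hom, HS. }
  assert (HS : forall z, Cmod z < 1 -> S z).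
  { intros z1 Hz1; apply NNPP; intros Hno.
    destruct (minimal_modulus S z1) as [z0 [Hz01 [Sz0 Hin]]]; [|assumption|].
    { intros z Hz; apply Sopen; lra. }
    assert (Hz0 : 0 < Cmod z0).
    { apply Cmod_gt_0; intros E; apply Sz0; rewrite E; exact S0. }
    apply Sz0.
    apply (no_first_exit a b c Q om zetas z0 hc hQ HT ltac:(lra)).
    - intros z Hz; apply Hom, Hin, Hz.
    - intros z Hz; apply Homd; [lra|now apply Hin].
    - exact Hom0. }
  assert (Hf : forall z, Cmod z < 1 -> sdiff f z (1 * F z + z * C_derive F z)).
  { intros z Hz; exact (sdiff_mult _ _ _ _ _ (sdiff_id z) (HF z Hz)). }
  assert (Hball : forall z x, Cmod (x - z) < 1 - Cmod z -> Cmod x < 1).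
  { intros z x Hx; pose proof (Cmod_rtriangle x z); lra. }
  split; [split; [|split]|split].
  - apply sdiff_analytic_on; intros z Hz; exists (1 - Cmod z)%R; split; [unfold unit_disk in Hz; lra|].
    intros x Hx; eexists; apply Hf, (Hball z), Hx.
  - unfold f; ring.
  - rewrite (sdiff_C_derive f 0 _ (Hf 0 ltac:(rewrite Cmod_0; lra))), HF1; ring.
  - intros z Hz Hz0; unfold f; apply Cmult_neq_0; [assumption|]; exact (proj1 (HS z Hz)).
  - exists om; split; [|split].
    + apply sdiff_analytic_on; intros z Hz; exists (1 - Cmod z)%R.
      split; [unfold unit_disk in Hz; lra|]; intros x Hx.
      assert (Cmod x < 1) by (apply (Hball z), Hx); now apply Homd, HS.
    + intros z Hz; rewrite <- (Rmult_1_r (Cmod (om z))); apply (schwarz om 1); [| |assumption|exact Hz].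
      * intros x Hx; now apply Homd, HS.
      * intros x Hx; left; now apply Hom, HS.
    + intros z Hz; destruct (Hom z (HS z Hz)) as [Fz [_ Qz]]; unfold phi, zdlog; rewrite Qz.
      (* At 0 the conventional value 1 of [zdlog] agrees with [1 + theta F 0 / F 0], because
         [theta F 0 = 0]. *)
      destruct (Ceq_dec z 0) as [->|Hz0].
      * unfold theta, Cdiv; ring.
      * rewrite (sdiff_C_derive f z _ (Hf z Hz)); unfold f, theta; fold (F z).
        change (hyp2F1 a b c z) with (F z); field; auto.
Qed.
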